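(* There is a deterministic polynomial-time algorithm that, given an $\mathsf{NC}^0_3$ circuit $C\colon\{0,1\}^n\to\{0,1\}^m$ with $m\geq\frac{1}{3}\binom{n}{2}+2n$, outputs an element $y\in\{0,1\}^m$ with $y\notin\mathrm{Range}(C)$.
   Context: An $\mathsf{NC}^0_3$ circuit is a multi-output Boolean function $C\colon\{0,1\}^n\to\{0,1\}^m$ in which each output bit depends on at most $3$ input bits, described by listing, for each output, the input bits it reads and its truth table.
   Formalization: The formal statement assumes m > 0, which excludes only n = m = 0, where the unique circuit {0,1}^0 → {0,1}^0 is onto and no y outside Range(C) exists. *)

(* Defs.v *)
From mathcomp Require Import all_boot all_order all_algebra.

Set Implicit Arguments.
Unset Strict Implicit.
Unset Printing Implicit Defensive.

(** * Random access machines with logarithmic cost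

    The model is that of S. A. Cook and R. A. Reckhow, Time bounded random
    access machines, J. Comput. Syst. Sci. 7 (1973), over the natural numbers:
    addition and (truncated) subtraction are the only arithmetic operations,
    and every instruction is charged the bit lengths of the numbers it handles.
    Polynomial time on these machines is polynomial time on Turing machines. *)

Inductive instr : Type :=
| Const of nat & nat        (* Const i v     X_i <- v                      *)
| Plus of nat & nat & nat   (* Plus i j k    X_i <- X_j + X_k              *)
| Minus of nat & nat & nat  (* Minus i j k   X_i <- X_j - X_k, truncated   *)
| Fetch of nat & nat        (* Fetch i j     X_i <- X_(X_j)                *)
| Store of nat & nat        (* Store i j     X_(X_i) <- X_j                *)
| JumpPos of nat & nat      (* JumpPos j l   go to line l if X_j > 0       *)
| Read of nat               (* Read i        X_i <- next input, 0 if none  *)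
| Print of nat.             (* Print i       append X_i to the output      *)

Definition program := seq instr.

Record config := Config {
  pc : nat;
  reg : nat -> nat;
  inp : seq nat;
  out : seq nat }.

Definition init (s : seq nat) : config := Config 0 (fun=> 0) s [::].

Definition upd (r : nat -> nat) (i v : nat) : nat -> nat :=
  fun j => if j == i then v else r j.

Definition exec (a : instr) (c : config) : config :=
  let: Config l r s o := c in
  match a with
  | Const i v => Config l.+1 (upd r i v) s o
  | Plus i j k => Config l.+1 (upd r i (r j + r k)) s o
  | Minus i j k => Config l.+1 (upd r i (r j - r k)) s o
  | Fetch i j => Config l.+1 (upd r i (r (r j))) s o
  | Store i j => Config l.+1 (upd r (r i) (r j)) s o
  | JumpPos j l' => Config (if 0 < r j then l' else l.+1) r s o
  | Read i => Config l.+1 (upd r i (head 0 s)) (behead s) o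
  | Print i => Config l.+1 r s (rcons o (r i))
  end.

Definition bitlen (v : nat) : nat := (trunc_log 2 v).+1.

Definition cost (a : instr) (c : config) : nat :=
  let: Config _ r s _ := c in
  match a with
  | Const _ v => bitlen v
  | Plus _ j k => bitlen (r j) + bitlen (r k)
  | Minus _ j k => bitlen (r j) + bitlen (r k)
  | Fetch _ j => bitlen (r j) + bitlen (r (r j))
  | Store i j => bitlen (r i) + bitlen (r j)
  | JumpPos j _ => bitlen (r j)
  | Read _ => bitlen (head 0 s)
  | Print i => bitlen (r i)
  end.

(* [run p c t c']: started in [c], the program [p] halts (by leaving the list
   of instructions) in [c'], at total cost [t]. *)
Inductive run (p : program) : config -> nat -> config -> Prop :=
| run_halt c : size p <= pc c -> run p c 0 c
| run_step a c t c' : onth p (pc c) = Some a ->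
    run p (exec a c) t c' -> run p c (cost a c + t) c'.

Definition outputs_in_time (p : program) (s o : seq nat) (t : nat) : Prop :=
  exists2 c, run p (init s) t c & out c = o.

Definition input_size (s : seq nat) : nat := sumn (map bitlen s).

(** * NC^0_k circuits *)

Record gate (k n : nat) := Gate {
  reads : seq 'I_n;
  table : seq bool;
  _ : uniq reads;
  _ : size reads <= k;
  _ : size table = 2 ^ size reads }.

Definition circuit (k n m : nat) := m.-tuple (gate k n).

(* least significant bit first *)
Definition nat_of_bits (s : seq bool) : nat := foldr (fun (b : bool) v => b + v.*2) 0 s.

Definition eval_gate k n (g : gate k n) (x : n.-tuple bool) : bool :=
  nth false (table g) (nat_of_bits [seq tnth x i | i <- reads g]).

Definition eval k n m (C : circuit k n m) (x : n.-tuple bool) : m.-tuple bool :=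
  [tuple eval_gate (tnth C j) x | j < m].

Definition encode_bits (s : seq bool) : seq nat := map nat_of_bool s.

Definition encode_gate k n (g : gate k n) : seq nat :=
  size (reads g) :: map val (reads g) ++ encode_bits (table g).

Definition encode_circuit k n m (C : circuit k n m) : seq nat :=
  [:: n, m & flatten (map (@encode_gate k n) C)].

(* Main.v *)
(** Add a constant input [x_n = 0], so that every gate reads exactly three
    variables, and maintain a partition of the variables into classes within
    which they agree up to a known complement.

    Merging: while fixing the outputs of one or two unused gates forces an
    equation [x_p + x_q = c] between different classes, fix them and merge the
    two classes; this uses at most two gates for each class that disappears.

    Linear algebra: among the other gates, whenever [g], or [g + h] for an
    earlier gate [h], is an affine form in the [r] remaining classes, feed the
    form to Gaussian elimination.  If it is independent of the previous forms,
    the output of [g] is chosen so that the form has to vanish; if it is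
    dependent, so that it must not vanish, and then the output has no preimage.

    If no dependent form shows up, at most [2 (n - r)] gates were used for
    merging and at most [r] forms were found.  The remaining gates read three
    distinct classes each, and by an exhaustive check of the pairs of truth
    tables two of them share at most one class, so there are at most
    [r (r - 1) / 6] of them.  In total that is fewer than
    [m] gates, a contradiction.

    The algorithm is written in a small imperative language with arrays and
    bounded loops, in which every program runs in polynomial time, and compiled
    to a random access machine. *)

Require Import Defs.
From mathcomp Require Import all_boot all_order all_algebra.
From mathcomp Require Import zify lra.

Set Implicit Arguments.
Unset Strict Implicit.
Unset Printing Implicit Defensive.

(** The term [C(n,2)/3] of the density is a packing bound: if any two leftover gates share at most
    one class, each of them owns three pairs of classes. The rest must fit into [2n]: a vanished
    class pays for two gates and a remaining class for one form, so at most [2n - r] gates go there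
    and [r > 0] gives strictness. For [r = 0] strictness comes from [C(n,2) > 0], and for [n <= 1]
    from merging with single gates only.

    Merging is run to stability before any form is taken, because forms are written in terms of the
    classes. A form pairs [g] with an earlier [h], whose output is already settled when that of [g]
    is chosen.

    The tests enumerate all values of the at most six variables involved, so they miss no forced
    equation and no affine form. A gate that survives both stages is therefore wild in the sense of
    the check on truth tables, once complement bits are absorbed into its table.

    The linear stage does not stop at a dependent form: from then on every assignment already
    contradicts some settled output, and later choices cannot repair this. *)

(** * The imperative language: syntax and semantics *)

(* Input variables and tables of the gates; class and complement bit of the
   variables; gates used for merging and chosen outputs; rows of the echelon
   form, which of them are present, and the form being reduced; gates whose
   form has been processed. *)
Inductive arr := Rd | Tb | Cls | Par | Used | Ys | Row | Has | Vec | Dn.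

Definition arr_id (a : arr) : nat :=
  match a with Rd => 0 | Tb => 1 | Cls => 2 | Par => 3 | Used => 4 | Ys => 5
             | Row => 6 | Has => 7 | Vec => 8 | Dn => 9 end.

Inductive expr :=
| EN of nat
| EX of nat
| EA of arr & expr
| EAdd of expr & expr
| ESub of expr & expr.

Inductive cmd :=
| Skip
| Asg of nat & expr
| Sto of arr & expr & expr
| Inp of nat
| Out of expr
| Seq of cmd & cmd
| When of expr & cmd
| For of nat & expr & cmd.

Record state := State {
  sx : nat -> nat;
  sa : arr -> nat -> nat;
  si : seq nat;
  so : seq nat }.

Definition setx (s : state) k v := State (upd (sx s) k v) (sa s) (si s) (so s).
Definition seta (s : state) a i v :=
  State (sx s) (fun b => if arr_id b == arr_id a then upd (sa s b) i v else sa s b) (si s) (so s).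

Fixpoint ev (s : state) (e : expr) : nat :=
  match e with
  | EN v => v
  | EX k => sx s k
  | EA a e1 => sa s a (ev s e1)
  | EAdd e1 e2 => ev s e1 + ev s e2
  | ESub e1 e2 => ev s e1 - ev s e2
  end.

(* Every value written to a variable or an array is cut off at [L]: this keeps
   all stored numbers small, whatever the program. *)
Fixpoint sem (L : nat) (c : cmd) (s : state) : state :=
  match c with
  | Skip => s
  | Asg k e => setx s k (minn (ev s e) L)
  | Sto a e1 e2 => seta s a (ev s e1) (minn (ev s e2) L)
  | Inp k => State (upd (sx s) k (head 0 (si s))) (sa s) (behead (si s)) (so s)
  | Out e => State (sx s) (sa s) (si s) (rcons (so s) (ev s e))
  | Seq c1 c2 => sem L c2 (sem L c1 s)
  | When e c1 => if 0 < ev s e then sem L c1 s else s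
  | For k e c1 => foldl (fun s' i => sem L c1 (setx s' k i)) s (iota 0 (minn (ev s e) L))
  end.

(** * Compilation to random access machines *)

(* Register [16 i + k] is cell [i] of memory bank [k]: variables, temporaries,
   loop bounds, loop counters, the cut-off [L], and one bank for each array. *)
Definition loc (k i : nat) := 16 * i + k.
Notation rV i := (loc 0 i).
Notation rT i := (loc 1 i).
Notation rB i := (loc 2 i).
Notation rC i := (loc 3 i).
Notation rL := (loc 4 0).
Definition rA (a : arr) i := loc (5 + arr_id a) i.

Lemma arr_id_lt a : arr_id a < 10. Proof. by case: a. Qed.

Lemma loc_eq k i k' i' : k < 16 -> k' < 16 -> (loc k i == loc k' i') = (k == k') && (i == i').
Proof. by rewrite /loc => h h'; apply/eqP/andP => [e|[/eqP-> /eqP->]] //; split; apply/eqP; lia. Qed.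

(** Four doublings supply the factor 16 of [loc]; the number of the bank is added last. *)
Definition addr_code (a : arr) d : program :=
  [:: Plus (rT d) (rT d) (rT d); Plus (rT d) (rT d) (rT d); Plus (rT d) (rT d) (rT d);
      Plus (rT d) (rT d) (rT d); Const (rT d.+1) (5 + arr_id a); Plus (rT d) (rT d) (rT d.+1)].

(** There is no copy instruction, so the target is cleared first; [i] and [j] have to differ. *)
Definition move_code i j : program := [:: Const i 0; Plus i i j].

(** Stack discipline: the value is left in [rT d] and only cells [rT i] with [d <= i] are
    overwritten, so a left operand survives the evaluation of the right one. *)
Fixpoint compile_expr d (e : expr) : program :=
  match e with
  | EN v => [:: Const (rT d) v]
  | EX k => move_code (rT d) (rV k)
  | EA a e1 => compile_expr d e1 ++ addr_code a d ++ [:: Fetch (rT d) (rT d)]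
  | EAdd e1 e2 => compile_expr d e1 ++ compile_expr d.+1 e2 ++ [:: Plus (rT d) (rT d) (rT d.+1)]
  | ESub e1 e2 => compile_expr d e1 ++ compile_expr d.+1 e2 ++ [:: Minus (rT d) (rT d) (rT d.+1)]
  end.

(** With truncated subtraction, [x - (x - L)] is the minimum of [x] and [L]. *)
Definition clip_code : program :=
  [:: Minus (rT 1) (rT 0) rL; Minus (rT 0) (rT 0) (rT 1)].

Definition for_head d e : program :=
  compile_expr 0 e ++ clip_code ++ move_code (rB d) (rT 0) ++ [:: Const (rC d) 0].

(** In [sem] a loop runs over a fixed list, whatever its body does to the loop variable. Hence bound
    and counter live in banks of their own, indexed by the nesting depth, and the counter is copied
    to the variable in every round. The jump leaves the loop when [1 - (bound - counter)] is
    positive. *)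
Definition for_test d k l : program :=
  [:: Minus (rT 0) (rB d) (rC d); Const (rT 1) 1; Minus (rT 0) (rT 1) (rT 0);
      JumpPos (rT 0) l] ++ move_code (rV k) (rC d).

Definition for_next d l : program :=
  [:: Const (rT 0) 1; Plus (rC d) (rC d) (rT 0); JumpPos (rT 0) l].

(** Jumps are absolute, so the address [l] of the first instruction is a parameter; [d] is the loop
    depth. [When] evaluates the negated test because [JumpPos] skips the body on a positive value.
    The constants 6 and 3 are the lengths of [for_test] and [for_next]. *)
Fixpoint compile d l (c : cmd) : program :=
  match c with
  | Skip => [::]
  | Asg k e => compile_expr 0 e ++ clip_code ++ move_code (rV k) (rT 0)
  | Sto a e1 e2 =>
      compile_expr 0 e2 ++ clip_code ++ compile_expr 1 e1 ++ addr_code a 1 ++ [:: Store (rT 1) (rT 0)]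
  | Inp k => [:: Read (rV k)]
  | Out e => compile_expr 0 e ++ [:: Print (rT 0)]
  | Seq c1 c2 => let q := compile d l c1 in q ++ compile d (l + size q) c2
  | When e c1 =>
      let q := compile_expr 0 (ESub (EN 1) e) in
      let q1 := compile d (l + (size q).+1) c1 in
      q ++ JumpPos (rT 0) (l + (size q).+1 + size q1) :: q1
  | For k e c1 =>
      let q := for_head d e in
      let l1 := l + size q in
      let q1 := compile d.+1 (l1 + 6) c1 in
      q ++ for_test d k (l1 + 6 + size q1 + 3) ++ q1 ++ for_next d l1
  end.

(** * Straight-line code *)

(** [run] relates a configuration only to a halting one, so a segment of a run is described by what
    it adds to every run that continues it. *)
Definition reach p c N c' :=
  exists2 t, t <= N & forall t' c'', run p c' t' c'' -> run p c (t + t') c''.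

Lemma reach_refl p c N : reach p c N c.
Proof. by exists 0. Qed.

Lemma reach_trans p c1 N1 c2 N2 c3 N :
  reach p c1 N1 c2 -> reach p c2 N2 c3 -> N1 + N2 <= N -> reach p c1 N c3.
Proof.
move=> [t1 h1 r1] [t2 h2 r2] hN; exists (t1 + t2); first by lia.
by move=> t' c'' /r2 /r1; rewrite addnA.
Qed.

Lemma reach_step p c a N : onth p (pc c) = Some a -> cost a c <= N -> reach p c N (exec a c).
Proof. by move=> h hN; exists (cost a c) => // t' c''; apply: run_step. Qed.

Definition code_at (p : program) l (q : program) :=
  forall i, i < size q -> onth p (l + i) = onth q i.

Lemma code_at_cat p l q1 q2 :
  code_at p l (q1 ++ q2) -> code_at p l q1 /\ code_at p (l + size q1) q2.
Proof.
move=> h; split=> i hi.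
  by rewrite h ?size_cat ?ltn_addr // onth_cat hi.
by rewrite -addnA h ?size_cat ?ltn_add2l // onth_cat ltnNge leq_addr /= addKn.
Qed.

Lemma code_at_cons p l a q : code_at p l (a :: q) -> onth p l = Some a /\ code_at p l.+1 q.
Proof.
move=> h; split; first by have := h 0 isT; rewrite addn0.
by move=> i hi; rewrite addSnnS h.
Qed.

Definition plain (a : instr) :=
  match a with Const _ _ | Plus _ _ _ | Minus _ _ _ | Fetch _ _ | Store _ _ => true | _ => false end.

Definition exec_reg (r : nat -> nat) (a : instr) : nat -> nat := reg (exec a (Config 0 r [::] [::])).
Definition cost_reg (r : nat -> nat) (a : instr) : nat := cost a (Config 0 r [::] [::]).
Definition exec_regs := foldl exec_reg.
Fixpoint cost_regs (r : nat -> nat) (q : program) : nat :=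
  if q is a :: q' then cost_reg r a + cost_regs (exec_reg r a) q' else 0.

Lemma exec_regs_cat r q1 q2 : exec_regs r (q1 ++ q2) = exec_regs (exec_regs r q1) q2.
Proof. exact: foldl_cat. Qed.

Lemma cost_regs_cat r q1 q2 :
  cost_regs r (q1 ++ q2) = cost_regs r q1 + cost_regs (exec_regs r q1) q2.
Proof. by elim: q1 r => //= a q IH r; rewrite IH addnA. Qed.

Lemma reach_plain p l r i o q N : all plain q -> code_at p l q -> cost_regs r q <= N ->
  reach p (Config l r i o) N (Config (l + size q) (exec_regs r q) i o).
Proof.
elim: q l r N => [|a q IH] l r N /=; first by rewrite addn0 => *; apply: reach_refl.
move=> /andP[ha hq] /code_at_cons[h1 h2] hN.
rewrite addnS -addSn.
apply: (@reach_trans _ _ (cost_reg r a) (Config l.+1 (exec_reg r a) i o) (cost_regs (exec_reg r a) q)) => //.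
  have := @reach_step p (Config l r i o) a (cost_reg r a) h1.
  by case: a ha {h1 h2 hN} => //= [??|???|???|??|??] _; apply.
exact: IH.
Qed.

Lemma plain_expr d e : all plain (compile_expr d e).
Proof.
elim: e d => //= [a e IH|e1 IH1 e2 IH2|e1 IH1 e2 IH2] d; rewrite !all_cat ?IH ?IH1 ?IH2 //.
Qed.

(** A crude bound, but enough: stored numbers stay below the cut-off, which will be linear in the
    input size. *)
Lemma bitlen_le v : bitlen v <= v.+1.
Proof.
rewrite /bitlen ltnS; case: v => [|v]; first by rewrite trunc_log0.
by have := trunc_logP (isT : 1 < 2) (isT : 0 < v.+1); have := ltn_expl (trunc_log 2 v.+1) (isT : 1 < 2); lia.
Qed.

(** * Correctness of the compiler *)

(** Only stored values are cut off; inside an expression sums may exceed [B], but by an amount fixed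
    by its syntax. *)
Fixpoint bound_expr B (e : expr) : nat :=
  match e with
  | EN v => v
  | EX k => B
  | EA a e1 => B
  | EAdd e1 e2 | ESub e1 e2 => bound_expr B e1 + bound_expr B e2
  end.

Fixpoint cost_expr B (e : expr) : nat :=
  match e with
  | EN v => v.+1
  | EX k => B + 3
  | EA a e1 => cost_expr B e1 + 100 * (bound_expr B e1 + B + 20)
  | EAdd e1 e2 | ESub e1 e2 =>
      cost_expr B e1 + cost_expr B e2 + bound_expr B e1 + bound_expr B e2 + 2
  end.

Definition agree (r : nat -> nat) (s : state) :=
  (forall k, r (rV k) = sx s k) /\ (forall a i, r (rA a i) = sa s a i).

Definition bounded B (s : state) :=
  [/\ forall k, sx s k <= B, forall a i, sa s a i <= B & all (leq^~ B) (si s)].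

Definition temp_from d j := exists2 i, d <= i & j = rT i.

Lemma updE r i v j : upd r i v j = if j == i then v else r j. Proof. by []. Qed.

Lemma exec_regs_nil r : exec_regs r [::] = r. Proof. by []. Qed.
Lemma exec_regs_cons r a q : exec_regs r (a :: q) = exec_regs (exec_reg r a) q. Proof. by []. Qed.
Lemma cost_regs_nil r : cost_regs r [::] = 0. Proof. by []. Qed.
Lemma cost_regs_cons r a q : cost_regs r (a :: q) = cost_reg r a + cost_regs (exec_reg r a) q.
Proof. by []. Qed.

Definition exec_regE := (exec_regs_cons, exec_regs_nil).
Definition cost_regE := (cost_regs_cons, cost_regs_nil).

Lemma agree_frame r r' s : agree r s -> (forall j, ~ temp_from 0 j -> r' j = r j) -> agree r' s.
Proof.
move=> [h1 h2] h; split=> [k|a i].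
  by rewrite h // => -[i _ /eqP]; rewrite loc_eq.
rewrite h // => -[j _ /eqP]; rewrite loc_eq //; have := arr_id_lt a; lia.
Qed.

Lemma ntemp_from_neq d j i : ~ temp_from d j -> d <= i -> (j == rT i) = false.
Proof. by move=> h hi; apply/eqP=> e; apply: h; exists i. Qed.

Lemma temp_fromS d j : ~ temp_from d j -> ~ temp_from d.+1 j.
Proof. by move=> h [i hi e]; apply: h; exists i => //; lia. Qed.

Lemma not_temp_lt d i : i < d -> ~ temp_from d (rT i).
Proof. by move=> hi [j hj /eqP]; rewrite loc_eq //= => /eqP e; lia. Qed.

Ltac bitlens := repeat match goal with
  | |- context [bitlen ?v] => lazymatch goal with
     | h : bitlen v <= _ |- _ => fail
     | _ => have := bitlen_le v; generalize (bitlen v); intro; intro end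
  end.

Lemma addr_code_ok a d r : let r' := exec_regs r (addr_code a d) in
  [/\ r' (rT d) = rA a (r (rT d)), forall j, ~ temp_from d j -> r' j = r j
    & cost_regs r (addr_code a d) <= 80 * (r (rT d) + 18)].
Proof.
have h1 : (rT d == rT d.+1) = false by rewrite loc_eq //=; lia.
have h2 : (rT d.+1 == rT d) = false by rewrite eq_sym.
split.
- rewrite /addr_code !exec_regE /exec_reg /= !updE !eqxx ?h1 ?h2 /rA /loc; lia.
- move=> j hj; rewrite /addr_code !exec_regE /exec_reg /= !updE !(ntemp_from_neq hj) //; lia.
- rewrite /addr_code !cost_regE /cost_reg /exec_reg /= !updE !eqxx ?h1 ?h2.
  have := arr_id_lt a; bitlens; lia.
Qed.

Lemma compile_expr_EA d a e :
  compile_expr d (EA a e) = compile_expr d e ++ addr_code a d ++ [:: Fetch (rT d) (rT d)].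
Proof. by []. Qed.

Lemma compile_expr_ok B s e r d : agree r s -> bounded B s ->
  let r' := exec_regs r (compile_expr d e) in
  [/\ r' (rT d) = ev s e, forall j, ~ temp_from d j -> r' j = r j,
      ev s e <= bound_expr B e & cost_regs r (compile_expr d e) <= cost_expr B e].
Proof.
move=> hr [b1 b2 b3] /=.
elim: e d r hr => [v|k|a e IH|e1 IH1 e2 IH2|e1 IH1 e2 IH2] d r hr; rewrite ?compile_expr_EA ?[compile_expr d (_ _)]/=.
- rewrite !exec_regE !cost_regE /exec_reg /cost_reg /=; split=> //.
  + by rewrite updE eqxx.
  + by move=> j hj; rewrite updE (ntemp_from_neq hj).
  + bitlens; lia.
- have h : (rV k == rT d) = false by rewrite loc_eq.
  rewrite !exec_regE !cost_regE /exec_reg /cost_reg /=; split=> //.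
  + by rewrite !updE !eqxx h (hr.1 k).
  + by move=> j hj; rewrite !updE !(ntemp_from_neq hj).
  + by rewrite !updE eqxx h (hr.1 k); move: (b1 k); bitlens; lia.
- have [v1 f1 w1 c1] := IH d r hr.
  have hr1 : agree (exec_regs r (compile_expr d e)) s.
    by apply: agree_frame hr _ => j hj; apply: f1 => -[i hi hij]; apply: hj; exists i.
  have := addr_code_ok a d (exec_regs r (compile_expr d e)); rewrite v1.
  rewrite !exec_regs_cat !cost_regs_cat.
  set r1 := exec_regs r _ in v1 f1 hr1 *; set r2 := exec_regs r1 _ => -[v2 f2 c2].
  have e2 : r2 (rA a (ev s e)) = sa s a (ev s e).
    rewrite f2; first exact: hr1.2.
    by move=> [j _ /eqP]; rewrite loc_eq //; have := arr_id_lt a; lia.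
  set k2 := cost_regs r1 (addr_code a d) in c2 *.
  rewrite !exec_regE !cost_regE /exec_reg /cost_reg [cost _ _]/=; split.
  + by rewrite /= updE eqxx v2 e2.
  + by move=> j hj; rewrite /= updE (ntemp_from_neq hj) // f2 // f1.
  + exact: b2.
  + rewrite v2 e2 /=; move: (b2 a (ev s e)) (arr_id_lt a) => hb ha.
    have : rA a (ev s e) <= 16 * ev s e + 15 by rewrite /rA /loc; lia.
    bitlens; lia.
- have [v1 f1 w1 c1] := IH1 d r hr.
  have hr1 : agree (exec_regs r (compile_expr d e1)) s.
    by apply: agree_frame hr _ => j hj; apply: f1 => -[i hi hij]; apply: hj; exists i.
  have [v2 f2 w2 c2] := IH2 d.+1 _ hr1.
  rewrite !exec_regs_cat !cost_regs_cat.
  set r1 := exec_regs r _ in v1 f1 hr1 v2 f2 c2 *; set r2 := exec_regs r1 _ in v2 f2 *.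
  have e1' : r2 (rT d) = ev s e1 by rewrite f2 //; apply: not_temp_lt.
  rewrite !exec_regE !cost_regE /exec_reg /cost_reg /= e1' v2; split.
  + by rewrite updE eqxx.
  + by move=> j hj; rewrite updE (ntemp_from_neq hj) // f2 ?f1 //; apply: temp_fromS.
  + lia.
  + bitlens; lia.
- have [v1 f1 w1 c1] := IH1 d r hr.
  have hr1 : agree (exec_regs r (compile_expr d e1)) s.
    by apply: agree_frame hr _ => j hj; apply: f1 => -[i hi hij]; apply: hj; exists i.
  have [v2 f2 w2 c2] := IH2 d.+1 _ hr1.
  rewrite !exec_regs_cat !cost_regs_cat.
  set r1 := exec_regs r _ in v1 f1 hr1 v2 f2 c2 *; set r2 := exec_regs r1 _ in v2 f2 *.
  have e1' : r2 (rT d) = ev s e1 by rewrite f2 //; apply: not_temp_lt.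
  rewrite !exec_regE !cost_regE /exec_reg /cost_reg /= e1' v2; split.
  + by rewrite updE eqxx.
  + by move=> j hj; rewrite updE (ntemp_from_neq hj) // f2 ?f1 //; apply: temp_fromS.
  + lia.
  + bitlens; lia.
Qed.

Definition clipped_expr e := compile_expr 0 e ++ clip_code.

Lemma clipped_expr_ok L s e r : agree r s -> bounded L s -> r rL = L ->
  let r' := exec_regs r (clipped_expr e) in
  [/\ r' (rT 0) = minn (ev s e) L, forall j, ~ temp_from 0 j -> r' j = r j
    & cost_regs r (clipped_expr e) <= cost_expr L e + 5 * (bound_expr L e + L + 2)].
Proof.
move=> hr hb hL; have [v1 f1 w1 c1] := compile_expr_ok e 0 hr hb.
rewrite /clipped_expr !exec_regs_cat !cost_regs_cat.
set r1 := exec_regs r _ in v1 f1 *.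
have hL1 : r1 rL = L by rewrite f1 // => -[i _ /eqP]; rewrite loc_eq.
rewrite /clip_code !exec_regE !cost_regE /exec_reg /cost_reg /=; split.
- by rewrite !updE /= v1 hL1 minnE.
- by move=> j hj; rewrite !updE !(ntemp_from_neq hj) // f1.
- rewrite !updE /= v1 hL1; bitlens; lia.
Qed.

(** What code at depth [d] must leave alone: the cut-off, and the bounds and counters of the
    enclosing loops. *)
Definition frame d (r r' : nat -> nat) :=
  r' rL = r rL /\ forall i, i < d -> r' (rB i) = r (rB i) /\ r' (rC i) = r (rC i).

Lemma frame_trans d r1 r2 r3 : frame d r1 r2 -> frame d r2 r3 -> frame d r1 r3.
Proof.
by move=> [h1 h2] [h3 h4]; split=> [|i hi]; [rewrite h3|case: (h2 i hi) (h4 i hi) => <- <- []].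
Qed.

Lemma frame_S d r r' : frame d.+1 r r' -> frame d r r'.
Proof. by move=> [h1 h2]; split=> // i hi; apply: h2; lia. Qed.

Lemma frame_temp d r r' : (forall j, ~ temp_from 0 j -> r' j = r j) -> frame d r r'.
Proof. by move=> h; split=> [|i hi]; rewrite !h // => -[j _ /eqP]; rewrite loc_eq. Qed.

Fixpoint cost_cmd B (c : cmd) : nat :=
  match c with
  | Skip => 0
  | Asg k e => cost_expr B e + 5 * (bound_expr B e + B + 2) + B + 3
  | Sto a e1 e2 => cost_expr B e2 + 5 * (bound_expr B e2 + B + 2) + cost_expr B e1
                   + 100 * (bound_expr B e1 + B + 20)
  | Inp k => B + 1
  | Out e => cost_expr B e + bound_expr B e + 1
  | Seq c1 c2 => cost_cmd B c1 + cost_cmd B c2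
  | When e c1 => cost_expr B (ESub (EN 1) e) + 2 + cost_cmd B c1
  | For k e c1 => cost_expr B e + 5 * (bound_expr B e + B + 2) + 4 * B + 20
                  + B * (cost_cmd B c1 + 10 * B + 40)
  end.

Lemma bounded_sem L c s : bounded L s -> bounded L (sem L c s).
Proof.
elim: c s => [|k e|a e1 e2|k|e|c1 IH1 c2 IH2|e c1 IH1|k e c1 IH1] s hb //=.
- case: hb => h1 h2 h3; split=> //= j; rewrite updE; case: eqP => // _; exact: geq_minr.
- case: hb => h1 h2 h3; split=> //= b i; case: eqP => // _; rewrite updE; case: eqP => // _.
  exact: geq_minr.
- case: hb => h1 h2; case: (si s) => [|v q] /=.
    by move=> _; split=> //= j; rewrite updE; case: eqP.
  by move=> /andP[h3 h4]; split=> //= j; rewrite updE; case: eqP.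
- by apply: IH2; apply: IH1.
- by case: ifP => // _; apply: IH1.
- have : all (leq^~ L) (iota 0 (minn (ev s e) L)).
    apply/allP=> i; rewrite mem_iota /=; have := geq_minr (ev s e) L; lia.
  move: (iota _ _) => l; elim: l s hb => //= i q IH s hb /andP[hi hq]; apply: IH => //; apply: IH1.
  by case: hb => h1 h2 h3; split=> //= j; rewrite updE; case: eqP.
Qed.

(** The cost is bounded through [L] and the syntax of [c] alone, since stored numbers are at most
    [L] and each loop makes at most [L] rounds. *)
Lemma compile_ok L p c d l r s : code_at p l (compile d l c) ->
  agree r s -> bounded L s -> r rL = L ->
  let s' := sem L c s in
  exists r', [/\ reach p (Config l r (si s) (so s)) (cost_cmd L c)
                   (Config (l + size (compile d l c)) r' (si s') (so s')),
               agree r' s' & frame d r r'].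
Proof.
elim: c d l r s => [|k e|a e1 e2|k|e|c1 IH1 c2 IH2|e c1 IH1|k e c1 IH1] d l r s hc hr hb hL.
- by exists r; split=> //=; rewrite addn0; apply: reach_refl.
- have [v1 f1 c1] := clipped_expr_ok e hr hb hL.
  have hr1 := agree_frame hr f1.
  exists (exec_regs r (compile d l (Asg k e))).
  have -> : compile d l (Asg k e) = clipped_expr e ++ move_code (rV k) (rT 0) by rewrite /clipped_expr -catA.
  have hx : exec_regs r (clipped_expr e ++ move_code (rV k) (rT 0)) =1
            upd (exec_regs r (clipped_expr e)) (rV k) (minn (ev s e) L).
    move=> j; rewrite exec_regs_cat; set r1 := exec_regs r _ in v1 *.
    rewrite /move_code !exec_regE /exec_reg /= !updE eqxx loc_eq //= v1.
    by case: eqP.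
  split.
  + rewrite -[so _]/(so s) -[si _]/(si s).
    apply: reach_plain => //.
    * by rewrite /clipped_expr !all_cat plain_expr.
    * by move: hc; rewrite /clipped_expr -catA.
    * rewrite cost_regs_cat; move: (exec_regs _ _) v1 c1 => r1 v1 c1 /=.
      rewrite /cost_reg /exec_reg /= !updE eqxx loc_eq //= v1.
      have := geq_minr (ev s e) L; bitlens; lia.
  + split=> [j|a i]; rewrite hx updE.
      by rewrite loc_eq //= updE; case: eqP => // _; apply: hr1.1.
    rewrite loc_eq //=; last by have := arr_id_lt a; lia.
    exact: hr1.2.
  + have [g1 g2] := frame_temp d f1.
    by split=> [|i hi]; rewrite !hx !updE !loc_eq //=; apply: g2.
- have [v1 f1 c1] := clipped_expr_ok e2 hr hb hL.
  have hr1 := agree_frame hr f1.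
  exists (exec_regs r (compile d l (Sto a e1 e2))).
  have E : compile d l (Sto a e1 e2) =
    clipped_expr e2 ++ compile_expr 1 e1 ++ addr_code a 1 ++ [:: Store (rT 1) (rT 0)].
    by rewrite /clipped_expr -catA.
  rewrite E in hc *; move: hc; rewrite -[so _]/(so s) -[si _]/(si s) => hc.
  have [v2 f2 w2 c2] := compile_expr_ok e1 1 hr1 hb.
  have [v3 f3 c3] := addr_code_ok a 1 (exec_regs (exec_regs r (clipped_expr e2)) (compile_expr 1 e1)).
  have f123 j : ~ temp_from 0 j ->
      exec_regs (exec_regs (exec_regs r (clipped_expr e2)) (compile_expr 1 e1)) (addr_code a 1) j = r j.
    by move=> hj; rewrite f3 ?f2 ?f1 //; apply: temp_fromS.
  have v0 : exec_regs (exec_regs (exec_regs r (clipped_expr e2)) (compile_expr 1 e1)) (addr_code a 1) (rT 0)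
       = minn (ev s e2) L.
    by rewrite f3 ?f2 ?v1 //; apply: not_temp_lt.
  split.
  + apply: reach_plain => //; first by rewrite /clipped_expr !all_cat !plain_expr.
    rewrite 3!cost_regs_cat; set r3 := exec_regs _ (addr_code a 1) in v3 v0 *.
    have -> : cost_regs r3 [:: Store (rT 1) (rT 0)] = bitlen (r3 (rT 1)) + bitlen (r3 (rT 0)).
      by rewrite /= addn0.
    rewrite v3 v0 v2; move: c3; rewrite v2 => c3; have := arr_id_lt a.
    have : rA a (ev s e1) <= 16 * ev s e1 + 15.
      by have := arr_id_lt a; rewrite /rA /loc; lia.
    have := geq_minr (ev s e2) L; rewrite [cost_cmd _ _]/=; bitlens; lia.
  + have hr3 := agree_frame hr f123.
    rewrite 3!exec_regs_cat; move: (exec_regs (exec_regs _ _) (addr_code a 1)) v3 hr3 v0 => r3 v3 hr3 v0.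
    split=> [k|b i].
      rewrite /= /exec_reg /= updE v3 loc_eq //=; last by have := arr_id_lt a; lia.
      by rewrite -hr3.1.
    rewrite /= /exec_reg /= updE v3 v2 v0 loc_eq; [|have := arr_id_lt b; lia|have := arr_id_lt a; lia].
    rewrite eqn_add2l; case: eqP => /= _; last exact: hr3.2.
    by rewrite updE; case: eqP => // _; exact: hr3.2.
  + have [g1 g2] := frame_temp d f123.
    rewrite 3!exec_regs_cat; move: (exec_regs (exec_regs _ _) (addr_code a 1)) v3 g1 g2 => r3 v3 g1 g2.
    have ha := arr_id_lt a.
    split=> [|i hi]; rewrite /= /exec_reg /= !updE v3 !loc_eq //=; try lia.
      exact: g2.
- exists (upd r (rV k) (head 0 (si s))); split.
  + case/code_at_cons: hc => hc _; rewrite [_ + _]addn1.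
    rewrite -[Config l.+1 _ _ _]/(exec (Read (rV k)) (Config l r (si s) (so s))).
    apply: reach_step => //=; case: hb => _ _; case: (si s) => [|v q] /=; first by bitlens; lia.
    by move=> /andP[hv _]; bitlens; lia.
  + split=> [j|a i]; rewrite updE.
      by rewrite loc_eq //= updE; case: eqP => // _; apply: hr.1.
    rewrite loc_eq //=; last by have := arr_id_lt a; lia.
    exact: hr.2.
  + by split=> [|i hi]; rewrite !updE !loc_eq.
- case/code_at_cat: hc => hc1 /code_at_cons[hc2 _].
  have [v1 f1 w1 c1] := compile_expr_ok e 0 hr hb.
  exists (exec_regs r (compile_expr 0 e)); split.
  + apply: (@reach_trans _ _ (cost_expr L e) (Config (l + size (compile_expr 0 e)) (exec_regs r (compile_expr 0 e)) (si s) (so s)) (bound_expr L e + 1)).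
    * exact: reach_plain (plain_expr _ _) _ _.
    * rewrite size_cat addnA [size [:: _]]/=.
      have := @reach_step p (Config (l + size (compile_expr 0 e)) (exec_regs r (compile_expr 0 e)) (si s) (so s)) _ (bound_expr L e + 1) hc2.
      by rewrite /= -[(l + _).+1]addn1 v1; apply; bitlens; lia.
    * by rewrite /=; lia.
  + exact: agree_frame hr f1.
  + exact: frame_temp.
- case/code_at_cat: hc => hc1 hc2.
  have [r1 [h1 a1 f1]] := IH1 _ _ _ _ hc1 hr hb hL.
  have [r2 [h2 a2 f2]] := IH2 _ _ _ _ hc2 a1 (bounded_sem _ hb) (etrans f1.1 hL).
  exists r2; split=> //; last exact: frame_trans f1 f2.
  by rewrite size_cat addnA; apply: reach_trans h1 h2 _.
- have E : compile d l (When e c1) = let q := compile_expr 0 (ESub (EN 1) e) in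
      let q1 := compile d (l + (size q).+1) c1 in
      q ++ JumpPos (rT 0) (l + (size q).+1 + size q1) :: q1 by [].
  rewrite E in hc *; move: hc => {E}; cbv zeta; set e' := ESub _ _; set q := compile_expr 0 e' => hc.
  case/code_at_cat: hc => hc1 /code_at_cons[hc2 hc3].
  have [v1 f1 w1 k1] := compile_expr_ok e' 0 hr hb.
  have g1 := frame_temp d f1.
  rewrite -/q in v1 f1 k1 g1.
  have R1 : reach p (Config l r (si s) (so s)) (cost_expr L e')
               (Config (l + size q) (exec_regs r q) (si s) (so s)).
    exact: reach_plain (plain_expr _ _) _ _.
  have R2 := @reach_step p (Config (l + size q) (exec_regs r q) (si s) (so s)) _ 2 hc2.
  have hr1 := agree_frame hr f1.
  move: (exec_regs r q) v1 f1 g1 R1 R2 hr1 => r1 v1 f1 g1 R1 R2 hr1.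
  move: R2; rewrite /= v1 => R2.
  have {}R2 := reach_trans R1 (R2 _) (leqnn _).
  have hbit : bitlen (1 - ev s e) <= 2 by bitlens; lia.
  have hpc : l + size (q ++ JumpPos (rT 0) (l + (size q).+1 + size (compile d (l + (size q).+1) c1))
                      :: compile d (l + (size q).+1) c1) = l + (size q).+1 + size (compile d (l + (size q).+1) c1).
    by rewrite size_cat /=; lia.
  rewrite hpc; case: (posnP (ev s e)) => h0.
    exists r1; split=> //.
    move: (R2 hbit); rewrite /= h0 /= => R3.
    by apply: (reach_trans R3 (reach_refl _ _ 0)); rewrite /= -/e'; lia.
  move: hc3; rewrite -addnS => hc3.
  have [r2 [h2 a2 f2]] := IH1 _ _ _ _ hc3 hr1 hb (etrans g1.1 hL).
  exists r2; split=> //; last exact: frame_trans g1 f2.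
  move: (R2 hbit); rewrite subn_gt0 ltnNge h0 /= -addnS => R3.
  by apply: (reach_trans R3 h2); rewrite /= -/e'; lia.
- have E : compile d l (For k e c1) = let q := for_head d e in
      let l1 := l + size q in
      let q1 := compile d.+1 (l1 + 6) c1 in
      q ++ for_test d k (l1 + 6 + size q1 + 3) ++ q1 ++ for_next d l1 by [].
  have hq : for_head d e = clipped_expr e ++ (move_code (rB d) (rT 0) ++ [:: Const (rC d) 0]).
    by rewrite /clipped_expr -catA.
  rewrite E in hc *; move: hc => {E}; set q := for_head _ _ in hq *; cbv zeta.
  set l1 := l + size q; set q1 := compile d.+1 _ _; set lend := l1 + _ + _ + _ => hc.
  case/code_at_cat: hc; rewrite -/l1 => hcq /code_at_cat[hct].
  rewrite [size (for_test _ _ _)]/= => /code_at_cat[hcb hcn].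
  have -> : l + size (q ++ for_test d k lend ++ q1 ++ for_next d l1) = lend.
    rewrite (size_cat q) (size_cat (for_test _ _ _)) (size_cat q1) [size (for_test _ _ _)]/= [size (for_next _ _)]/= /lend /l1.
    by move: (size q) (size q1) => u v; lia.
  have [v1 f1 k1] := clipped_expr_ok e hr hb hL.
  set N := minn (ev s e) L in v1.
  have hN : N <= L by apply: geq_minr.
  have test i s0 r0 : agree r0 s0 -> r0 (rB d) = N -> r0 (rC d) = i -> i <= N ->
      exists r1, [/\ reach p (Config l1 r0 (si s0) (so s0)) (3 * L + 9)
                       (Config (if i < N then l1.+4 else lend) r1 (si s0) (so s0)),
                    agree r1 s0 & frame d.+1 r0 r1].
    move=> ha hB hC hi.
    pose qt := [:: Minus (rT 0) (rB d) (rC d); Const (rT 1) 1; Minus (rT 0) (rT 1) (rT 0)].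
    have ft j : ~ temp_from 0 j -> exec_regs r0 qt j = r0 j.
      by move=> hj; rewrite /qt !exec_regE /exec_reg /= !updE !(ntemp_from_neq hj).
    have vt : exec_regs r0 qt (rT 0) = 1 - (N - i).
      by rewrite /qt !exec_regE /exec_reg /= !updE !loc_eq //= hB hC.
    have ct : cost_regs r0 qt <= 3 * L + 7.
      by rewrite /qt !cost_regE /cost_reg /exec_reg /= !updE !loc_eq //= hB hC; bitlens; lia.
    have hct' : code_at p l1 (qt ++ (JumpPos (rT 0) lend :: move_code (rV k) (rC d))) by exact: hct.
    case/code_at_cat: hct' => hct1 /code_at_cons[hct2 hct3].
    have R1 : reach p (Config l1 r0 (si s0) (so s0)) (3 * L + 7)
          (Config (l1 + size qt) (exec_regs r0 qt) (si s0) (so s0)) by exact: reach_plain.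
    have R2 := @reach_step p (Config (l1 + size qt) (exec_regs r0 qt) (si s0) (so s0)) _ 2 hct2.
    move: (frame_temp d.+1 ft) (agree_frame ha ft) vt R1 R2.
    move: (exec_regs r0 qt) => r1 g1 ha1 vt R1; rewrite /= vt => R2.
    have hbt : bitlen (1 - (N - i)) <= 2 by bitlens; lia.
    have {}R2 := reach_trans R1 (R2 hbt) (leqnn _).
    exists r1; split=> //.
    move: R2; have -> : 0 < 1 - (N - i) = ~~ (i < N) by lia.
    rewrite addn3 -addnA.
    by case: (i < N).
  (* Induction on the number [K] of rounds left, always entered at the loop test with counter
     [i]. *)
  have loop K i s0 r0 : i + K = N -> agree r0 s0 -> bounded L s0 -> r0 rL = L ->
      r0 (rB d) = N -> r0 (rC d) = i ->
      let s1 := foldl (fun s' i => sem L c1 (setx s' k i)) s0 (iota i K) in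
      exists r1, [/\ reach p (Config l1 r0 (si s0) (so s0)) (K * (cost_cmd L c1 + 10 * L + 40) + 3 * L + 9)
                       (Config lend r1 (si s1) (so s1)), agree r1 s1 & frame d r0 r1].
    elim: K i s0 r0 => [|K IH] i s0 r0 hK ha hb0 hL0 hB hC.
      have hi : i <= N by lia.
      have [r1 [R1 ha1 g1]] := test _ _ _ ha hB hC hi.
      exists r1; split=> //; last exact: frame_S g1.
      by move: R1; have -> : i < N = false by lia.
    have hi : i <= N by lia.
    have [r1 [R2 ha1 g1]] := test _ _ _ ha hB hC hi.
    have hNi : i < N by lia.
    rewrite hNi in R2.
    have hc3 : code_at p l1.+4 (move_code (rV k) (rC d)).
      have : code_at p l1 ([:: Minus (rT 0) (rB d) (rC d); Const (rT 1) 1; Minus (rT 0) (rT 1) (rT 0); JumpPos (rT 0) lend] ++ move_code (rV k) (rC d)) by exact: hct.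
      by case/code_at_cat => _; rewrite addn4.
    have hC1 : r1 (rC d) = i by rewrite -hC (g1.2 d (ltnSn d)).2.
    have hB1 : r1 (rB d) = N by rewrite -hB (g1.2 d (ltnSn d)).1.
    pose r2 := exec_regs r1 (move_code (rV k) (rC d)).
    have r2E j : r2 j = if j == rV k then i else r1 j.
      rewrite /r2 /move_code !exec_regE /exec_reg /= !updE eqxx loc_eq //= hC1 add0n.
      by case: eqP.
    have R3 : reach p (Config l1.+4 r1 (si s0) (so s0)) (L + 4) (Config (l1 + 6) r2 (si s0) (so s0)).
      have -> : l1 + 6 = l1.+4 + size (move_code (rV k) (rC d)) by rewrite /=; lia.
      apply: reach_plain => //.
      rewrite /move_code !cost_regE /cost_reg /exec_reg /= !updE eqxx loc_eq //= hC1.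
      by bitlens; lia.
    have ha2 : agree r2 (setx s0 k i).
      split=> [j|a j]; rewrite r2E loc_eq //=.
      + by rewrite ?updE; case: eqP => // _; apply: ha1.1.
      + exact: ha1.2.
      + by have := arr_id_lt a; lia.
    have hb2 : bounded L (setx s0 k i).
      by case: hb0 => b1 b2 b3; split=> //= j; rewrite updE; case: eqP => // _; lia.
    have hL2 : r2 rL = L by rewrite r2E loc_eq //= g1.1.
    have [r3 [R4 ha3 g3]] := IH1 _ _ _ _ hcb ha2 hb2 hL2.
    have hB3 : r3 (rB d) = N by rewrite (g3.2 d (ltnSn d)).1 r2E loc_eq.
    have hC3 : r3 (rC d) = i by rewrite (g3.2 d (ltnSn d)).2 r2E loc_eq.
    pose qn := [:: Const (rT 0) 1; Plus (rC d) (rC d) (rT 0)].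
    have hcn' : code_at p (l1 + 6 + size q1) (qn ++ [:: JumpPos (rT 0) l1]) by exact: hcn.
    case/code_at_cat: hcn' => hcn2 /code_at_cons[hcn3 _].
    pose r4 := exec_regs r3 qn.
    have r4E j : r4 j = if j == rC d then i.+1 else if j == rT 0 then 1 else r3 j.
      rewrite /r4 /qn !exec_regE /exec_reg /= !updE !loc_eq //= hC3 addn1.
      by [].
    have R5 : reach p (Config (l1 + 6 + size q1) r3 (si (sem L c1 (setx s0 k i))) (so (sem L c1 (setx s0 k i))))
         (L + 6) (Config (l1 + 6 + size q1 + size qn) r4 (si (sem L c1 (setx s0 k i))) (so (sem L c1 (setx s0 k i)))).
      apply: reach_plain => //.
      rewrite /qn !cost_regE /cost_reg /exec_reg /= !updE !loc_eq //= hC3.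
      by bitlens; lia.
    have R6 := @reach_step p (Config (l1 + 6 + size q1 + size qn) r4 (si (sem L c1 (setx s0 k i))) (so (sem L c1 (setx s0 k i)))) _ 2 hcn3.
    move: R6; rewrite [cost _ _]/= [exec _ _]/= r4E loc_eq //= => R6.
    have {}R6 := R6 (bitlen_le 1).
    have ha4 : agree r4 (sem L c1 (setx s0 k i)).
      split=> [j|a j]; rewrite r4E !loc_eq //=; try by have := arr_id_lt a; lia.
      + exact: ha3.1.
      + exact: ha3.2.
    have fr4 : frame d r0 r4.
      apply: (frame_trans (frame_S g1)).
      split=> [|j hj].
        by rewrite r4E !loc_eq //= g3.1 r2E loc_eq.
      rewrite !r4E !loc_eq //= (g3.2 j (ltnW hj)).1 (g3.2 j (ltnW hj)).2 !r2E !loc_eq //=.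
      by have -> : (j == d) = false by lia.
    have hL4 : r4 rL = L by rewrite fr4.1.
    have hK' : i.+1 + K = N by lia.
    have hB4 : r4 (rB d) = N by rewrite r4E !loc_eq.
    have hC4 : r4 (rC d) = i.+1 by rewrite r4E eqxx.
    have [r5 [R7 ha5 fr5]] := IH _ _ _ hK' ha4 (bounded_sem _ hb2) hL4 hB4 hC4.
    exists r5; split=> //; last exact: frame_trans fr4 fr5.
    apply: (reach_trans R2 (reach_trans R3 (reach_trans R4 (reach_trans R5 (reach_trans R6 R7 (leqnn _)) (leqnn _)) (leqnn _)) (leqnn _))).
    by rewrite mulSn; lia.
  pose qm := move_code (rB d) (rT 0) ++ [:: Const (rC d) 0].
  pose r1 := exec_regs (exec_regs r (clipped_expr e)) qm.
  have r1E j : r1 j = if j == rC d then 0 else if j == rB d then N else exec_regs r (clipped_expr e) j.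
    rewrite /r1 /qm /move_code exec_regs_cat; set r2 := exec_regs r _ in v1 *.
    by rewrite !exec_regE /exec_reg /= !updE !loc_eq //= ?eqxx v1; case: eqP => //; case: eqP.
  have R1 : reach p (Config l r (si s) (so s)) (cost_expr L e + 5 * (bound_expr L e + L + 2) + (L + 4))
     (Config l1 r1 (si s) (so s)).
    rewrite /l1 /r1 -exec_regs_cat {1}hq; apply: reach_plain => //.
    + by rewrite !all_cat !plain_expr.
    + by rewrite -hq.
    + rewrite cost_regs_cat; apply: leq_add => //.
      set r2 := exec_regs r _ in v1 *.
      rewrite /qm /move_code /= /cost_reg /exec_reg /= !updE !loc_eq //= ?eqxx v1; bitlens; lia.
  have ha1 : agree r1 s.
    have h := agree_frame hr f1.
    split=> [j|a j]; rewrite r1E !loc_eq //=; try by have := arr_id_lt a; lia.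
    + exact: h.1.
    + exact: h.2.
  have hL1 : r1 rL = L by rewrite r1E !loc_eq //= f1 // => -[? _ /eqP]; rewrite loc_eq.
  have fr1 : frame d r r1.
    have [h1 h2] := frame_temp d f1.
    split=> [|j hj]; rewrite !r1E !loc_eq //=.
    have -> : (j == d) = false by lia.
    exact: h2.
  have hB1 : r1 (rB d) = N by rewrite r1E !loc_eq //= eqxx.
  have hC1 : r1 (rC d) = 0 by rewrite r1E eqxx.
  have [r2 [R2 ha2 fr2]] := loop N 0 s r1 (add0n _) ha1 hb hL1 hB1 hC1.
  exists r2; split=> //; last exact: frame_trans fr1 fr2.
  apply: (reach_trans R1 R2); rewrite [cost_cmd _ (For _ _ _)]/=.
  move: (leq_mul hN (leqnn (cost_cmd L c1 + 10 * L + 40))).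
  by move: (N * _) (L * (cost_cmd _ _ + _ + _)) => u v; lia.
Qed.

(** * Polynomial bounds *)

Definition poly_bounded (f : nat -> nat) := exists c d, forall B, f B <= c * B.+1 ^ d.

Lemma poly_bounded_const k : poly_bounded (fun=> k).
Proof. by exists k, 0 => B; rewrite expn0 muln1. Qed.

Lemma poly_bounded_id : poly_bounded id.
Proof. by exists 1, 1 => B; rewrite expn1 mul1n. Qed.

Lemma poly_bounded_add f g : poly_bounded f -> poly_bounded g -> poly_bounded (fun B => f B + g B).
Proof.
move=> [c1 [d1 h1]] [c2 [d2 h2]]; exists (c1 + c2), (d1 + d2) => B; rewrite mulnDl.
apply: leq_add; [apply: leq_trans (h1 B) _|apply: leq_trans (h2 B) _];
  by rewrite leq_mul2l leq_pexp2l ?orbT // ?leq_addr ?leq_addl.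
Qed.

Lemma poly_bounded_mul f g : poly_bounded f -> poly_bounded g -> poly_bounded (fun B => f B * g B).
Proof.
move=> [c1 [d1 h1]] [c2 [d2 h2]]; exists (c1 * c2), (d1 + d2) => B.
by rewrite expnD mulnACA; apply: leq_mul.
Qed.

Lemma poly_bounded_bound e : poly_bounded (bound_expr^~ e).
Proof.
elim: e => /= *; auto using poly_bounded_const, poly_bounded_id, poly_bounded_add.
Qed.

Lemma poly_bounded_cost_expr e : poly_bounded (cost_expr^~ e).
Proof.
elim: e => /= *; repeat first [assumption | exact: poly_bounded_const | exact: poly_bounded_bound
  | exact: poly_bounded_id | apply: poly_bounded_mul | apply: poly_bounded_add].
Qed.

(** A loop multiplies the cost by at most [B], so for a fixed program the degree is governed by its
    nesting depth. *)
Lemma poly_bounded_cost c : poly_bounded (cost_cmd^~ c).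
Proof.
elim: c => /= *; repeat first [assumption | exact: poly_bounded_const | exact: poly_bounded_bound
  | exact: poly_bounded_cost_expr
  | exact: poly_bounded_id | apply: poly_bounded_mul | apply: poly_bounded_add].
Qed.

(** * Boolean functions of few variables *)

(** The first bit varies fastest, so [z] stands at position [nat_of_bits z], as in the tables of
    gates. *)
Fixpoint bits k : seq (seq bool) :=
  if k is k'.+1 then [seq b :: l | l <- bits k', b <- [:: false; true]] else [:: [::]].

Lemma mem_bits k l : (l \in bits k) = (size l == k).
Proof.
elim: k l => [|k IH] l; first by rewrite inE; case: l.
change (bits k.+1) with [seq b :: l | l <- bits k, b <- [:: false; true]].
apply/allpairsP/idP => [[[l' b] /= [h1 _ ->]]|].
  by rewrite /= eqSS -IH.
case: l => // b l; rewrite eqSS -IH => h; exists (l, b); split=> //=.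
by case: b; rewrite !inE.
Qed.

Fixpoint evens (t : seq bool) := if t is a :: _ :: t' then a :: evens t' else [::].
Fixpoint odds (t : seq bool) := if t is _ :: b :: t' then b :: odds t' else [::].

(** Lookup by splitting on the lowest bit: structural, without indices, for the exhaustive
    computation below. *)
Fixpoint tabv (t z : seq bool) : bool :=
  if z is b :: z' then tabv (if b then odds t else evens t) z' else head false t.
Definition table_of k (f : seq bool -> bool) : seq bool := [seq f z | z <- bits k].

Lemma tabv_table3 f a b c : tabv (table_of 3 f) [:: a; b; c] = f [:: a; b; c].
Proof. by case: a; case: b; case: c. Qed.

Lemma tabv_table2 f a b : tabv (table_of 2 f) [:: a; b] = f [:: a; b].
Proof. by case: a; case: b. Qed.

Fixpoint dotb (u z : seq bool) : bool :=
  match u, z with a :: u', b :: z' => (a && b) (+) dotb u' z' | _, _ => false end.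

(* Unlike [has] and [all] these do not evaluate the tail eagerly. *)
Fixpoint any T (P : T -> bool) s := if s is x :: s' then if P x then true else any P s' else false.
Fixpoint every T (P : T -> bool) s := if s is x :: s' then if P x then every P s' else false else true.

Lemma anyE T (P : T -> bool) s : any P s = has P s. Proof. by elim: s => //= x s ->; case: (P x). Qed.
Lemma everyE T (P : T -> bool) s : every P s = all P s. Proof. by elim: s => //= x s ->; case: (P x). Qed.

(* [forcible F k]: all solutions of [F] satisfy one equation [z_p + z_q = c],
   where [z_k] stands for the constant [0]. *)
Definition forcible (F : seq bool -> bool) k :=
  (fun Z => any (fun p => any (fun q => any (fun c =>
    every (fun z => eqb (nth false z p (+) nth false z q) c) Z)
    [:: false; true]) (iota p.+1 (k - p))) (iota 0 k)) [seq z <- bits k | F z].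

Definition affine (F : seq bool -> bool) k :=
  any (fun u => any (fun c => every (fun z => eqb (F z) (c (+) dotb u z)) (bits k)) [:: false; true]) (bits k).

(** A tame gate can be used on its own, by merging or by linear algebra; the others are called
    wild. *)
Definition tame (t : seq bool) k :=
  if any (fun a => forcible (fun z => eqb (tabv t z) a) k) [:: false; true] then true else affine (tabv t) k.

(** Two gates with exactly two common variables are placed on four variables [P, Q, R, S]: one reads
    [P, Q, R], the other [P, Q, S]. *)
Definition restr3 (z : seq bool) := if z is [:: x; y; _; w] then [:: x; y; w] else [::].

Definition both (F G : bool) := if F then G else false.

(** On the same three variables merging alone suffices. For equal tables, for instance,
    contradictory outputs have no solution and force every equation vacuously. *)
Definition tame_pair3 (t u : seq bool) :=
  any (fun a => any (fun b => forcible (fun z => both (eqb (tabv t z) a) (eqb (tabv u z) b)) 3)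
    [:: false; true]) [:: false; true].

Definition tame_pair4 (t u : seq bool) :=
  if any (fun a => any (fun b => forcible (fun z => both (eqb (tabv t (take 3 z)) a) (eqb (tabv u (restr3 z)) b)) 4)
    [:: false; true]) [:: false; true] then true
  else affine (fun z => tabv t (take 3 z) (+) tabv u (restr3 z)) 4.

(** A non-affine function of two bits takes one of its values exactly once, and that output fixes
    both bits. *)
Lemma tame2 t : size t = 4 -> tame t 2.
Proof.
move=> ht; have : all (tame^~ 2) (bits 4) by [].
by move/allP => /(_ t); rewrite mem_bits ht; apply.
Qed.

(** The finite fact behind the counting. The list of wild tables is an argument, so that it is
    computed only once. *)
Lemma wild_pairs :
  (fun W => every (fun t => every (fun u => both (tame_pair3 t u) (tame_pair4 t u)) W) W)
  [seq t <- bits 8 | ~~ tame t 3].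
Proof. by vm_compute. Qed.

Lemma bothE a b : both a b = a && b. Proof. by case: a. Qed.

Lemma tame_pair t u : size t = 8 -> size u = 8 -> ~~ tame t 3 -> ~~ tame u 3 ->
  tame_pair3 t u /\ tame_pair4 t u.
Proof.
move=> ht hu wt wu; have := wild_pairs; cbv beta; rewrite everyE => /allP /(_ t).
rewrite mem_filter wt mem_bits ht everyE.
by move=> /(_ isT) /allP /(_ u); rewrite mem_filter wu mem_bits hu bothE => /(_ isT) /andP.
Qed.

(** * Equations between classes of variables *)

(* [v] is an assignment to the class representatives; class [n] is the class
   of the constant [0]. *)
Definition forces n (F : (nat -> bool) -> bool) P Q c :=
  forall v, v n = false -> F v -> v P (+) v Q = c.

Definition xsum (v : nat -> bool) (ls : seq nat) := \big[addb/false]_(k <- ls) v k.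

Definition is_sum n (F : (nat -> bool) -> bool) ls c :=
  forall v, v n = false -> F v = c (+) xsum v ls.

(** [P] is the class that will disappear, hence [P != n], whereas [Q] may be the class of the
    constant. An unsatisfiable [F] forces everything, so impossible outputs count as merges too. *)
Definition gate_forced n F (cs : seq nat) :=
  exists P Q c, [/\ P \in cs, Q \in n :: cs, P != Q, P != n & forces n F P Q c].

Definition gate_sum n F (cs : seq nat) :=
  exists ls c, {subset ls <= cs} /\ is_sum n F ls c.

Lemma dotb_mask v u cs : dotb u (map v cs) = xsum v (mask u cs).
Proof.
elim: u cs => [|a u IH] [|c cs] /=; rewrite /xsum ?big_nil //.
by case: a => /=; rewrite ?big_cons IH.
Qed.

(** The index [size cs] is out of range on both sides: [nth n cs] yields the class [n] there and
    [nth false z] its value 0. *)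
Lemma forcible_forced (n : nat) F Fz (cs : seq nat) : uniq (n :: cs) ->
  (forall v, v n = false -> F v = Fz (map v cs)) -> forcible Fz (size cs) -> gate_forced n F cs.
Proof.
rewrite cons_uniq => /andP[hn hu] hF; rewrite /forcible anyE => /hasP[p].
rewrite mem_iota add0n => /andP[_ hp].
rewrite anyE => /hasP[q]; rewrite mem_iota anyE => hq /hasP[c _]; rewrite everyE => /allP h.
have hpc : nth n cs p \in cs by apply: mem_nth.
exists (nth n cs p), (nth n cs q), c; split=> //.
- case: (ltnP q (size cs)) => hqs; first by rewrite inE mem_nth ?orbT.
  by rewrite nth_default // mem_head.
- case: (ltnP q (size cs)) => hqs; first by rewrite nth_uniq //; lia.
  by rewrite [nth _ _ q]nth_default //; apply: contraNneq hn => <-.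
- by apply: contraNneq hn => <-.
- move=> v hv; rewrite hF // => hz.
  have := h (map v cs); rewrite mem_filter mem_bits size_map eqxx hz => /(_ isT) /eqP <-.
  have E k : nth false (map v cs) k = v (nth n cs k).
    case: (ltnP k (size cs)) => hk; first by rewrite (nth_map n).
    by rewrite !nth_default ?size_map.
  by rewrite !E.
Qed.

Lemma affine_sum n F Fz cs :
  (forall v, v n = false -> F v = Fz (map v cs)) -> affine Fz (size cs) -> gate_sum n F cs.
Proof.
move=> hF; rewrite /affine anyE => /hasP[u _]; rewrite anyE => /hasP[c _]; rewrite everyE => /allP h.
exists (mask u cs), c; split; first by move=> x; apply: mem_mask.
move=> v hv; rewrite hF // -dotb_mask; apply/eqP; apply: h.
by rewrite mem_bits size_map.
Qed.

Definition gate_tame n F (cs : seq nat) :=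
  gate_sum n F cs \/ exists a, gate_forced n (fun v => F v == a) cs.

Lemma tame_gate (n : nat) F t (cs : seq nat) : uniq (n :: cs) ->
  (forall v, v n = false -> F v = tabv t (map v cs)) -> tame t (size cs) -> gate_tame n F cs.
Proof.
move=> hu hF; rewrite /tame anyE; case: ifP => [/hasP[a _ h] _|_ h]; last by left; apply: affine_sum h.
right; exists a; apply: forcible_forced h => // v hv; by rewrite hF.
Qed.

Lemma gate_sum_sub n F cs cs' : {subset cs <= cs'} -> gate_sum n F cs -> gate_sum n F cs'.
Proof. by move=> h [ls [c [h1 h2]]]; exists ls, c; split=> // x /h1 /h. Qed.

Lemma gate_forced_sub n F cs cs' : {subset cs <= cs'} -> gate_forced n F cs -> gate_forced n F cs'.
Proof.
move=> h [P [Q [c [h1 h2 h3 h4 h5]]]]; exists P, Q, c; split=> //; first exact: h.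
by move: h2; rewrite !inE => /orP[->//|/h ->]; rewrite orbT.
Qed.

Lemma gate_tame_sub n F cs cs' : {subset cs <= cs'} -> gate_tame n F cs -> gate_tame n F cs'.
Proof.
move=> h [/(gate_sum_sub h)|[a /(gate_forced_sub h) ha]]; first by left.
by right; exists a.
Qed.

Lemma gate_tame1 n F f P : (forall v, v n = false -> F v = f (v P)) -> gate_sum n F [:: P].
Proof.
move=> hF; case e : (f false (+) f true); last first.
  exists [::], (f false); split=> // v hv; rewrite /xsum big_nil hF //.
  by move: e; case: (v P); case: (f false); case: (f true).
exists [:: P], (f false); split=> // v hv; rewrite /xsum big_seq1 hF //.
by move: e; case: (v P); case: (f false); case: (f true).
Qed.

(** If the classes coincide, or one is the constant, a function of one bit remains, which is affine;
    otherwise [tame2] applies. *)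
Lemma gate_tame2 n F f P Q : (forall v, v n = false -> F v = f (v P) (v Q)) -> gate_tame n F [:: P; Q].
Proof.
move=> hF.
case: (eqVneq P n) => [eP|hP].
  left; apply: gate_sum_sub (@gate_tame1 n F (f false) Q _) => [x|v hv].
    by rewrite !inE => ->; rewrite orbT.
  by rewrite hF // eP hv.
case: (eqVneq Q n) => [eQ|hQ].
  left; apply: gate_sum_sub (@gate_tame1 n F (f^~ false) P _) => [x|v hv].
    by rewrite !inE => ->.
  by rewrite hF // eQ hv.
case: (eqVneq P Q) => [eQ|hPQ].
  left; apply: gate_sum_sub (@gate_tame1 n F (fun a => f a a) P _) => [x|v hv].
    by rewrite !inE => ->.
  by rewrite hF // eQ.
apply: (@tame_gate n F (table_of 2 (fun z => f (nth false z 0) (nth false z 1)))).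
- by rewrite /= !inE negb_or eq_sym hP eq_sym hQ hPQ.
- by move=> v hv; rewrite [map _ _]/= tabv_table2 hF.
- exact: tame2.
Qed.

(** Any coincidence among the three classes and the constant leaves a function of two classes, which
    is tame. *)
Lemma wild_gate_uniq n F t c0 c1 c2 :
  (forall v, v n = false -> F v = tabv t [:: v c0; v c1; v c2]) ->
  ~ gate_tame n F [:: c0; c1; c2] -> uniq [:: n; c0; c1; c2].
Proof.
move=> hF hw.
have sub P Q : P \in [:: c0; c1; c2] -> Q \in [:: c0; c1; c2] -> {subset [:: P; Q] <= [:: c0; c1; c2]}.
  by move=> hP hQ x; rewrite !inE => /orP[] /eqP ->; move: hP hQ; rewrite !inE.
have case2 f P Q : P \in [:: c0; c1; c2] -> Q \in [:: c0; c1; c2] ->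
    (forall v, v n = false -> F v = f (v P) (v Q)) -> False.
  by move=> hP hQ h; apply: hw; apply: gate_tame_sub (sub _ _ hP hQ) _; apply: gate_tame2 h.
rewrite /= !inE !negb_or !andbT; do !(apply/andP; split); apply/eqP => e.
- by apply: (case2 (fun a b => tabv t [:: false; a; b]) c1 c2); rewrite ?inE ?eqxx ?orbT // => v hv; rewrite hF // -e hv.
- by apply: (case2 (fun a b => tabv t [:: a; false; b]) c0 c2); rewrite ?inE ?eqxx ?orbT // => v hv; rewrite hF // -e hv.
- by apply: (case2 (fun a b => tabv t [:: a; b; false]) c0 c1); rewrite ?inE ?eqxx ?orbT // => v hv; rewrite hF // -e hv.
- by apply: (case2 (fun a b => tabv t [:: a; a; b]) c0 c2); rewrite ?inE ?eqxx ?orbT // => v hv; rewrite hF // -e.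
- by apply: (case2 (fun a b => tabv t [:: a; b; a]) c0 c1); rewrite ?inE ?eqxx ?orbT // => v hv; rewrite hF // -e.
- by apply: (case2 (fun a b => tabv t [:: a; b; b]) c0 c1); rewrite ?inE ?eqxx ?orbT // => v hv; rewrite hF // -e.
Qed.

Lemma gate_reorder (n : nat) F t (c0 c1 c2 P Q : nat) :
  (forall v, v n = false -> F v = tabv t [:: v c0; v c1; v c2]) -> uniq [:: n; c0; c1; c2] ->
  P \in [:: c0; c1; c2] -> Q \in [:: c0; c1; c2] -> P != Q ->
  exists R t', [/\ size t' = 8, uniq [:: n; P; Q; R],
    [:: P; Q; R] =i [:: c0; c1; c2] & forall v, v n = false -> F v = tabv t' [:: v P; v Q; v R]].
Proof.
move=> hF hu; rewrite !inE => hP hQ hPQ.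
have G f R : perm_eq [:: c0; c1; c2] [:: P; Q; R] ->
    (forall v, v n = false -> F v = f [:: v P; v Q; v R]) ->
    exists R t', [/\ size t' = 8, uniq [:: n; P; Q; R],
    [:: P; Q; R] =i [:: c0; c1; c2] & forall v, v n = false -> F v = tabv t' [:: v P; v Q; v R]].
  move=> hs h3; exists R, (table_of 3 f); split=> //.
    by rewrite -(perm_uniq (_ : perm_eq (n :: [:: c0; c1; c2]) _)) // perm_cons.
    by move=> x; rewrite (perm_mem hs).
  by move=> v hv; rewrite tabv_table3 h3.
have p3 (x y z : nat) : [/\ perm_eq [:: x; y; z] [:: x; z; y], perm_eq [:: x; y; z] [:: y; x; z],
    perm_eq [:: x; y; z] [:: y; z; x], perm_eq [:: x; y; z] [:: z; x; y] & perm_eq [:: x; y; z] [:: z; y; x]].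
  by split; apply/permP => a /=; lia.
have [q1 q2 q3 q4 q5] := p3 c0 c1 c2.
case/or3P: hP => /eqP eP; case/or3P: hQ => /eqP eQ; subst P Q; move: hPQ; rewrite ?eqxx // => _.
- by apply: (G (fun z => tabv t [:: nth false z 0; nth false z 1; nth false z 2]) c2).
- by apply: (G (fun z => tabv t [:: nth false z 0; nth false z 2; nth false z 1]) c1).
- by apply: (G (fun z => tabv t [:: nth false z 1; nth false z 0; nth false z 2]) c2).
- by apply: (G (fun z => tabv t [:: nth false z 2; nth false z 0; nth false z 1]) c0).
- by apply: (G (fun z => tabv t [:: nth false z 1; nth false z 2; nth false z 0]) c1).
- by apply: (G (fun z => tabv t [:: nth false z 2; nth false z 1; nth false z 0]) c0).
Qed.

(** After reordering, [P] and [Q] come first in both gates. If the third classes agree, [tame_pair3]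
    yields a forced equation; otherwise [tame_pair4] yields a forced equation or an affine sum. *)
Lemma wild_gates_share (n : nat) F G t u (c d : nat -> nat) (P Q : nat) :
  (forall v, v n = false -> F v = tabv t [:: v (c 0); v (c 1); v (c 2)]) ->
  (forall v, v n = false -> G v = tabv u [:: v (d 0); v (d 1); v (d 2)]) ->
  let cs := [:: c 0; c 1; c 2] in let ds := [:: d 0; d 1; d 2] in
  ~ gate_tame n F cs -> ~ gate_tame n G ds ->
  ~ gate_sum n (fun v => F v (+) G v) (cs ++ ds) ->
  (forall a b, ~ gate_forced n (fun v => (F v == a) && (G v == b)) (cs ++ ds)) ->
  P != Q -> P \in cs -> Q \in cs -> P \in ds -> Q \in ds -> False.
Proof.
move=> hF hG cs ds wF wG hs hf hPQ Pc Qc Pd Qd.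
have uF := wild_gate_uniq hF wF; have uG := wild_gate_uniq hG wG.
have [R [t' [st uR eR hF']]] := gate_reorder hF uF Pc Qc hPQ.
have [S [u' [su uS eS hG']]] := gate_reorder hG uG Pd Qd hPQ.
have wt : ~~ tame t' 3.
  apply/negP => h; apply: wF; apply: (@gate_tame_sub n F [:: P; Q; R]); first by move=> x; rewrite eR.
  exact: (@tame_gate n F t' [:: P; Q; R]).
have wu : ~~ tame u' 3.
  apply/negP => h; apply: wG; apply: (@gate_tame_sub n G [:: P; Q; S]); first by move=> x; rewrite eS.
  exact: (@tame_gate n G u' [:: P; Q; S]).
have [h3 h4] := tame_pair st su wt wu.
case: (eqVneq R S) => [eRS|hRS].
  move: h3; rewrite /tame_pair3 anyE => /hasP[a _]; rewrite anyE => /hasP[b _ h]; apply: (hf a b).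
  apply: (@gate_forced_sub n _ [:: P; Q; R]); first by move=> x; rewrite mem_cat eR => ->.
  apply: (@forcible_forced n _ _ [:: P; Q; R] _ _ h) => // v hv; by rewrite hF' // hG' // eRS bothE.
have hu4 : uniq [:: n; P; Q; R; S].
  move: uR uS; rewrite /= !inE !negb_or !andbT => /and3P[/and3P[-> -> ->] /andP[-> ->] ->].
  by move=> /and3P[/and3P[_ _ ->] /andP[_ ->] ->]; rewrite hRS.
have sub4 : {subset [:: P; Q; R; S] <= cs ++ ds}.
  move=> x hx; rewrite mem_cat.
  have : (x \in [:: P; Q; R]) || (x \in [:: P; Q; S]).
    by move: hx; rewrite !inE => /or4P[] ->; rewrite ?orbT.
  by rewrite eR eS.
move: h4; rewrite /tame_pair4 anyE; case: ifP => [/hasP[a _]|_ h]; last first.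
  by apply: hs; apply: gate_sum_sub sub4 _; apply: (@affine_sum n _ _ [:: P; Q; R; S] _ h) => v hv; rewrite hF' // hG'.
rewrite anyE => /hasP[b _ h] _.
apply: (hf a b); apply: gate_forced_sub sub4 _; apply: (@forcible_forced n _ _ [:: P; Q; R; S] _ _ h) => // v hv.
by rewrite hF' // hG' // bothE.
Qed.

(** * Counting *)

Lemma card_offdiag (T : finType) (A : {set T}) :
  #|[set p in setX A A | p.1 != p.2]| + #|A| = #|A| * #|A|.
Proof.
rewrite -cardsX -(cardsID [set p : T * T | p.1 != p.2] (setX A A)).
congr (_ + _); first by apply: eq_card => p; rewrite !inE.
rewrite -(card_imset _ (_ : injective (fun a : T => (a, a)))); last by move=> a b [].
apply: eq_card => -[a b]; rewrite !inE negbK /=.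
apply/imsetP/idP => [[c hc [-> ->]]|/andP[/eqP -> /andP[h _]]]; first by rewrite eqxx hc.
by exists b.
Qed.

(** Each triple gives six ordered pairs of distinct points, no pair arises from two triples, and
    there are [#|R| * #|R| - #|R|] pairs: the packing bound for triples meeting pairwise in at most
    one point. *)
Lemma linear_triples (T U : finType) (A : {set T}) (R : {set U}) (cl : T -> 'I_3 -> U) :
  (forall g k, g \in A -> cl g k \in R) ->
  (forall g, g \in A -> injective (cl g)) ->
  (forall g h i j i' j', g \in A -> h \in A -> i != j ->
     cl g i = cl h i' -> cl g j = cl h j' -> g = h) ->
  6 * #|A| + #|R| <= #|R| * #|R|.
Proof.
move=> hR hinj hlin.
pose O := [set p in setX [set: 'I_3] [set: 'I_3] | p.1 != p.2].
have hO : #|O| = 6.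
  by have := card_offdiag [set: 'I_3]; rewrite cardsT card_ord -/O; lia.
rewrite -card_offdiag leq_add2r mulnC -hO -cardsX.
pose f (p : T * ('I_3 * 'I_3)) := (cl p.1 p.2.1, cl p.1 p.2.2).
rewrite -(card_in_imset (_ : {in setX A O &, injective f})).
  apply/subset_leq_card/subsetP => q /imsetP[[g [i j]]].
  rewrite !inE /= => /andP[hg hij] ->; rewrite /= !hR //=.
  by apply: contraNneq hij => /(hinj _ hg) ->.
move=> [g [i j]] [h [i' j']]; rewrite !inE /= => /andP[hg hij] /andP[hh hij'] [e1 e2].
have e := hlin _ _ _ _ _ _ hg hh hij e1 e2; subst h.
by rewrite (hinj _ hg _ _ e1) (hinj _ hg _ _ e2).
Qed.

(** * Program logic *)

Lemma sem_for_ind L k e c s (P : nat -> state -> Prop) N :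
  minn (ev s e) L = N -> P 0 s ->
  (forall i s', i < N -> P i s' -> P i.+1 (sem L c (setx s' k i))) ->
  P N (sem L (For k e c) s).
Proof.
move=> /= -> h0 hs.
suff H K i s' : i + K = N -> P i s' ->
    P N (foldl (fun s' i => sem L c (setx s' k i)) s' (iota i K)) by apply: H.
elim: K i s' => [|K IH] i s' /=; first by rewrite addn0 => ->.
by move=> hi hP; apply: IH; [lia|apply: hs => //; lia].
Qed.

(** Syntactic frame conditions, settled by computation; invariants then need no clause for what a
    command never writes. *)
Fixpoint keeps_var k (c : cmd) : bool :=
  match c with
  | Asg k' _ | Inp k' => k != k'
  | Seq c1 c2 => keeps_var k c1 && keeps_var k c2
  | When _ c1 => keeps_var k c1
  | For k' _ c1 => (k != k') && keeps_var k c1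
  | _ => true
  end.

Fixpoint keeps_arr a (c : cmd) : bool :=
  match c with
  | Sto b _ _ => arr_id a != arr_id b
  | Seq c1 c2 => keeps_arr a c1 && keeps_arr a c2
  | When _ c1 | For _ _ c1 => keeps_arr a c1
  | _ => true
  end.

Fixpoint keeps_out (c : cmd) : bool :=
  match c with
  | Out _ => false
  | Seq c1 c2 => keeps_out c1 && keeps_out c2
  | When _ c1 | For _ _ c1 => keeps_out c1
  | _ => true
  end.

Lemma keeps_varP L k c s : keeps_var k c -> sx (sem L c s) k = sx s k.
Proof.
elim: c s => [|k' e|a e1 e2|k'|e|c1 IH1 c2 IH2|e c1 IH1|k' e c1 IH1] s //=.
- by rewrite updE => /negPf ->.
- by rewrite updE => /negPf ->.
- by case/andP => h1 h2; rewrite IH2 // IH1.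
- by case: ifP => // _; apply: IH1.
- move=> /andP[/negPf hk h1]; move: (iota _ _) => q; elim: q s => //= i q IH s.
  by rewrite IH IH1 //= updE hk.
Qed.

Lemma keeps_arrP L a c s : keeps_arr a c -> sa (sem L c s) a = sa s a.
Proof.
elim: c s => [|k' e|b e1 e2|k'|e|c1 IH1 c2 IH2|e c1 IH1|k' e c1 IH1] s //=.
- by move=> /negPf ->.
- by case/andP => h1 h2; rewrite IH2 // IH1.
- by case: ifP => // _; apply: IH1.
- by move=> h1; move: (iota _ _) => q; elim: q s => //= i q IH s; rewrite IH IH1.
Qed.

Lemma keeps_outP L c s : keeps_out c -> so (sem L c s) = so s.
Proof.
elim: c s => [|k' e|b e1 e2|k'|e|c1 IH1 c2 IH2|e c1 IH1|k' e c1 IH1] s //=.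
- by case/andP => h1 h2; rewrite IH2 // IH1.
- by case: ifP => // _; apply: IH1.
- by move=> h1; move: (iota _ _) => q; elim: q s => //= i q IH s; rewrite IH IH1.
Qed.

Definition seqs (l : seq cmd) : cmd := foldr Seq Skip l.

Lemma keeps_var_seqs k l : keeps_var k (seqs l) = all (keeps_var k) l.
Proof. by elim: l => //= c l ->. Qed.
Lemma keeps_arr_seqs a l : keeps_arr a (seqs l) = all (keeps_arr a) l.
Proof. by elim: l => //= c l ->. Qed.
Lemma keeps_out_seqs l : keeps_out (seqs l) = all keeps_out l.
Proof. by elim: l => //= c l ->. Qed.

Lemma sem_seqs_cons L c l s : sem L (seqs (c :: l)) s = sem L (seqs l) (sem L c s).
Proof. by []. Qed.
Lemma sem_seqs_nil L s : sem L (seqs [::]) s = s.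
Proof. by []. Qed.
Lemma sem_when L e c s : sem L (When e c) s = if 0 < ev s e then sem L c s else s.
Proof. by []. Qed.

(** * Boolean tests over natural numbers *)

Definition notE e := ESub (EN 1) e.
Definition andE e1 e2 := notE (EAdd (notE e1) (notE e2)).
Definition orE e1 e2 := EAdd e1 e2.
(** The distance of two numbers: exclusive or on bits, and, since any positive value is true, a test
    for inequality in general. *)
Definition xorE e1 e2 := EAdd (ESub e1 e2) (ESub e2 e1).
Definition equE e1 e2 := notE (xorE e1 e2).
Definition ltE e1 e2 := ESub e2 e1.
Definition allE l := foldr andE (EN 1) l.
Definition litE (b : bool) e := if b then e else notE e.
Definition dblE e := EAdd e e.

Definition xorn a b := (a - b) + (b - a).
Definition truth s e := 0 < ev s e.

Lemma odd_xorn a b : odd (xorn a b) = odd a (+) odd b.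
Proof.
rewrite /xorn; case: (leqP a b) => h.
  have -> : a - b = 0 by lia.
  by rewrite add0n oddB // addbC.
have -> : b - a = 0 by lia.
by rewrite addn0 oddB // ltnW.
Qed.

Lemma xorn_le1 a b : a <= 1 -> b <= 1 -> xorn a b <= 1.
Proof. rewrite /xorn; lia. Qed.

Lemma truth_not s e : truth s (notE e) = ~~ truth s e.
Proof. by rewrite /truth /=; lia. Qed.
Lemma truth_and s e1 e2 : truth s (andE e1 e2) = truth s e1 && truth s e2.
Proof. by rewrite /truth /=; lia. Qed.
Lemma truth_or s e1 e2 : truth s (orE e1 e2) = truth s e1 || truth s e2.
Proof. by rewrite /truth /=; lia. Qed.
Lemma truth_xor s e1 e2 : truth s (xorE e1 e2) = (ev s e1 != ev s e2).
Proof. by rewrite /truth /=; lia. Qed.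
Lemma truth_eq s e1 e2 : truth s (equE e1 e2) = (ev s e1 == ev s e2).
Proof. by rewrite truth_not truth_xor negbK. Qed.
Lemma truth_lt s e1 e2 : truth s (ltE e1 e2) = (ev s e1 < ev s e2).
Proof. by rewrite /truth /= subn_gt0. Qed.
Lemma truth_all s l : truth s (allE l) = all (truth s) l.
Proof. by elim: l => //= e l IH; rewrite -IH truth_and. Qed.
Lemma truth_lit s b e : truth s (litE b e) = (truth s e == b).
Proof. by case: b; rewrite /litE ?truth_not; case: (truth s e). Qed.
Lemma ev_and s e1 e2 : ev s (andE e1 e2) = truth s e1 && truth s e2.
Proof. by rewrite /truth /=; lia. Qed.
Lemma ev_not s e : ev s (notE e) = ~~ truth s e.
Proof. by rewrite /truth /=; lia. Qed.
Lemma ev_xor s e1 e2 : ev s (xorE e1 e2) = xorn (ev s e1) (ev s e2).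
Proof. by []. Qed.

Lemma truth_all3 s e1 e2 e3 :
  truth s (allE [:: e1; e2; e3]) = [&& truth s e1, truth s e2 & truth s e3].
Proof. by rewrite truth_all /= andbT. Qed.
Lemma truth_all6 s e1 e2 e3 e4 e5 e6 :
  truth s (allE [:: e1; e2; e3; e4; e5; e6]) =
  [&& truth s e1, truth s e2, truth s e3, truth s e4, truth s e5 & truth s e6].
Proof. by rewrite truth_all /= andbT. Qed.

Definition truthE := (truth_not, truth_and, truth_or, truth_xor, truth_eq, truth_lt, truth_all, truth_lit).

(** * The program *)

Notation vN := 0 (only parsing).
Notation vM := 1 (only parsing).
Notation vG := 2 (only parsing).
Notation vH := 3 (only parsing).
Notation vI := 4 (only parsing).
Notation vJ := 5 (only parsing).
Notation vP := 6 (only parsing).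
Notation vQ := 7 (only parsing).
Notation vC := 8 (only parsing).
Notation vR := 9 (only parsing).
Notation vT := 10 (only parsing).
Notation vOff := 11 (only parsing).
Notation vIns := 12 (only parsing).
Notation vRep := 13 (only parsing).

(** The strides are powers of two, 4 for the three inputs and 8 for the table, so addresses need
    doublings only. *)
Definition rd_at e k := EAdd (dblE (dblE e)) (EN k).
Definition tb_at e i := EAdd (dblE (dblE (dblE e))) (EN i).
Definition rdE e k := EA Rd (rd_at e k).
Definition tbE e z := EA Tb (tb_at e (nat_of_bits z)).

(* The variables read by gates G and H, numbered 0 to 5, and the constant 0 as
   number 6. *)
Definition uE k :=
  if k < 3 then rdE (EX vG) k else if k < 6 then rdE (EX vH) (k - 3) else EX vN.
Definition cE k := EA Cls (uE k).
Definition pE k := EA Par (uE k).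

Definition pairs7 := [seq (p, q) | p <- iota 0 7, q <- iota 0 7].

(** All values [z] of the six variables and the constant are enumerated, and those at odds with the
    classes are discarded. This spares a case distinction on which of the variables coincide or lie
    in one class. *)
Definition consE (z : seq bool) :=
  allE [seq orE (xorE (cE pq.1) (cE pq.2))
                (litE (nth false z pq.1 == nth false z pq.2) (equE (pE pq.1) (pE pq.2))) | pq <- pairs7].

Definition first3 (z : seq bool) := [:: nth false z 0; nth false z 1; nth false z 2].
Definition last3 (z : seq bool) := [:: nth false z 3; nth false z 4; nth false z 5].

Definition points := [seq rcons z false | z <- bits 6].

Definition mchoice := (bool * bool * nat * nat * bool)%type.

Definition bools := [:: false; true].
(** The constant, number 6, is offered for [q] only, because the class of [p] is the one to
    disappear. *)
Definition choices : seq mchoice :=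
  [seq (abpq, c) | abpq <- [seq (abp, q) | abp <- [seq (ab, p) | ab <- [seq (a, b) | a <- bools, b <- bools],
     p <- iota 0 6], q <- iota 0 7], c <- bools].

Lemma mem_choices a b p q c : p < 6 -> q < 7 -> ((a, b, p, q, c) : mchoice) \in choices.
Proof.
have hb (d : bool) : d \in bools by case: d.
move=> hp hq; apply: allpairs_f (hb c); apply: allpairs_f; last by rewrite mem_iota.
by apply: allpairs_f; [apply: allpairs_f|rewrite mem_iota].
Qed.

Lemma choices_lt a b p q c : ((a, b, p, q, c) : mchoice) \in choices -> p < 7 /\ q < 7.
Proof.
have : all (fun t : mchoice => (t.1.1.2 < 7) && (t.1.2 < 7)) choices by [].
by move/allP => H /H /andP.
Qed.

Opaque choices.

(* Two different gates are only used when [1 < n]: for [n <= 1] there may be as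
   few as [2 n] gates, and merging with pairs could exhaust them. *)
Definition candE (t : mchoice) : expr :=
  let: (a, b, p, q, c) := t in
  allE [:: (if a == b then orE (equE (EX vG) (EX vH)) (ltE (EN 1) (EX vN))
            else andE (xorE (EX vG) (EX vH)) (ltE (EN 1) (EX vN)));
           notE (EA Used (EX vG)); notE (EA Used (EX vH));
           xorE (cE p) (cE q); xorE (cE p) (EX vN);
           allE [seq notE (andE (consE z) (andE (litE a (tbE (EX vG) (first3 z)))
                                                (litE b (tbE (EX vH) (last3 z)))))
                | z <- points & nth false z p (+) nth false z q != c]].

Arguments allE : simpl never.
Arguments consE : simpl never.
Arguments points : simpl never.
Arguments bits : simpl never.
Arguments candE : simpl never.
Arguments tbE : simpl never.
Arguments uE : simpl never.
Arguments cE : simpl never.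
Arguments pE : simpl never.
Arguments rdE : simpl never.
Arguments truth : simpl never.
Arguments notE : simpl never.
Arguments andE : simpl never.
Arguments orE : simpl never.
Arguments xorE : simpl never.
Arguments equE : simpl never.
Arguments ltE : simpl never.

Definition relabel : cmd :=
  For vI (EAdd (EX vN) (EN 1))
    (When (equE (EA Cls (EX vI)) (EX vP))
      (Seq (Sto Par (EX vI) (xorE (EA Par (EX vI)) (EX vC))) (Sto Cls (EX vI) (EX vQ)))).

(** Passing from variables to representatives adds both complement bits to [c]. The two classes and
    this bit are saved first, since [relabel] overwrites the arrays they come from. *)
Definition merge_cmd (t : mchoice) : cmd :=
  let: (a, b, p, q, c) := t in
  seqs [:: Asg vP (cE p); Asg vQ (cE q); Asg vC (xorE (xorE (pE p) (pE q)) (EN c));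
    Sto Used (EX vG) (EN 1); Sto Used (EX vH) (EN 1);
    Sto Ys (EX vG) (EN a); Sto Ys (EX vH) (EN b); relabel].

Definition try_merge (t : mchoice) : cmd := When (candE t) (merge_cmd t).

Definition merge_round : cmd :=
  For vG (EX vM) (For vH (EX vM) (seqs [seq try_merge t | t <- choices])).

(** A round that merges removes at least one of at most [n] classes, so one of [n + 1] rounds is
    idle, and from then on nothing can be merged. *)
Definition merge_stage : cmd := For vRep (EAdd (EX vN) (EN 1)) merge_round.

(** Clearing [Vec] makes the remaining steps of the elimination idle. *)
Definition insert_row : cmd :=
  seqs [:: For vJ (EX vN) (Seq (Sto Row (EAdd (EX vOff) (EX vJ)) (EA Vec (EX vJ))) (Sto Vec (EX vJ) (EN 0)));
           Sto Has (EX vI) (EN 1); Asg vIns (EN 1)].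

Definition reduce_row : cmd :=
  For vJ (EX vN) (Sto Vec (EX vJ) (xorE (EA Vec (EX vJ)) (EA Row (EAdd (EX vOff) (EX vJ))))).

Definition gauss_step : cmd :=
  seqs [:: When (andE (EA Vec (EX vI)) (notE (EA Has (EX vI)))) insert_row;
           When (andE (EA Vec (EX vI)) (EA Has (EX vI))) reduce_row;
           Asg vOff (EAdd (EX vOff) (EX vN))].

Definition gauss : cmd :=
  seqs [:: Asg vIns (EN 0); Asg vOff (EN 0); For vI (EX vN) gauss_step].

(** [u] is an affine form: six coefficients, and a constant term that is multiplied by a final
    [true] in [z]. *)
Definition dot7 (u z : seq bool) :=
  \big[addb/false]_(k <- iota 0 7) (nth false u k && nth false z k).

(** For [h = g] the second summand is switched off, so the same code treats a single gate and a
    pair. *)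
Definition sumE z := xorE (tbE (EX vG) (first3 z)) (andE (xorE (EX vG) (EX vH)) (tbE (EX vH) (last3 z))).

Definition affE (u : seq bool) : expr :=
  allE [:: notE (EA Dn (EX vG)); notE (EA Used (EX vH));
           allE [seq orE (notE (consE (rcons z false))) (litE (dot7 u (rcons z true)) (sumE z)) | z <- bits 6]].

Definition support6 (u : seq bool) := [seq k <- iota 0 6 | nth false u k].

(** Coefficients are toggled, so variables of one class cancel modulo 2. Toggles for the constant
    fall into cell [n], which the elimination never reads. *)
Definition load_vec (u : seq bool) : cmd :=
  seqs [:: For vJ (EX vN) (Sto Vec (EX vJ) (EN 0));
           seqs [seq Sto Vec (cE k) (xorE (EA Vec (cE k)) (EN 1)) | k <- support6 u]].

Definition parE (u : seq bool) :=
  foldr xorE (EN (nth false u 6)) [seq pE k | k <- support6 u].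

(** If the form was inserted, the output asks for its value 0. If it is dependent, its value is
    already bound to be 0, and the flipped output asks for 1. *)
Definition use_form (u : seq bool) : cmd :=
  seqs [:: Sto Dn (EX vG) (EN 1); load_vec u; gauss;
           Sto Ys (EX vG) (xorE (andE (xorE (EX vG) (EX vH)) (EA Ys (EX vH)))
                                (xorE (notE (EX vIns)) (parE u)))].

Arguments sumE : simpl never.
Arguments affE : simpl never.
Arguments parE : simpl never.
Arguments dot7 : simpl never.

Definition try_form (u : seq bool) : cmd := When (affE u) (use_form u).

(** The bound [g + 1] includes [h = g], the test of the gate alone. *)
Definition linear_gate : cmd :=
  When (notE (EA Used (EX vG)))
    (For vH (EAdd (EX vG) (EN 1)) (seqs [seq try_form u | u <- bits 7])).

Definition linear_stage : cmd := For vG (EX vM) linear_gate.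

(** A gate with fewer than three inputs is padded with the variable [n], the constant 0. *)
Definition read_var k : cmd :=
  seqs [:: When (ltE (EN k) (EX vR)) (Seq (Inp vT) (Sto Rd (rd_at (EX vG) k) (EX vT)));
           When (notE (ltE (EN k) (EX vR))) (Sto Rd (rd_at (EX vG) k) (EX vN))].

(* The least [r] with [i < 2 ^ r]: bit [i] is present in the tables of gates
   with at least that many inputs. *)
Definition bits_needed i := nth 0 [:: 0; 1; 2; 2; 3; 3; 3; 3] i.

Definition read_bit i : cmd :=
  When (ltE (EN (bits_needed i)) (EAdd (EX vR) (EN 1)))
    (Seq (Inp vT) (Sto Tb (tb_at (EX vG) i) (EX vT))).

Definition read_gate : cmd :=
  seqs [:: Inp vR; seqs [seq read_var k | k <- iota 0 3]; seqs [seq read_bit i | i <- iota 0 8]].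

Definition read_stage : cmd := For vG (EX vM) read_gate.

Definition init_stage : cmd := For vI (EAdd (EX vN) (EN 1)) (Sto Cls (EX vI) (EX vI)).

Definition print_stage : cmd := For vG (EX vM) (Out (EA Ys (EX vG))).

Definition avoid : cmd :=
  seqs [:: read_stage; init_stage; merge_stage; linear_stage; print_stage].

(** * Meaning of the tests *)

Section Tests.

Variables (n : nat) (R T cls par : nat -> nat).

Definition uvar g h k := if k < 3 then R (4 * g + k) else if k < 6 then R (4 * h + (k - 3)) else n.

Definition consistent g h (z : seq bool) :=
  all (fun pq => (cls (uvar g h pq.1) != cls (uvar g h pq.2)) ||
    ((par (uvar g h pq.1) == par (uvar g h pq.2)) == (nth false z pq.1 == nth false z pq.2))) pairs7.

Definition tbval g (z : seq bool) : bool := 0 < T (8 * g + nat_of_bits z).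

Definition cand (used : nat -> nat) g h (t : mchoice) :=
  let: (a, b, p, q, c) := t in
  [&& (g == h) && (a == b) || (g != h) && (1 < n), used g == 0, used h == 0,
      cls (uvar g h p) != cls (uvar g h q), cls (uvar g h p) != n
    & all (fun z => (nth false z p (+) nth false z q != c) ==>
         ~~ [&& consistent g h z, tbval g (first3 z) == a & tbval h (last3 z) == b]) points].

Definition formed g h (u : seq bool) :=
  all (fun z => consistent g h (rcons z false) ==>
     (tbval g (first3 z) (+) (g != h) && tbval h (last3 z) == dot7 u (rcons z true))) (bits 6).

End Tests.

Lemma ev_rd_at s k i : ev s (rd_at (EX k) i) = 4 * sx s k + i.
Proof. by rewrite /=; lia. Qed.
Lemma ev_tb_at s k i : ev s (tb_at (EX k) i) = 8 * sx s k + i.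
Proof. by rewrite /=; lia. Qed.

Section TestsOk.

Variable s : state.
Let n := sx s vN.
Let R := sa s Rd.
Let T := sa s Tb.
Let cls := sa s Cls.
Let par := sa s Par.
Let used := sa s Used.
Let g := sx s vG.
Let h := sx s vH.

Lemma ev_u k : ev s (uE k) = uvar n R g h k.
Proof.
rewrite /uE /uvar; case: ifP => _; first by rewrite /rdE -ev_rd_at.
by case: ifP => _ //; rewrite /rdE -ev_rd_at.
Qed.

Lemma ev_c k : ev s (cE k) = cls (uvar n R g h k). Proof. by rewrite -ev_u. Qed.
Lemma ev_p k : ev s (pE k) = par (uvar n R g h k). Proof. by rewrite -ev_u. Qed.

Lemma truth_tbG z : truth s (tbE (EX vG) z) = tbval T g z.
Proof. by rewrite /truth /tbval -ev_tb_at. Qed.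
Lemma truth_tbH z : truth s (tbE (EX vH) z) = tbval T h z.
Proof. by rewrite /truth /tbval -ev_tb_at. Qed.

Lemma truth_cons z : truth s (consE z) = consistent n R cls par g h z.
Proof.
rewrite truth_all all_map; apply: eq_all => -[p q] /=.
by rewrite truth_or truth_xor truth_lit truth_eq !ev_c !ev_p.
Qed.

Lemma truth_cand t : truth s (candE t) = cand n R T cls par used g h t.
Proof.
case: t => -[[[a b] p] q] c; rewrite /candE truth_all6 /cand; congr [&& _, _, _, _, _ & _].
- case: ifP => _; rewrite !truthE /= -/n -/g -/h; first by case: (g == h).
  by case: (g == h).
- by rewrite truth_not /truth /= -eqn0Ngt.
- by rewrite truth_not /truth /= -eqn0Ngt.
- by rewrite truth_xor !ev_c.
- by rewrite truth_xor ev_c.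
- rewrite truth_all all_map all_filter; apply: eq_all => z.
  by rewrite /= truth_not truth_and truth_cons truth_and !truth_lit truth_tbG truth_tbH.
Qed.

(** [sumE] adds table entries through [xorE], which is a sum modulo 2 on bits only; hence the bound
    on [T]. *)
Lemma truth_aff u : (forall i, T i <= 1) ->
  truth s (affE u) = [&& sa s Dn g == 0, used h == 0 & formed n R T cls par g h u].
Proof.
move=> hT; rewrite /affE truth_all3; congr [&& _, _ & _].
- by rewrite truth_not /truth /= -eqn0Ngt.
- by rewrite truth_not /truth /= -eqn0Ngt.
- rewrite truth_all all_map; apply: eq_all => z /=.
  rewrite truth_or truth_not truth_lit truth_cons implybE; congr (_ || _).
  rewrite truth_xor ev_and truth_xor truth_tbH /= -/g -/h /tbval -/T; congr (_ == _).
  have := hT (8 * g + nat_of_bits (first3 z)); have -> : g + g + (g + g) + (g + g + (g + g)) = 8 * g by lia.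
  by case: (T _) => [|[|]] //; case: (_ && _).
Qed.

Lemma odd_parE u :
  odd (ev s (parE u)) = \big[addb/false]_(k <- support6 u) odd (par (uvar n R g h k)) (+) nth false u 6.
Proof.
rewrite /parE; elim: (support6 u) => [|k l IH]; first by rewrite big_nil /=; case: (nth _ _ _).
by rewrite big_cons -addbA -IH [foldr _ _ _]/= ev_xor odd_xorn ev_p.
Qed.

Lemma parE_le1 u : (forall i, par i <= 1) -> ev s (parE u) <= 1.
Proof.
move=> hp; rewrite /parE; elim: (support6 u) => [|k l IH]; first by rewrite /=; case: (nth _ _ _).
by rewrite [foldr _ _ _]/= ev_xor ev_p; apply: xorn_le1.
Qed.

End TestsOk.

Opaque notE andE orE xorE equE ltE allE litE rd_at tb_at tbE rdE uE cE pE consE candE sumE affE parE points bits.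

(** * Classes of variables *)

Section Classes.

Variables (n m : nat) (R T : nat -> nat).
Hypothesis R_le : forall g k, g < m -> k < 3 -> R (4 * g + k) <= n.

Definition gate_val g (x : nat -> bool) := tbval T g [seq x (R (4 * g + k)) | k <- iota 0 3].

Definition class_val (cls par : nat -> nat) g (v : nat -> bool) :=
  gate_val g (fun i => v (cls i) (+) odd (par i)).

(** A union-find structure of depth one with parities. [cls n = n] keeps the constant as a
    representative, of value 0. *)
Definition wf_classes (cls par : nat -> nat) :=
  [/\ forall i, i <= n -> cls i <= n, forall i, i <= n -> cls (cls i) = cls i,
      forall i, i <= n -> par (cls i) = 0, cls n = n & forall i, par i <= 1].

Definition respects (cls par : nat -> nat) (x : nat -> bool) :=
  forall i, i <= n -> x i = x (cls i) (+) odd (par i).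

Local Notation uu := (uvar n R).

Lemma uu_le g h k : g < m -> h < m -> uu g h k <= n.
Proof.
move=> hg hh; rewrite /uvar; case: ifP => h3; first exact: R_le.
by case: ifP => h6 //; apply: R_le => //; lia.
Qed.

Lemma mem_pairs7 p q : ((p, q) \in pairs7) = (p < 7) && (q < 7).
Proof.
apply/idP/idP => [/allpairsP[[p' q'] [h1 h2 [-> ->]]]|/andP[hp hq]].
  by move: h1 h2; rewrite !mem_iota => /= -> ->.
by apply: allpairs_f; rewrite mem_iota.
Qed.

Lemma eqb_odd (a b : bool) (k l : nat) : k <= 1 -> l <= 1 ->
  ((k == l) == (a == b)) = (a (+) odd k == b (+) odd l).
Proof. by case: k => [|[|]] //; case: l => [|[|]] //; case: a; case: b. Qed.

Lemma consistentP cls par g h z : (forall i, par i <= 1) ->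
  reflect (forall p q, p < 7 -> q < 7 -> cls (uu g h p) = cls (uu g h q) ->
      nth false z p (+) odd (par (uu g h p)) = nth false z q (+) odd (par (uu g h q)))
    (consistent n R cls par g h z).
Proof.
move=> hpar; apply: (iffP allP) => [H p q hp hq e|H [p q]].
  have := H (p, q); rewrite mem_pairs7 hp hq e eqxx /= => /(_ isT).
  by rewrite eqb_odd // => /eqP.
rewrite mem_pairs7 => /andP[hp hq] /=; case: eqP => //= e.
by rewrite eqb_odd //; apply/eqP; apply: H.
Qed.

Definition values g h (x : nat -> bool) := [seq x (uu g h k) | k <- iota 0 6].

Lemma nth_values g h x b k : x n = b -> k < 7 -> nth false (rcons (values g h x) b) k = x (uu g h k).
Proof.
move=> <- hk; rewrite nth_rcons size_map size_iota; case: ltnP => h6.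
  by rewrite (nth_map 0) ?size_iota // nth_iota.
by have -> : k = 6 by lia.
Qed.

Lemma consistent_values cls par g h x : wf_classes cls par -> respects cls par x -> x n = false ->
  g < m -> h < m -> consistent n R cls par g h (rcons (values g h x) false).
Proof.
move=> [_ _ _ _ hp] hx hn hg hh; apply/consistentP => // p q hp7 hq7 e.
by rewrite !nth_values // [x (uu g h p)]hx ?[x (uu g h q)]hx ?uu_le // e -!addbA !addbb.
Qed.

(** Each class takes its value from the first of the seven variables that lies in it; consistency
    says that the others agree. Classes met by none of them are arbitrary. *)
Lemma consistent_lift cls par g h z : wf_classes cls par -> nth false z 6 = false ->
  consistent n R cls par g h z ->
  exists2 v, v n = false & forall k, k < 7 -> nth false z k = v (cls (uu g h k)) (+) odd (par (uu g h k)).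
Proof.
move=> [h1 h2 h3 hn hp] h6 hc; have hz := elimT (@consistentP cls par g h z hp) hc.
pose v c := let k := find (fun k => cls (uu g h k) == c) (iota 0 7) in
            nth false z k (+) odd (par (uu g h k)).
have vE k : k < 7 -> v (cls (uu g h k)) = nth false z k (+) odd (par (uu g h k)).
  move=> hk; rewrite /v; set k0 := find _ _.
  have hk0 : has (fun j => cls (uu g h j) == cls (uu g h k)) (iota 0 7).
    by apply/hasP; exists k; rewrite ?mem_iota.
  have lt0 : k0 < 7 by rewrite /k0; move: hk0; rewrite has_find size_iota.
  have := nth_find 0 hk0; rewrite -/k0 nth_iota // add0n => /eqP e.
  exact: hz.
exists v; last by move=> k hk; rewrite vE // addbK.
have := vE 6 isT; rewrite h6 /uvar /= hn => ->.
by rewrite -{1}hn h3.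
Qed.

Lemma first3_class cls par g h z v :
  (forall k, k < 7 -> nth false z k = v (cls (uu g h k)) (+) odd (par (uu g h k))) ->
  tbval T g (first3 z) = class_val cls par g v /\ tbval T h (last3 z) = class_val cls par h v.
Proof.
move=> hz; rewrite /class_val /gate_val /first3 /last3 !hz // /uvar.
Qed.

Lemma size_points z : z \in points -> size z = 7 /\ nth false z 6 = false.
Proof.
move=> /mapP[y]; rewrite mem_bits => /eqP hy ->; rewrite size_rcons hy; split=> //.
by rewrite nth_rcons hy.
Qed.

(** Completeness of the merging test: a forced equation between representatives becomes one between
    variables, with both complement bits added to its constant. *)
Lemma forced_cand cls par used g h a b :
  wf_classes cls par -> (g == h) && (a == b) || (g != h) && (1 < n) -> used g = 0 -> used h = 0 ->
  gate_forced n (fun v => (class_val cls par g v == a) && (class_val cls par h v == b))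
    [seq cls (uu g h k) | k <- iota 0 6] ->
  exists2 t, t \in choices & cand n R T cls par used g h t.
Proof.
move=> wf guard ug uh [P [Q [c [hP hQ hPQ hPn hf]]]].
have [_ _ _ hn _] := wf.
case/mapP: hP => p; rewrite mem_iota => /andP[_ hp] eP.
have [q hq eQ] : exists2 q, q < 7 & Q = cls (uu g h q).
  move: hQ; rewrite inE => /orP[/eqP ->|/mapP[q]]; first by exists 6 => //; rewrite /uvar /= hn.
  by rewrite mem_iota => /andP[_ hq] ->; exists q => //; lia.
exists (a, b, p, q, c (+) odd (par (uu g h p)) (+) odd (par (uu g h q))).
  exact: mem_choices.
rewrite /cand guard ug uh -eP -eQ hPQ hPn !eqxx !andTb; apply/allP => z /size_points[_ z6].
apply/implyP => hz; apply/negP => /and3P[hc ha hb].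
have [v vn vz] := consistent_lift wf z6 hc.
have [eg eh] := @first3_class cls par g h z v vz.
have := hf v vn; rewrite -eg -eh ha hb => /(_ isT) => e.
move: hz; rewrite !vz //; last by lia.
by rewrite -eP -eQ -e; case: (v P); case: (v Q); case: (odd _); case: (odd _).
Qed.

Lemma dot7_toggle u j z : j < 7 ->
  dot7 (mkseq (fun k => nth false u k (+) (k == j)) 7) z = dot7 u z (+) nth false z j.
Proof.
move=> hj; rewrite /dot7 -[RHS]addbF.
have -> : nth false z j = \big[addb/false]_(k <- iota 0 7) ((k == j) && nth false z k).
  rewrite (bigD1_seq j) ?mem_iota ?iota_uniq //= eqxx big1 ?addbF // => k /negPf ->; exact: andFb.
rewrite addbF -big_split; apply: eq_big_seq => k; rewrite mem_iota => /andP[_ hk].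
by rewrite nth_mkseq //; case: (nth false u k); case: (k == j); case: (nth false z k).
Qed.

(** Completeness of the linear test. [u] is built by induction on [ls]: toggle the coefficient of
    one variable of the class, and the constant term if that variable is complemented. Toggling also
    copes with repetitions in [ls]. *)
Lemma sum_formed cls par g h :
  wf_classes cls par ->
  gate_sum n (fun v => class_val cls par g v (+) (g != h) && class_val cls par h v)
    [seq cls (uu g h k) | k <- iota 0 6] ->
  exists2 u, u \in bits 7 & formed n R T cls par g h u.
Proof.
move=> wf [ls [c [hls hs]]].
have [u hu H] : exists2 u, size u = 7 & forall z v, size z = 6 ->
    (forall k, k < 7 -> nth false (rcons z false) k = v (cls (uu g h k)) (+) odd (par (uu g h k))) ->
    dot7 u (rcons z true) = c (+) xsum v ls.
  elim: ls hls {hs} => [_|a ls IH hls].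
    exists (nseq 6 false ++ [:: c]) => // z v hz _; rewrite /xsum big_nil addbF /dot7.
    rewrite /= !big_cons big_nil /= nth_rcons hz /=; by case: c.
  have [|u hu H] := IH; first by move=> x hx; apply: hls; rewrite inE hx orbT.
  have /mapP[k] := hls a (mem_head _ _); rewrite mem_iota => /andP[_ hk] ea.
  pose w := mkseq (fun i => nth false u i (+) (i == k)) 7.
  have hw z : size z = 6 -> dot7 w (rcons z true) = dot7 u (rcons z true) (+) nth false z k.
    by move=> hz; rewrite dot7_toggle ?nth_rcons ?hz ?hk //; lia.
  case e : (odd (par (uu g h k))); last first.
    exists w => [|z v hz hv]; first by rewrite size_mkseq.
    rewrite hw // (H z v) // /xsum big_cons -/(xsum v ls).
    have := hv k; rewrite e addbF -ea nth_rcons hz hk => -> //; last by lia.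
    by move: (c) (v a) (xsum v ls) => [] [] [].
  exists (mkseq (fun i => nth false w i (+) (i == 6)) 7) => [|z v hz hv]; first by rewrite size_mkseq.
  rewrite dot7_toggle // hw // (H z v) // /xsum big_cons -/(xsum v ls).
  have := hv k; rewrite e -ea !nth_rcons hz hk eqxx /= => -> //; last by lia.
  by move: (c) (v a) (xsum v ls) => [] [] [].
exists u; first by rewrite mem_bits hu.
apply/allP => z; rewrite mem_bits => /eqP hz; apply/implyP => hc.
have [|v vn vz] := consistent_lift wf _ hc; first by rewrite nth_rcons hz.
rewrite (H z v) // -hs // -(first3_class vz).1 -(first3_class vz).2.
by rewrite /first3 /last3 !nth_rcons hz.
Qed.

(** * The invariant of merging *)

Definition nused (used : nat -> nat) := \sum_(g < m) (0 < used g).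
Definition nroots (cls : nat -> nat) := \sum_(i < n) (cls i == i).

(** The third clause is soundness: whatever matches the outputs fixed so far obeys all equations.
    The last two are the budget: two gates for each vanished class, but only one when [n <= 1]. *)
Definition inv_merge (cls par used Y : nat -> nat) :=
  [/\ wf_classes cls par, forall g, Y g <= 1,
      forall x, x n = false -> (forall g, g < m -> 0 < used g -> gate_val g x = odd (Y g)) ->
        respects cls par x,
      nused used + 2 * nroots cls <= 2 * n
    & n <= 1 -> nused used + nroots cls <= n].

Lemma nused_upd used g v : nused (upd used g v) <= nused used + 1.
Proof.
rewrite /nused; case: (ltnP g m) => hg; last first.
  apply: leq_trans (leq_addr _ _); apply: leq_sum => i _; rewrite updE.
  by case: eqP => // e; have := ltn_ord i; lia.
rewrite (bigD1 (Ordinal hg)) //= (bigD1 (F := fun i : 'I_m => (0 < used i : nat)) (Ordinal hg)) //= addnC.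
apply: leq_add; last by apply: leq_b1.
apply: (@leq_trans (\sum_(i < m | i != Ordinal hg) (0 < used i))); last by apply: leq_addl.
apply: leq_sum => i hi; rewrite updE; case: eqP => // e.
by case/negP: hi; apply/eqP/val_inj.
Qed.

Lemma merge_inv cls par used Y g h a b p q c cls' par' used' Y' :
  inv_merge cls par used Y -> g < m -> h < m -> p < 7 -> q < 7 ->
  cand n R T cls par used g h (a, b, p, q, c) ->
  let P := cls (uu g h p) in let Q := cls (uu g h q) in
  let C := xorn (xorn (par (uu g h p)) (par (uu g h q))) c in
  (forall i, cls' i = if (i <= n) && (cls i == P) then Q else cls i) ->
  (forall i, par' i = if (i <= n) && (cls i == P) then xorn (par i) C else par i) ->
  used' =1 upd (upd used g 1) h 1 -> Y' =1 upd (upd Y g a) h b ->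
  inv_merge cls' par' used' Y' /\ nroots cls' < nroots cls.
Proof.
move=> [wf Yb snd cnt cnt1] hg hh hp hq hc P Q C hcls hpar hused hY.
have [w1 w2 w3 w4 w5] := wf.
move: hc => /and5P[guard /eqP ug /eqP uh hPQ /andP[hPn /allP hall]].
rewrite -/P -/Q in hPQ hPn.
have lp := uu_le p hg hh; have lq := uu_le q hg hh.
have PP : cls P = P by rewrite w2.
have QQ : cls Q = Q by rewrite w2.
have lP : P < n by have := w1 _ lp; rewrite -/P; lia.
have lQ : Q <= n by apply: w1.
have Cb : C <= 1 by apply: xorn_le1; [apply: xorn_le1|case: (c)].
(* Exactly one representative is lost, namely [P]. *)
have roots i : i < n -> (cls' i == i) = (cls i == i) && (i != P).
  move=> hi; rewrite hcls (ltnW hi) /=; case: (eqVneq (cls i) P) => e /=.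
    case: (eqVneq (cls i) i) => e2 /=; first by rewrite -{2}e2 e eqxx -e2 e eq_sym (negPf hPQ).
    by apply/negbTE; apply: contraNneq e2 => <-; rewrite QQ.
  by case: (eqVneq (cls i) i) => //= e2; rewrite -{1}e2 e.
have hroots : nroots cls = (nroots cls').+1.
  rewrite /nroots (bigD1 (Ordinal lP)) //= PP eqxx add1n; congr _.+1.
  rewrite [RHS](bigD1 (Ordinal lP)) //= roots // eqxx andbF add0n.
  apply: eq_bigr => i hi; rewrite roots //.
  have -> : (i : nat) != P by apply: contraNneq hi => e; apply/eqP/val_inj.
  by rewrite andbT.
split; last by rewrite hroots.
split.
- split.
  + by move=> i hi; rewrite hcls; case: ifP => // _; apply: w1.
  + move=> i hi; rewrite [cls' i]hcls hi /=; case: eqP => e; rewrite hcls.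
      by rewrite QQ eq_sym (negPf hPQ) andbF.
    by rewrite w2 // w1 //=; case: eqP.
  + move=> i hi; rewrite [cls' i]hcls hi /=; case: eqP => e; rewrite hpar.
      by rewrite QQ eq_sym (negPf hPQ) andbF -QQ w3.
    by rewrite w2 // w1 //=; case: eqP => // _; rewrite w3.
  + by rewrite hcls w4 eq_sym (negPf hPn) andbF.
  + by move=> i; rewrite hpar; case: ifP => // _; apply: xorn_le1.
- by move=> i; rewrite hY !updE; case: ifP => _; [case: (b)|case: ifP => _ //; case: (a)].
- move=> x xn hx.
  have rx : respects cls par x.
    apply: snd => // k hk uk; rewrite hx // ?hused ?hY !updE.
      by case: eqP => [e|_]; [rewrite e uh in uk|case: eqP => // e; rewrite e ug in uk].
    by case: ifP => // _; case: ifP.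
  have hz := consistent_values wf rx xn hg hh.
  have mz : rcons (values g h x) false \in points.
    by apply/mapP; exists (values g h x); rewrite // mem_bits size_map size_iota.
  (* For [g = h] the output [b] overrides [a]; the guard makes them equal. *)
  have Eg : tbval T g (first3 (rcons (values g h x) false)) = a.
    rewrite -[LHS]/(gate_val g x) hx // ?hused ?hY !updE ?eqxx; last by case: ifP.
    case: eqP => e; last by case: (a).
    by move: guard; rewrite e eqxx /= orbF => /eqP ->; case: (b).
  have Eh : tbval T h (last3 (rcons (values g h x) false)) = b.
    by rewrite -[LHS]/(gate_val h x) hx // ?hused ?hY !updE ?eqxx //; case: (b).
  have := hall _ mz; rewrite hz Eg Eh !eqxx /= implybF negbK !nth_values // => /eqP e.
  have key : x P = x Q (+) odd C.
    move: e; rewrite [x (uu g h p)]rx // [x (uu g h q)]rx // -/P -/Q /C !odd_xorn.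
    by move=> <-; case: (c); case: (x P); case: (x Q); case: (odd _); case: (odd _).
  move=> i hi; rewrite hcls hpar hi /= rx //; case: eqP => // ->.
  by rewrite odd_xorn key; case: (x Q); case: (odd C); case: (odd _).
- have := nused_upd used g 1; have := nused_upd (upd used g 1) h 1.
  have -> : nused used' = nused (upd (upd used g 1) h 1) by apply: eq_bigr => i _; rewrite hused.
  by rewrite hroots in cnt; lia.
- move=> n1; move: guard; rewrite ltnNge n1 andbF orbF => /andP[/eqP e _]; subst h.
  have -> : nused used' = nused (upd used g 1).
    by apply: eq_bigr => i _; rewrite hused !updE; case: (_ == _).
  have := nused_upd used g 1; have := cnt1 n1; rewrite hroots; lia.
Qed.

End Classes.

(** * The merging stage *)

Lemma bounded_setx L s k i : bounded L s -> i <= L -> bounded L (setx s k i).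
Proof. by move=> [b1 b2 b3] hi; split=> //= j; rewrite updE; case: eqP. Qed.

Lemma ev_le_x L s k : bounded L s -> minn (sx s k) L = sx s k.
Proof. by case=> b1 _ _; apply/minn_idPl. Qed.

Lemma ev_le_a L s a i : bounded L s -> minn (sa s a i) L = sa s a i.
Proof. by case=> _ b2 _; apply/minn_idPl. Qed.

Section MergeStage.

Variables (L n m : nat) (R T : nat -> nat).
Hypothesis R_le : forall g k, g < m -> k < 3 -> R (4 * g + k) <= n.
Hypothesis nL : n < L.
Hypothesis mL : m <= L.

Definition ctx s := [/\ sx s vN = n, sx s vM = m, sa s Rd = R, sa s Tb = T & bounded L s].

Definition inv_merge_st s := inv_merge n m R T (sa s Cls) (sa s Par) (sa s Used) (sa s Ys).

Definition cand_st s g h t := cand n R T (sa s Cls) (sa s Par) (sa s Used) g h t.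

Definition keeps_ctx c := [&& keeps_var vN c, keeps_var vM c, keeps_arr Rd c & keeps_arr Tb c].

Lemma ctx_sem c s : keeps_ctx c -> ctx s -> ctx (sem L c s).
Proof.
move=> /and4P[k1 k2 k3 k4] [h1 h2 h3 h4 h5].
by split; rewrite ?keeps_varP ?keeps_arrP //; apply: bounded_sem.
Qed.

Lemma ctx_setx s k i : k != vN -> k != vM -> i <= L -> ctx s -> ctx (setx s k i).
Proof.
move=> k1 k2 hi [h1 h2 h3 h4 h5]; split=> //; last exact: bounded_setx.
  by rewrite /= updE eq_sym (negPf k1).
by rewrite /= updE eq_sym (negPf k2).
Qed.

Lemma relabel_ok s : ctx s -> (forall i, sa s Par i <= 1) -> sx s vC <= 1 ->
  let s' := sem L relabel s in
  (forall i, sa s' Cls i = if (i <= n) && (sa s Cls i == sx s vP) then sx s vQ else sa s Cls i) /\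
  (forall i, sa s' Par i = if (i <= n) && (sa s Cls i == sx s vP) then xorn (sa s Par i) (sx s vC)
                           else sa s Par i).
Proof.
move=> hs hpar hC.
pose P j s' := [/\ ctx s', sx s' vP = sx s vP, sx s' vQ = sx s vQ & sx s' vC = sx s vC] /\
  (forall i, sa s' Cls i = if (i < j) && (sa s Cls i == sx s vP) then sx s vQ else sa s Cls i) /\
  (forall i, sa s' Par i = if (i < j) && (sa s Cls i == sx s vP) then xorn (sa s Par i) (sx s vC)
                           else sa s Par i).
have [hN _ _ _ hb] := hs.
suff : P n.+1 (sem L relabel s) by case=> _ [h1 h2]; split=> i; [apply: h1|apply: h2].
apply: sem_for_ind.
    by rewrite /= hN addn1; apply/minn_idPl.
  by split.
move=> j s' hj [[c1 c2 c3 c4] [h1 h2]].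
have hs1 : ctx (setx s' vI j) by apply: ctx_setx => //; lia.
have hb1 : bounded L (setx s' vI j) by case: hs1.
split.
  by split; rewrite ?keeps_varP //; apply: ctx_sem.
rewrite sem_when -/(truth _ _) truth_eq /= !updE /= h1 ltnn /= c2.
have split_lt i : (i < j.+1) = (i < j) || (i == j) by rewrite ltnS leq_eqVlt orbC.
case: eqP => e /=; split=> i.
- rewrite updE split_lt; case: (eqVneq i j) => [->|hij]; last by rewrite orbF h1.
  by rewrite orbT e eqxx /= -c3 -[sx s' vQ]/(sx (setx s' vI j) vQ) ev_le_x.
- rewrite updE split_lt; case: (eqVneq i j) => [->|hij]; last by rewrite orbF h2.
  rewrite orbT e eqxx ev_xor /= !updE /= h2 ltnn /= c4.
  by apply/minn_idPl; apply: leq_trans (xorn_le1 _ _) _ => //; lia.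
- by rewrite h1 split_lt; case: (eqVneq i j) => [->|]; rewrite ?orbF // ltnn orbT /=; case: eqP e.
- by rewrite h2 split_lt; case: (eqVneq i j) => [->|]; rewrite ?orbF // ltnn orbT /=; case: eqP e.
Qed.

Lemma keeps_ctx_try t : keeps_ctx (try_merge t).
Proof. by case: t => -[[[a b] p] q] c. Qed.

Lemma keeps_try t : keeps_var vG (try_merge t) && keeps_var vH (try_merge t).
Proof. by case: t => -[[[a b] p] q] c. Qed.

Lemma try_merge_ok s t g h : ctx s -> inv_merge_st s -> t \in choices ->
  sx s vG = g -> sx s vH = h -> g < m -> h < m ->
  let s' := sem L (try_merge t) s in
  if cand_st s g h t then inv_merge_st s' /\ nroots n (sa s' Cls) < nroots n (sa s Cls) else s' = s.
Proof.
move=> hs hi ht hG hH hg hh.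
have [hN hM hRd hTb hb] := hs.
have E : truth s (candE t) = cand_st s g h t by rewrite truth_cand hN hRd hTb hG hH.
rewrite [sem _ _ _]sem_when -/(truth _ _) E; case: ifP => // hc.
case: t ht hc {E} => -[[[a b] p] q] c ht hc; cbv zeta.
have [hp hq] := choices_lt ht.
rewrite [merge_cmd _]/=.
have hwf : wf_classes n (sa s Cls) (sa s Par) by case: hi.
have pb : forall i, sa s Par i <= 1 by case: hwf.
set s1 := sem L (Asg vP (cE p)) s.
have c1 : ctx s1 by apply: ctx_sem.
set s2 := sem L (Asg vQ (cE q)) s1.
have c2 : ctx s2 by apply: ctx_sem.
set s3 := sem L (Asg vC (xorE (xorE (pE p) (pE q)) (EN c))) s2.
have c3 : ctx s3 by apply: ctx_sem.
set s7 := sem L (seqs [:: Sto Used (EX vG) (EN 1); Sto Used (EX vH) (EN 1);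
    Sto Ys (EX vG) (EN a); Sto Ys (EX vH) (EN b)]) s3.
have c7 : ctx s7 by apply: ctx_sem.
have -> : sem L (merge_cmd (a, b, p, q, c)) s = sem L relabel s7 by [].
have eP : sx s7 vP = sa s Cls (uvar n R g h p).
  by rewrite /s7 keeps_varP // /s3 keeps_varP // /s2 keeps_varP //= updE /= ev_c hN hRd hG hH ev_le_a.
have eQ : sx s7 vQ = sa s Cls (uvar n R g h q).
  rewrite /s7 keeps_varP // /s3 keeps_varP //= updE /= ev_c.
  have [-> _ -> _ _] := c1; rewrite (_ : sx s1 vG = g) // (_ : sx s1 vH = h) //.
  by rewrite (_ : sa s1 Cls = sa s Cls) // ev_le_a.
have L1 : 1 <= L by lia.
have eC : sx s7 vC = xorn (xorn (sa s Par (uvar n R g h p)) (sa s Par (uvar n R g h q))) c.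
  rewrite /s7 keeps_varP //= updE /= !ev_xor !ev_p.
  have [-> _ -> _ _] := c2; rewrite (_ : sx s2 vG = g) // (_ : sx s2 vH = h) //.
  rewrite (_ : sa s2 Par = sa s Par) //=; apply/minn_idPl.
  by apply: leq_trans L1; apply: xorn_le1; [apply: xorn_le1|case: (c)].
have h7C : sx s7 vC <= 1 by rewrite eC; apply: xorn_le1; [apply: xorn_le1|case: (c)].
have [r1 r2] := relabel_ok c7 pb h7C.
rewrite eP eQ in r1; rewrite eP eC in r2.
apply: (merge_inv R_le hi hg hh hp hq hc r1 r2).
- by move=> i; rewrite keeps_arrP //= !updE /= hG hH (minn_idPl L1).
- move=> i; rewrite keeps_arrP //= !updE /= hG hH.
  by have [-> ->] : minn a L = a /\ minn b L = b by case: (a); case: (b); lia.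
Qed.

Definition stable_st s := forall g h t, g < m -> h < m -> t \in choices -> ~~ cand_st s g h t.

(** Either some merge has happened since [s0], which was then unstable, or the arrays that the tests
    read are unchanged, so that every failed test in [S] is still a statement about [s0]. *)
Definition progress s0 (S : nat -> nat -> mchoice -> Prop) s :=
  [/\ ctx s, inv_merge_st s &
     (nroots n (sa s Cls) < nroots n (sa s0 Cls) /\ ~ stable_st s0) \/
     [/\ sa s Cls = sa s0 Cls, sa s Par = sa s0 Par, sa s Used = sa s0 Used
       & forall g h t, S g h t -> ~~ cand_st s0 g h t]].

Lemma progress_sub s0 S S' s : (forall g h t, S' g h t -> S g h t) -> progress s0 S s -> progress s0 S' s.
Proof.
move=> sub [h1 h2 h3]; split=> //; case: h3 => [|[e1 e2 e3 e4]]; [by left|right].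
by split=> // g h t /sub; apply: e4.
Qed.

Lemma progress_setx s0 S s k i : k != vN -> k != vM -> i <= L ->
  progress s0 S s -> progress s0 S (setx s k i).
Proof. by move=> k1 k2 hi [h1 h2 h3]; split=> //; apply: ctx_setx. Qed.

Lemma progress_list s0 S s l g h : progress s0 S s -> {subset l <= choices} ->
  sx s vG = g -> sx s vH = h -> g < m -> h < m ->
  let s' := sem L (seqs [seq try_merge t | t <- l]) s in
  [/\ progress s0 (fun g' h' t => S g' h' t \/ [/\ g' = g, h' = h & t \in l]) s', sx s' vG = g & sx s' vH = h].
Proof.
elim: l S s => [|t l IH] S s hp sub hG hH hg hh.
  by split=> //; apply: progress_sub hp => g' h' t [|[]].
rewrite [map _ _]/= sem_seqs_cons; set s1 := sem L (try_merge t) s.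
have [kG kH] := andP (keeps_try t).
have hG1 : sx s1 vG = g by rewrite keeps_varP.
have hH1 : sx s1 vH = h by rewrite keeps_varP.
have ht : t \in choices by apply: sub; apply: mem_head.
have sub' : {subset l <= choices} by move=> y hy; apply: sub; rewrite inE hy orbT.
have [p1 p2 p3] := hp.
have hp1 : progress s0 (fun g' h' t' => S g' h' t' \/ [/\ g' = g, h' = h & t' = t]) s1.
  have := try_merge_ok p1 p2 ht hG hH hg hh; cbv zeta; rewrite -/s1.
  case: ifP => [hc [i1 lt1]|hc ->].
    split=> //; first by apply: ctx_sem => //; apply: keeps_ctx_try.
    left; case: p3 => [[lt2 ns]|[e1 e2 e3 e4]]; first by split=> //; apply: ltn_trans lt2.
    split; first by rewrite -e1.
    by move=> st; move: (st g h t hg hh ht); rewrite /cand_st -e1 -e2 -e3 -/(cand_st s g h t) hc.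
  split=> //; case: p3 => [|[e1 e2 e3 e4]]; [by left|right; split=> //].
  move=> g' h' t' [/e4 //|[-> -> ->]].
  by rewrite /cand_st -e1 -e2 -e3 -/(cand_st s g h t) hc.
have [q1 q2 q3] := IH _ _ hp1 sub' hG1 hH1 hg hh.
split=> //; apply: progress_sub q1 => g' h' t' [hS|[eg eh]]; first by left; left.
by rewrite inE => /orP[/eqP et|]; [left; right|right].
Qed.

Lemma merge_round_ok s : ctx s -> inv_merge_st s ->
  progress s (fun g h t => [/\ g < m, h < m & t \in choices]) (sem L merge_round s).
Proof.
move=> hc hi.
have hm : minn m L = m by apply/minn_idPl.
apply: (@sem_for_ind L vG (EX vM) _ s (fun j => progress s (fun g h t => [/\ g < j, h < m & t \in choices])) m).
    by case: hc => _ /= -> _ _ _.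
  by split=> //; right; split=> // g h t [].
move=> j s' hj hp.
have hp1 : progress s (fun g h t => [/\ g < j, h < m & t \in choices]) (setx s' vG j).
  by apply: progress_setx hp => //; lia.
pose P i s1 := progress s (fun g h t => [/\ g < j, h < m & t \in choices] \/ [/\ g = j, h < i & t \in choices]) s1
   /\ sx s1 vG = j.
suff [h1 _] : P m (sem L (For vH (EX vM) (seqs [seq try_merge t | t <- choices])) (setx s' vG j)).
  apply: progress_sub h1 => g h t [hg hh ht].
  by move: hg; rewrite ltnS leq_eqVlt => /orP[/eqP ->|hg]; [right|left].
apply: sem_for_ind.
    by case: hp1 => -[_ /= -> _ _ _].
  by split=> //; apply: progress_sub hp1 => g h t [] // [].
move=> i s1 hi' [hp2 hG].
have hp3 : progress s (fun g h t => [/\ g < j, h < m & t \in choices] \/ [/\ g = j, h < i & t \in choices])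
   (setx s1 vH i) by apply: progress_setx hp2 => //; lia.
have hG3 : sx (setx s1 vH i) vG = j by [].
have hH3 : sx (setx s1 vH i) vH = i by [].
have [q1 q2 q3] := progress_list hp3 (fun t ht => ht) hG3 hH3 hj hi'.
split; last exact: q2.
apply: progress_sub q1 => g h t [hl|[hg hh ht]]; first by left; left.
move: hh; rewrite ltnS leq_eqVlt => /orP[/eqP e|hh].
  by right; split; [exact: hg|exact: e|exact: ht].
by left; right; split; [exact: hg|exact: hh|exact: ht].
Qed.

Lemma nroots_le cls : nroots n cls <= n.
Proof. by rewrite -[X in _ <= X]card_ord -sum1_card; apply: leq_sum => i _; apply: leq_b1. Qed.

Lemma merge_stage_ok s : ctx s -> inv_merge_st s ->
  let s' := sem L merge_stage s in [/\ ctx s', inv_merge_st s' & stable_st s'].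
Proof.
move=> hc hi.
(* At [j = n + 1] the first alternative is impossible. *)
pose P j s' := [/\ ctx s', inv_merge_st s' & nroots n (sa s' Cls) + j <= n \/ stable_st s'].
have : P n.+1 (sem L merge_stage s).
  apply: sem_for_ind.
      by case: hc => /= -> _ _ _ _; rewrite addn1; apply/minn_idPl.
    by split=> //; left; rewrite addn0 nroots_le.
  move=> j s' hj [h1 h2 h3].
  have c1 : ctx (setx s' vRep j) by apply: ctx_setx => //; lia.
  have [q1 q2 q3] := merge_round_ok c1 h2.
  split=> //; case: q3 => [[lt ns]|[e1 e2 e3 e4]].
    case: h3 => [h3|st]; last by case: ns => g h t hg hh ht; apply: st.
    left; move: lt; rewrite -[sa (setx _ _ _) Cls]/(sa s' Cls).
    by move: (nroots _ (sa s' _)) h3 (nroots _ _) => k1 h3 k2; lia.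
  right=> g h t hg hh ht; rewrite /cand_st e1 e2 e3.
  exact: e4.
by case=> h1 h2 [|h3]; [rewrite addnS; lia|split].
Qed.

End MergeStage.

(** * Gaussian elimination *)

Section Gauss.

Variables (L n : nat).
Hypothesis nL : n * n <= L.
Hypothesis L1 : 0 < L.

Definition dotx (r : nat -> nat) (x : nat -> bool) := \big[addb/false]_(j < n) (odd (r j) && x j).

Lemma eq_dotx r r' x : (forall j, j < n -> r j = r' j) -> dotx r x = dotx r' x.
Proof. by move=> h; apply: eq_bigr => j _; rewrite h. Qed.

Lemma dotx0 r x : (forall j, j < n -> r j = 0) -> dotx r x = false.
Proof. by move=> h; apply: big1 => j _; rewrite h. Qed.

Lemma dotx_xorn r r' x : dotx (fun j => xorn (r j) (r' j)) x = dotx r x (+) dotx r' x.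
Proof.
rewrite /dotx -big_split; apply: eq_bigr => j _; rewrite odd_xorn /=.
by case: (odd _); case: (odd _); case: (x j).
Qed.

Definition rowv s i j := sa s Row (i * n + j).

Definition zero_rows s x := forall i, i < n -> 0 < sa s Has i -> dotx (rowv s i) x = false.

Definition nhas s := \sum_(i < n) (0 < sa s Has i).

(** Row [i] has its pivot at [i], and rows are supported on representatives; hence there are at most
    [nroots] of them. *)
Definition rows_wf s :=
  (forall i, sa s Row i <= 1) /\
  forall i, i < n -> 0 < sa s Has i ->
    [/\ sa s Cls i = i, rowv s i i = 1, forall j, j < i -> rowv s i j = 0
      & forall j, j < n -> 0 < rowv s i j -> sa s Cls j = j].

Definition vec_wf s :=
  (forall i, sa s Vec i <= 1) /\ forall j, j < n -> 0 < sa s Vec j -> sa s Cls j = j.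

Lemma insert_row_ok s i : bounded L s -> sx s vN = n -> sx s vOff = i * n -> sx s vI = i -> i < n ->
  let s' := sem L insert_row s in
  [/\ forall k, sa s' Row k = if i * n <= k < i * n + n then sa s Vec (k - i * n) else sa s Row k,
      forall k, sa s' Vec k = if k < n then 0 else sa s Vec k,
      forall k, sa s' Has k = if k == i then 1 else sa s Has k & sx s' vIns = 1].
Proof.
move=> hb hN hO hI hi.
pose P j s' := [/\ bounded L s', sx s' vOff = i * n, sx s' vI = i,
   (forall k, sa s' Row k = if i * n <= k < i * n + j then sa s Vec (k - i * n) else sa s Row k) &
   (forall k, sa s' Vec k = if k < j then 0 else sa s Vec k)] /\ sa s' Has = sa s Has.
have nL' : n <= L by apply: leq_trans nL; case: (n) => // k; rewrite leq_pmulr.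
have : P n (sem L (For vJ (EX vN) (Seq (Sto Row (EAdd (EX vOff) (EX vJ)) (EA Vec (EX vJ)))
    (Sto Vec (EX vJ) (EN 0)))) s).
  apply: sem_for_ind.
      by rewrite /= hN; apply/minn_idPl.
    by split=> //; split=> // k; rewrite addn0; case: ltnP => //; rewrite ?andbF // => h; rewrite leqNgt h.
  move=> j s' hj [[h1 h2 h3 h4 h5] h6].
  have hb1 : bounded L (setx s' vJ j) by apply: bounded_setx => //; lia.
  split; last by rewrite keeps_arrP.
  split; [exact: bounded_sem|by rewrite keeps_varP|by rewrite keeps_varP|move=> k|move=> k].
    rewrite /= !updE /= h2 -[sa s' Vec j]/(sa (setx s' vJ j) Vec j) ev_le_a //= h5 ltnn h4.
    case: eqP => [->|hk]; first by rewrite leq_addr ltn_add2l ltnSn /= addKn.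
    by congr (if _ then _ else _); lia.
  rewrite /= !updE /= min0n h5; case: eqP => [->|hk]; first by rewrite ltnSn.
  by congr (if _ then _ else _); lia.
rewrite /insert_row sem_seqs_cons; move: (sem L (For _ _ _) s) => s1 [[h1 h2 h3 h4 h5] h6].
split=> //=.
- by move=> k; rewrite !updE h3 (minn_idPl L1) h6.
- by rewrite updE (minn_idPl L1).
Qed.

Lemma reduce_row_ok s i : bounded L s -> sx s vN = n -> sx s vOff = i * n -> i < n ->
  (forall k, sa s Row k <= 1) -> (forall k, sa s Vec k <= 1) ->
  let s' := sem L reduce_row s in
  forall k, sa s' Vec k = if k < n then xorn (sa s Vec k) (rowv s i k) else sa s Vec k.
Proof.
move=> hb hN hO hi hR hV.
pose P j s' := [/\ bounded L s', sx s' vOff = i * n, sa s' Row = sa s Row &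
   (forall k, sa s' Vec k = if k < j then xorn (sa s Vec k) (rowv s i k) else sa s Vec k)].
have nL' : n <= L by apply: leq_trans nL; case: (n) => // k; rewrite leq_pmulr.
suff : P n (sem L reduce_row s) by case.
apply: sem_for_ind.
    by rewrite /= hN; apply/minn_idPl.
  by split.
move=> j s' hj [h1 h2 h3 h4].
have hb1 : bounded L (setx s' vJ j) by apply: bounded_setx => //; lia.
split.
- exact: bounded_sem.
- by rewrite keeps_varP.
- by rewrite keeps_arrP.
- move=> k; rewrite /= ev_xor /= !updE /= h2 h3 !h4 ltnn.
  case: eqP => [->|hk]; last by congr (if _ then _ else _); lia.
  rewrite ltnSn; apply/minn_idPl; apply: leq_trans L1; exact: xorn_le1.
Qed.

Lemma row_disj i i' j : i != i' -> j < n -> i * n <= i' * n + j < i * n + n = false.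
Proof.
move=> hii hj; case: (ltngtP i i') hii => // h _.
  have : i.+1 * n <= i' * n by rewrite leq_mul2r h orbT.
  by rewrite mulSn; move: (i * n) (i' * n) => u w; lia.
have : i'.+1 * n <= i * n by rewrite leq_mul2r h orbT.
by rewrite mulSn; move: (i * n) (i' * n) => u w; lia.
Qed.

Lemma nhas_add s s' i : i < n -> sa s Has i = 0 ->
  (forall k, sa s' Has k = if k == i then 1 else sa s Has k) -> nhas s' = nhas s + 1.
Proof.
move=> hi h0 h; rewrite /nhas (bigD1 (Ordinal hi)) //= [in RHS](bigD1 (Ordinal hi)) //= h eqxx h0 add0n addnC.
congr (_ + _); apply: eq_bigr => k hk; rewrite h; case: eqP => // e.
by case/negP: hk; apply/eqP/val_inj.
Qed.

(** Before an insertion the rows are untouched, and reduction has not changed the value of the form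
    where they vanish; after one, the vector is zero. *)
Definition gauss_inv s i o s' :=
  [/\ sx s' vN = n, bounded L s', sx s' vOff = o, sa s' Cls = sa s Cls & rows_wf s'] /\
  [/\ vec_wf s', forall j, j < i -> sa s' Vec j = 0, nhas s' = nhas s + sx s' vIns,
      sx s' vIns = 1 /\ (forall j, j < n -> sa s' Vec j = 0) \/
      [/\ sx s' vIns = 0, sa s' Row = sa s Row, sa s' Has = sa s Has
        & forall x, zero_rows s x -> dotx (sa s' Vec) x = dotx (sa s Vec) x]
    & forall x, zero_rows s x -> dotx (sa s Vec) x = false -> zero_rows s' x].

Lemma gauss_inv_setx s i o s' k v : gauss_inv s i o s' -> k != vN -> k != vOff -> k != vIns -> v <= L ->
  gauss_inv s i o (setx s' k v).
Proof.
move=> [[h1 h2 h3 h4 h5] [h6 h7 h8 h9 h10]] k1 k2 k3 hv.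
have e j : j != k -> sx (setx s' k v) j = sx s' j by move=> /negPf hj; rewrite /= updE hj.
split; split=> //; rewrite ?e // 1?eq_sym //; exact: bounded_setx.
Qed.

Lemma next_row s i s' : i < n -> gauss_inv s i.+1 (i * n) s' ->
  gauss_inv s i.+1 (i.+1 * n) (sem L (Asg vOff (EAdd (EX vOff) (EX vN))) s').
Proof.
move=> hi [[h1 h2 h3 h4 h5] h6].
split; last by case: h6 => q1 q2 q3 q4 q5; split.
split=> //; first by apply: bounded_sem.
rewrite /= updE /= h3 h1 mulSn addnC; apply/minn_idPl.
by apply: leq_trans nL; rewrite -mulSn leq_mul2r hi orbT.
Qed.

Lemma insert_cond s i : sx s vI = i ->
  (0 < ev s (andE (EA Vec (EX vI)) (notE (EA Has (EX vI))))) = (0 < sa s Vec i) && (sa s Has i == 0).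
Proof. by move=> hI; rewrite -/(truth _ _) truth_and truth_not /truth /= hI eqn0Ngt. Qed.

Lemma reduce_cond s i : sx s vI = i ->
  (0 < ev s (andE (EA Vec (EX vI)) (EA Has (EX vI)))) = (0 < sa s Vec i) && (0 < sa s Has i).
Proof. by move=> hI; rewrite -/(truth _ _) truth_and /truth /= hI. Qed.

Lemma gauss_step_ok s i s' : i < n -> gauss_inv s i (i * n) s' -> sx s' vI = i ->
  gauss_inv s i.+1 (i.+1 * n) (sem L gauss_step s').
Proof.
move=> hi [[hN hb hO hC hR] [hV hz hc hcase hx]] hI.
rewrite /gauss_step 3!sem_seqs_cons sem_seqs_nil; apply: next_row => //.
rewrite [sem L (When _ insert_row) s']sem_when (insert_cond hI).
have v1 : sa s' Vec i <= 1 := hV.1 i.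
case: (posnP (sa s' Vec i)) => hv.
  rewrite andFb sem_when (reduce_cond hI) hv andFb.
  split=> //; split=> // j; rewrite ltnS leq_eqVlt => /orP[/eqP -> //|]; exact: hz.
case: hcase => [[_ h0]|[ins0 eR eH hd]]; first by move: hv; rewrite h0.
have vi1 : sa s' Vec i = 1 by lia.
rewrite andTb; case: (posnP (sa s' Has i)) => hh.
  have [r1 r2 r3 r4] := insert_row_ok hb hN hO hI hi.
  have n1 : sx (sem L insert_row s') vN = n by rewrite keeps_varP.
  have b1 : bounded L (sem L insert_row s') by apply: bounded_sem.
  have o1 : sx (sem L insert_row s') vOff = i * n by rewrite keeps_varP.
  have C1 : sa (sem L insert_row s') Cls = sa s Cls by rewrite keeps_arrP.
  have I1 : sx (sem L insert_row s') vI = i by rewrite keeps_varP.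
  move: (sem L insert_row s') r1 r2 r3 r4 n1 b1 o1 C1 I1 => s1 r1 r2 r3 r4 n1 b1 o1 C1 I1.
  have rown j : j < n -> rowv s1 i j = sa s' Vec j.
    by move=> hj; rewrite /rowv r1 leq_addr ltn_add2l hj /= addKn.
  have rowo i' j : i' != i -> j < n -> rowv s1 i' j = rowv s' i' j.
    by move=> hii hj; rewrite /rowv r1 row_disj // eq_sym.
  (* The insertion has cleared [Vec], so the reduction test that follows fails. *)
  rewrite sem_when (reduce_cond I1) r2 hi andFb.
  split.
    split=> //; split=> [k|k hk].
      by rewrite r1; case: ifP => _; [apply: hV.1|apply: hR.1].
    rewrite r3; case: eqP => [-> _|/eqP hki hk0].
      rewrite rown // vi1 C1 -hC; split=> //; first by apply: hV.2 => //; rewrite vi1.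
        by move=> j hj; rewrite rown ?hz //; lia.
      by move=> j hj; rewrite rown // => hvj; apply: hV.2.
    have [q1 q2 q3 q4] := hR.2 k hk hk0.
    rewrite C1 -hC rowo //; split=> // j hj; first by rewrite rowo ?q3 //; lia.
    by rewrite rowo //; apply: q4.
  split.
  - split=> [k|j hj]; first by rewrite r2; case: ifP => // _; apply: hV.1.
    by rewrite r2 hj.
  - by move=> j hj; rewrite r2; case: ltnP => //; lia.
  - by rewrite r4 (nhas_add hi hh r3) hc ins0 addn0.
  - by left; rewrite r4; split=> // j hj; rewrite r2 hj.
  - move=> x zx dx k hk; rewrite r3; case: eqP => [-> _|/eqP hki hk0].
      rewrite -dx -(hd x zx); apply: eq_dotx => j hj; exact: rown.
    rewrite -(hx x zx dx k hk hk0); apply: eq_dotx => j hj; exact: rowo.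
rewrite sem_when (reduce_cond hI) hv hh.
have hV' := reduce_row_ok hb hN hO hi hR.1 hV.1.
have [q1 q2 q3 q4] := hR.2 i hi hh.
have n1 : sx (sem L reduce_row s') vN = n by rewrite keeps_varP.
have b1 : bounded L (sem L reduce_row s') by apply: bounded_sem.
have o1 : sx (sem L reduce_row s') vOff = i * n by rewrite keeps_varP.
have C1 : sa (sem L reduce_row s') Cls = sa s Cls by rewrite keeps_arrP.
have R1 : sa (sem L reduce_row s') Row = sa s' Row by rewrite keeps_arrP.
have H1 : sa (sem L reduce_row s') Has = sa s' Has by rewrite keeps_arrP.
have S1 : sx (sem L reduce_row s') vIns = sx s' vIns by rewrite keeps_varP.
change (gauss_inv s i.+1 (i * n) (sem L reduce_row s')).
move: (sem L reduce_row s') hV' n1 b1 o1 C1 R1 H1 S1 => s1 hV' n1 b1 o1 C1 R1 H1 S1.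
split.
  by split=> //; split=> [k|k]; rewrite /rowv R1 ?H1 ?C1 -?hC; [apply: hR.1|apply: hR.2].
split.
- split=> [k|j hj]; rewrite hV'.
    by case: ifP => // _; [apply: xorn_le1; [apply: hV.1|apply: hR.1]|apply: hV.1].
  rewrite hj C1 -hC => hx1.
  case: (posnP (sa s' Vec j)) => e1; last exact: hV.2.
  by apply: q4 => //; move: hx1; rewrite e1 /xorn; lia.
- move=> j; rewrite hV' ltnS leq_eqVlt => /orP[/eqP ->|hj].
    by rewrite hi vi1 q2.
  by case: ifP => // _; rewrite hz // q3.
- by rewrite S1 /nhas H1.
(* Row [i] vanishes at [x], so adding it does not change the value of the form. *)
- right; rewrite S1 R1 H1; split=> // x zx; rewrite -(hd x zx).
  have -> : dotx (sa s1 Vec) x = dotx (fun j => xorn (sa s' Vec j) (rowv s' i j)) x.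
    by apply: eq_dotx => j hj; rewrite hV' hj.
  rewrite dotx_xorn.
  have -> : dotx (rowv s' i) x = false by rewrite -(zx i hi) -?eH // /rowv eR.
  by rewrite addbF.
- by move=> x zx dx k hk; rewrite H1 => hk0; rewrite -(hx x zx dx k hk hk0) /rowv R1.
Qed.

(** If nothing was inserted, the vector ends up zero, so the form vanishes wherever the rows do. *)
Lemma gauss_ok s : bounded L s -> sx s vN = n -> rows_wf s -> vec_wf s ->
  let s' := sem L gauss s in
  [/\ rows_wf s' /\ (forall i, sa s' Vec i <= 1), sx s' vIns <= 1, nhas s' = nhas s + sx s' vIns,
      forall x, zero_rows s x -> dotx (sa s Vec) x = false -> zero_rows s' x
    & sx s' vIns = 0 -> forall x, zero_rows s x -> dotx (sa s Vec) x = false].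
Proof.
move=> hb hN hR hV.
have nL' : n <= L by apply: leq_trans nL; case: (n) => // k; rewrite leq_pmulr.
have : gauss_inv s n (n * n) (sem L gauss s).
  rewrite /gauss sem_seqs_cons sem_seqs_cons sem_seqs_cons sem_seqs_nil.
  apply: (@sem_for_ind _ _ _ _ _ (fun j => gauss_inv s j (j * n))).
      by rewrite /= !updE /= hN; apply/minn_idPl.
    split; first by split=> //; [do 2!apply: bounded_sem|rewrite /= updE /= min0n].
    split=> //; first by rewrite /= !updE /= min0n addn0.
    by right; rewrite /= !updE /= min0n.
  move=> j s' hj hs'.
  by apply: gauss_step_ok => //; apply: gauss_inv_setx hs' _ _ _ _ => //; lia.
move=> [[h1 h2 h3 h4 h5] [h6 h7 h8 h9 h10]]; split=> //.
    by split=> //; apply: h6.1.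
  by case: h9 => [[-> _]|[-> _ _ _]].
move=> i0 x zx; case: h9 => [[i1 _]|[_ _ _ hd]]; first by rewrite i1 in i0.
by rewrite -(hd x zx); apply: dotx0.
Qed.

End Gauss.

(** * The linear stage *)

Lemma keeps_var_load k u : k != vJ -> keeps_var k (load_vec u).
Proof. by move=> h; rewrite /= h keeps_var_seqs all_map all_predT. Qed.

Lemma keeps_arr_load a u : arr_id a != arr_id Vec -> keeps_arr a (load_vec u).
Proof.
move=> h; rewrite /= h keeps_arr_seqs all_map andbT.
by apply/allP => k _ /=.
Qed.

Lemma keeps_var_try k u : k < 4 -> keeps_var k (try_form u).
Proof.
move=> hk; have h : k != vJ by lia.
change ([&& true, keeps_var k (load_vec u), keeps_var k gauss & true]).
by rewrite keeps_var_load //; case: k hk {h} => [|[|[|[|]]]].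
Qed.

Section LinearStage.

Variables (L n m : nat) (R T cls par used Y0 : nat -> nat).
Hypothesis R_le : forall g k, g < m -> k < 3 -> R (4 * g + k) <= n.
Hypothesis T_le : forall i, T i <= 1.
Hypothesis nL : n < L.
Hypothesis nnL : n * n <= L.
Hypothesis mL : m <= L.
Hypothesis inv0 : inv_merge n m R T cls par used Y0.

Let L1 : 0 < L. Proof. by apply: leq_ltn_trans nL. Qed.
Let wf : wf_classes n cls par. Proof. by case: inv0. Qed.
Let par_le i : par i <= 1. Proof. by case: wf. Qed.

Local Notation uu := (uvar n R).
Local Notation gate_val := (gate_val R T).
Local Notation respects := (respects n cls par).

Definition root_form g h u (x : nat -> bool) :=
  \big[addb/false]_(k <- support6 u) x (cls (uu g h k)).

Definition par_form g h u :=
  \big[addb/false]_(k <- support6 u) odd (par (uu g h k)) (+) nth false u 6.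

Lemma formed_values g h u x : g < m -> h < m -> x n = false -> respects x ->
  formed n R T cls par g h u ->
  gate_val g x (+) (g != h) && gate_val h x = root_form g h u x (+) par_form g h u.
Proof.
move=> hg hh xn rx /allP /(_ (values n R g h x)).
rewrite mem_bits size_map size_iota => /(_ isT) /implyP H.
have /eqP := H (consistent_values R_le wf rx xn hg hh).
rewrite -[first3 _]/([seq x (R (4 * g + k)) | k <- iota 0 3]).
rewrite -[last3 _]/([seq x (R (4 * h + k)) | k <- iota 0 3]).
move=> ->; rewrite /dot7 -[7]/(6 + 1) iotaD big_cat big_seq1.
have -> : nth false (rcons (values n R g h x) true) (0 + 6) = true by [].
rewrite andbT /par_form addbA; congr (_ (+) _).
rewrite /root_form /support6 -big_split big_filter [RHS]big_mkcond; apply: eq_big_seq => k.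
rewrite mem_iota => /andP[_ hk]; case: (nth false u k); last by [].
rewrite andTb; rewrite nth_rcons size_map size_iota hk (nth_map 0) ?size_iota // nth_iota //.
by rewrite [LHS]rx // (uu_le R_le k hg hh).
Qed.

Lemma dotx_toggle (v : nat -> nat) c x : c <= n -> x n = false ->
  dotx n (upd v c (xorn (v c) 1)) x = dotx n v x (+) x c.
Proof.
move=> hc xn; case: (ltnP c n) => hcn; last first.
  have -> : c = n by lia.
  rewrite xn addbF; apply: eq_dotx => j hj; rewrite updE; case: eqP => // e; lia.
rewrite /dotx (bigD1 (Ordinal hcn)) //= [in RHS](bigD1 (Ordinal hcn)) //= updE eqxx odd_xorn /=.
rewrite (eq_bigr (fun j : 'I_n => odd (v j) && x j)); last first.
  move=> j hj; rewrite updE; case: eqP => // e; case/negP: hj; exact/eqP/val_inj.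
by case: (odd (v c)); case: (x c); case: (\big[_/_]_(_ < _ | _) _).
Qed.

Definition lin_ctx s :=
  [/\ ctx L n m R T s, [/\ sa s Cls = cls, sa s Par = par & sa s Used = used],
      rows_wf n s /\ (forall i, sa s Vec i <= 1), forall g, sa s Ys g <= 1
    & forall g, 0 < used g -> sa s Ys g = Y0 g].

Lemma load_vec_ok s g h u : lin_ctx s -> sx s vG = g -> sx s vH = h -> g < m -> h < m ->
  let s' := sem L (load_vec u) s in
  vec_wf n s' /\ forall x, x n = false -> dotx n (sa s' Vec) x = root_form g h u x.
Proof.
move=> [hc [hC hP hU] [hR hV] _ _] hG hH hg hh; rewrite /load_vec 2!sem_seqs_cons sem_seqs_nil.
set s1 := sem L (For _ _ _) s.
have [z1 v1] : (forall k, k < n -> sa s1 Vec k = 0) /\ (forall k, sa s1 Vec k <= 1).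
  pose P j s' := (forall k, k < j -> sa s' Vec k = 0) /\ (forall k, sa s' Vec k <= 1).
  suff : P n s1 by [].
  apply: sem_for_ind; first by case: hc => /= -> *; apply/minn_idPl; lia.
    by split.
  move=> j s' hj [h1 h2]; split=> k /=; rewrite !updE /= min0n; case: eqP => // e.
  by move=> hk; apply: h1; lia.
have c1 : ctx L n m R T s1 by apply: ctx_sem.
have G1 : sx s1 vG = g by rewrite keeps_varP.
have H1 : sx s1 vH = h by rewrite keeps_varP.
have C1 : sa s1 Cls = cls by rewrite keeps_arrP.
have cle k : cls (uu g h k) <= n by case: wf => w1 *; apply: w1; exact: (uu_le R_le k hg hh).
have croot k : cls (cls (uu g h k)) = cls (uu g h k) by case: wf => _ w2 *; apply: w2; exact: (uu_le R_le k hg hh).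
have w1 : vec_wf n s1 by split=> // j hj; rewrite z1.
have d1 x : dotx n (sa s1 Vec) x = false by apply: dotx0.
suff H l s2 r : ctx L n m R T s2 -> sx s2 vG = g -> sx s2 vH = h -> sa s2 Cls = cls -> vec_wf n s2 ->
    (forall x, x n = false -> dotx n (sa s2 Vec) x = r x) ->
    let s3 := sem L (seqs [seq Sto Vec (cE k) (xorE (EA Vec (cE k)) (EN 1)) | k <- l]) s2 in
    vec_wf n s3 /\ forall x, x n = false ->
       dotx n (sa s3 Vec) x = r x (+) \big[addb/false]_(k <- l) x (cls (uu g h k)).
  by have [h1 h2] := H (support6 u) s1 (fun=> false) c1 G1 H1 C1 w1 (fun x _ => d1 x); split.
move: s1 {z1 v1 c1 G1 H1 C1 w1 d1} => _.
elim: l s2 r => [|k l IH] s2 r c2 G2 H2 C2 w2 d2.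
  by split=> // x xn; rewrite big_nil addbF d2.
rewrite [map _ _]/= sem_seqs_cons; set s3 := sem L (Sto _ _ _) s2.
have V3 i : sa s3 Vec i = upd (sa s2 Vec) (cls (uu g h k)) (xorn (sa s2 Vec (cls (uu g h k))) 1) i.
  have [hN _ hRd _ _] := c2.
  rewrite /s3 /= ev_xor /= ev_c hN hRd G2 H2 C2 (minn_idPl _) //.
  by apply: leq_trans L1; apply: xorn_le1 => //; apply: w2.1.
have c3 : ctx L n m R T s3 by apply: ctx_sem.
have C3 : sa s3 Cls = cls by [].
have w3 : vec_wf n s3.
  split=> [i|j hj]; rewrite V3 updE; case: eqP => [e|_].
  - by apply: xorn_le1 => //; apply: w2.1.
  - exact: w2.1.
  - by rewrite C3 e croot.
  - by rewrite C3 -C2; apply: w2.2.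
have d3 x : x n = false -> dotx n (sa s3 Vec) x = r x (+) x (cls (uu g h k)).
  move=> xn; rewrite -d2 // -dotx_toggle //; apply: eq_dotx => j _; exact: V3.
have [h1 h2] := IH s3 _ c3 G2 H2 C3 w3 d3.
by split=> // x xn; rewrite h2 // big_cons addbA.
Qed.

Lemma use_form_ok s g h u : lin_ctx s -> sx s vG = g -> sx s vH = h -> g < m -> h < m -> used g = 0 ->
  let s' := sem L (use_form u) s in
  lin_ctx s' /\ exists ins : bool,
    [/\ forall i, sa s' Dn i = upd (sa s Dn) g 1 i,
        forall i, i != g -> sa s' Ys i = sa s Ys i,
        odd (sa s' Ys g) = ((g != h) && odd (sa s Ys h)) (+) ~~ ins (+) par_form g h u,
        nhas n s' = nhas n s + ins
      & (forall x, x n = false -> zero_rows n s x -> root_form g h u x = false -> zero_rows n s' x) /\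
        (ins = false -> forall x, x n = false -> zero_rows n s x -> root_form g h u x = false)].
Proof.
move=> ls hG hH hg hh ug.
rewrite /use_form 4!sem_seqs_cons sem_seqs_nil.
set s1 := sem L (Sto Dn _ _) s.
have l1 : lin_ctx s1 by case: ls => [c1 c2 c3 c4 c5]; split=> //; apply: ctx_sem.
have [w2 d2] := load_vec_ok u l1 hG hH hg hh.
set s2 := sem L (load_vec u) s1 in w2 d2 *.
have kv k : k < 4 -> sx s2 k = sx s k.
  by move=> hk; rewrite keeps_varP // keeps_var_load //; lia.
have ka a : arr_id a != arr_id Vec -> arr_id a != arr_id Dn -> sa s2 a = sa s a.
  by move=> h1 h2; rewrite keeps_arrP ?keeps_arr_load //= (negPf h2).
have [c1 c2 c3 c4 c5] := ls; have [hN hM hRd hTb hb] := c1.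
have b2 : bounded L s2 by do 2!apply: bounded_sem.
have n2 : sx s2 vN = n by rewrite kv.
have r2 : rows_wf n s2.
  by rewrite /rows_wf /rowv !ka //; apply: c3.1.
have [[r3 v3] i3 h3 z3 y3] := gauss_ok nnL L1 b2 n2 r2 w2.
have G3 : sx (sem L gauss s2) vG = g by rewrite keeps_varP // kv.
have H3 : sx (sem L gauss s2) vH = h by rewrite keeps_varP // kv.
have N3 : sx (sem L gauss s2) vN = n by rewrite keeps_varP // kv.
have M3 : sx (sem L gauss s2) vM = m by rewrite keeps_varP // kv.
have a3 a : all (fun b => arr_id a != arr_id b) [:: Row; Has; Vec; Dn] -> sa (sem L gauss s2) a = sa s a.
  rewrite [all _ _]/= => /and5P[e1 e2 e4 e5 _]; rewrite keeps_arrP ?ka //.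
  by rewrite /= e1 e2 e4.
have D3 : sa (sem L gauss s2) Dn = sa s1 Dn.
  by rewrite keeps_arrP // /s2 keeps_arrP // keeps_arr_load.
have b3 : bounded L (sem L gauss s2) by apply: bounded_sem.
have nh2 : nhas n s2 = nhas n s by rewrite /nhas ka.
have zr2 x : zero_rows n s2 x <-> zero_rows n s x by rewrite /zero_rows /rowv !ka.
move: (sem L gauss s2) r3 v3 i3 h3 z3 y3 G3 H3 N3 M3 a3 D3 b3 => s3 r3 v3 i3 h3 z3 y3 G3 H3 N3 M3 a3 D3 b3.
set e := xorE _ _; set s4 := sem L (Sto Ys _ e) s3.
have p3 : sa s3 Par = par by rewrite a3 //; case: c2.
have eY : minn (ev s3 e) L = ev s3 e /\ ev s3 e <= 1.
  have : ev s3 e <= 1.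
    rewrite /e !ev_xor ev_and ev_not; apply: xorn_le1; first exact: leq_b1.
    by apply: xorn_le1; [exact: leq_b1|apply: parE_le1 => i; rewrite p3].
  by move=> le1; split=> //; apply/minn_idPl; apply: leq_trans L1.
have Y4 i : sa s4 Ys i = upd (sa s Ys) g (ev s3 e) i by rewrite /s4 /= G3 eY.1 a3.
split.
  split.
  - by split=> //; [rewrite /= a3|rewrite /= a3|apply: bounded_sem].
  - by case: c2 => <- <- <-; rewrite /= !a3.
  - by split.
  - by move=> i; rewrite Y4 updE; case: eqP => // _; apply: eY.2.
  - by move=> i ui; rewrite Y4 updE; case: eqP => [ei|_]; [rewrite ei ug in ui|apply: c5].
exists (sx s3 vIns == 1).
have insE : sx s3 vIns = (sx s3 vIns == 1) :> nat by move: i3; case: (sx s3 vIns) => [|[|]].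
split.
- by move=> i; rewrite /s4 /= D3 /s1 /= hG (minn_idPl L1).
- by move=> i hi; rewrite Y4 updE (negPf hi).
- rewrite Y4 updE eqxx /e !ev_xor !odd_xorn ev_and truth_xor ev_not odd_parE /= G3 H3 N3.
  rewrite !a3 // hRd -/par -/(par_form g h u) /truth /= H3 a3 //.
  have -> : 0 < sa s Ys h = odd (sa s Ys h) by have := c4 h; case: (sa s Ys h) => [|[|]].
  have -> : 0 < sx s3 12 = (sx s3 12 == 1) by move: i3; case: (sx s3 12) => [|[|]].
  by rewrite !oddb addbA; case: c2 => _ -> _.
- by rewrite -[nhas n s4]/(nhas n s3) h3 nh2 {1}insE.
- split=> [x xn zx rx|i0 x xn zx].
    rewrite -[zero_rows n s4 x]/(zero_rows n s3 x); apply: z3; first exact/zr2.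
    by rewrite d2.
  rewrite -d2 //; apply: y3; last exact/zr2.
  by rewrite insE i0.
Qed.

Definition mismatch g s x := exists2 g', g' < g & gate_val g' x != odd (sa s Ys g').

(** The count sits inside the alternative on purpose: it fails after a dependent form, but by then
    every [x] is a mismatch. *)
Definition good g s := forall x, x n = false -> respects x ->
  mismatch g s x \/ zero_rows n s x /\ nused m (sa s Dn) <= nhas n s.

Definition complete g s := forall g', g' < g -> used g' = 0 -> sa s Dn g' = 0 ->
  forall h u, h <= g' -> used h = 0 -> u \in bits 7 -> ~~ formed n R T cls par g' h u.

Definition lin_inv g s :=
  [/\ lin_ctx s, forall g', g <= g' -> sa s Dn g' = 0, good g s & complete g s].

Definition lin_inner g (S : nat -> seq bool -> Prop) s :=
  [/\ lin_ctx s, forall g', g < g' -> sa s Dn g' = 0, complete g s &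
    [/\ sa s Dn g = 0, good g s & forall h u, S h u -> used h = 0 -> ~~ formed n R T cls par g h u] \/
    0 < sa s Dn g /\ good g.+1 s].

Lemma lin_ctx_setx s k i : k != vN -> k != vM -> i <= L -> lin_ctx s -> lin_ctx (setx s k i).
Proof. by move=> k1 k2 hi [h1 h2 h3 h4 h5]; split=> //; apply: ctx_setx. Qed.

Lemma try_form_ok s S g h u : lin_inner g S s -> sx s vG = g -> sx s vH = h -> g < m -> h <= g ->
  used g = 0 ->
  lin_inner g (fun h' u' => S h' u' \/ h' = h /\ u' = u) (sem L (try_form u) s).
Proof.
move=> [ls d0 cp hcase] hG hH hg hhg ug.
have hh : h < m by lia.
have [c1 [C1 P1 U1] c3 c4 c5] := ls; have [hN hM hRd hTb hb] := c1.
rewrite /try_form sem_when -/(truth _ _) truth_aff; last by rewrite hTb.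
rewrite hN hRd hTb C1 P1 U1 hG hH; case: ifP => [/and3P[/eqP Dg /eqP uh fm]|hf]; last first.
  split=> //; case: hcase => [[Dg gd hS]|]; [left|by right].
  split=> // h' u' [/hS //|[-> ->]] uh.
  by move: hf; rewrite Dg uh /= => ->.
case: hcase => [[_ gd hS]|[]]; last by rewrite Dg.
have [ls' [ins [hD hY hYg hn [hz1 hz2]]]] := use_form_ok u ls hG hH hg hh ug.
set s' := sem L (use_form u) s in ls' hD hY hYg hn hz1 hz2 *.
split=> //.
- by move=> g' hg'; rewrite hD updE; case: eqP => [e|_]; [lia|apply: d0].
- move=> g' hg'; rewrite hD updE; case: eqP => [e|_]; [lia|exact: cp].
right; rewrite hD updE eqxx; split=> // x xn rx.
have mono : mismatch g s x -> mismatch g.+1 s' x.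
  by case=> g' hg' hm; exists g'; [lia|rewrite hY //; lia].
case: (gd x xn rx) => [hm|[zx le]]; first by left; apply: mono.
(* If [h] already misses its output, that mismatch persists, since only the output of [g]
   changes. *)
case: (boolP ((g != h) && (gate_val h x != odd (sa s Ys h)))) => [/andP[ngh hm]|].
  by left; apply: mono; exists h => //; lia.
rewrite negb_and !negbK => eh.
(* So [g] matches exactly when the form equals [~~ ins]: it vanishes if independent, and it would
   have to be 1 if dependent. *)
have key : gate_val g x (+) odd (sa s' Ys g) = root_form g h u x (+) ~~ ins.
  have := formed_values hg hh xn rx fm; rewrite hYg; move: eh.
  case: eqP => [_ _|_ /= /eqP ->] /=; last first.
    by case: (gate_val g x); case: (odd _); case: (root_form _ _ _ _); case: (ins); case: (par_form _ _ _).
  by case: (gate_val g x); case: (root_form _ _ _ _); case: (ins); case: (par_form _ _ _).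
case e : (root_form g h u x).
  left; exists g => //; move: key; rewrite e.
  case ei : ins; first by case: (gate_val g x); case: (odd _).
  by move: e; rewrite (hz2 ei x xn zx).
case ei : ins.
  right; split; first exact: hz1.
  have -> : nused m (sa s' Dn) = nused m (upd (sa s Dn) g 1) by apply: eq_bigr => i _; rewrite hD.
  by rewrite hn ei; apply: leq_trans (nused_upd _ _ _ _) _; rewrite leq_add2r.
by left; exists g => //; move: key; rewrite e ei; case: (gate_val g x); case: (odd _).
Qed.

Lemma try_forms_ok s S g h l : lin_inner g S s -> sx s vG = g -> sx s vH = h -> g < m -> h <= g ->
  used g = 0 ->
  let s' := sem L (seqs [seq try_form u | u <- l]) s in
  lin_inner g (fun h' u' => S h' u' \/ h' = h /\ u' \in l) s' /\ sx s' vG = g.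
Proof.
move=> hs hG hH hg hh ug; elim: l s S hs hG hH => [|u l IH] s S hs hG hH.
  split=> //; case: hs => h1 h2 h3 h4; split=> //; case: h4 => [[q1 q2 q3]|]; [left|by right].
  by split=> // h' u' [|[]] //; apply: q3.
rewrite [map _ _]/= sem_seqs_cons.
have h1 := @try_form_ok s S g h u hs hG hH hg hh ug.
have G1 : sx (sem L (try_form u) s) vG = g.
  by rewrite keeps_varP // keeps_var_try.
have H1 : sx (sem L (try_form u) s) vH = h.
  by rewrite keeps_varP // keeps_var_try.
have [[q1 q2 q3 q4] q5] := IH _ _ h1 G1 H1.
split=> //; split=> //; case: q4 => [[p1 p2 p3]|]; [left|by right].
split=> // h' u' hS; apply: p3; case: hS => [|[-> ]]; first by left; left.
by rewrite inE => /orP[/eqP ->|]; [left; right|right].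
Qed.

Lemma linear_gate_ok s g : lin_inv g s -> sx s vG = g -> g < m -> lin_inv g.+1 (sem L linear_gate s).
Proof.
move=> [ls d0 gd cp] hG hg.
have [c1 [C1 P1 U1] c3 c4 c5] := ls; have [hN hM hRd hTb hb] := c1.
rewrite /linear_gate sem_when -/(truth _ _) truth_not /truth [ev _ (EA _ _)]/= hG U1.
have mono s' x : mismatch g s' x -> mismatch g.+1 s' x by case=> g' hg' hm; exists g' => //; lia.
have gdS s' : good g s' -> good g.+1 s'.
  by move=> h x xn rx; case: (h x xn rx) => [/mono|]; [left|right].
case: (posnP (used g)) => ug /=; last first.
  split=> //; [by move=> g' hg'; apply: d0; lia|exact: gdS|].
  move=> g'; rewrite ltnS leq_eqVlt => /orP[/eqP ->|]; last exact: cp.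
  by move=> u0; rewrite u0 in ug.
pose P j s' := lin_inner g (fun h u => h < j /\ u \in bits 7) s' /\ sx s' vG = g.
have : P g.+1 (sem L (For vH (EAdd (EX vG) (EN 1)) (seqs [seq try_form u | u <- bits 7])) s).
  apply: sem_for_ind; first by rewrite /= hG addn1; apply/minn_idPl; lia.
    split=> //; split=> //; first by move=> g' hg'; apply: d0; lia.
    by left; split=> // [|h u [] //]; apply: d0.
  move=> j s' hj [hp hG'].
  have hp1 : lin_inner g (fun h u => h < j /\ u \in bits 7) (setx s' vH j).
    by case: hp => p1 p2 p3 p4; split=> //; apply: lin_ctx_setx => //; lia.
  have [[q1 q2 q3 q4] q5] := @try_forms_ok _ _ g j (bits 7) hp1 hG' (erefl _) hg hj ug.
  split=> //; split=> //; case: q4 => [[p1 p2 p3]|]; [left|by right].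
  split=> // h u [hh hu]; apply: p3; move: hh; rewrite ltnS leq_eqVlt => /orP[/eqP e|hh].
    by right; split.
  by left; split.
move=> [[q1 q2 q3 q4] _]; split=> //; first by case: q4 => [[_ /gdS]|[]].
move=> g'; rewrite ltnS leq_eqVlt => /orP[/eqP -> _ D0 h u hh uh hu|]; last exact: q3.
case: q4 => [[_ _ p3]|[]]; last by rewrite D0.
by apply: p3.
Qed.

Lemma linear_stage_ok s : lin_inv 0 s -> lin_inv m (sem L linear_stage s).
Proof.
move=> h0; apply: sem_for_ind => //.
  by case: h0 => -[[_ /= -> _ _ _] _ _ _ _] _ _ _; apply/minn_idPl.
move=> j s' hj [q1 q2 q3 q4]; apply: linear_gate_ok => //.
by split=> //; apply: lin_ctx_setx => //; lia.
Qed.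

End LinearStage.

(** * No assignment survives *)

Section Conclusion.

Variables (L n m : nat) (R T cls par used Y0 : nat -> nat).
Hypothesis R_le : forall g k, g < m -> k < 3 -> R (4 * g + k) <= n.
Hypothesis inv0 : inv_merge n m R T cls par used Y0.
Hypothesis stable0 : forall g h t, g < m -> h < m -> t \in choices -> ~~ cand n R T cls par used g h t.

Local Notation F := (class_val R T cls par).
Local Notation uu := (uvar n R).

Let wf : wf_classes n cls par. Proof. by case: inv0. Qed.

Definition gclass g k := cls (R (4 * g + k)).

(** Complement bits are absorbed into the table, so a gate becomes a plain table on class
    representatives. *)
Definition gtable g := table_of 3 (fun z => tbval T g
  [seq nth false z k (+) odd (par (R (4 * g + k))) | k <- iota 0 3]).

Lemma class_val_table g v :
  F g v = tabv (gtable g) [:: v (gclass g 0); v (gclass g 1); v (gclass g 2)].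
Proof. by rewrite /gtable tabv_table3. Qed.

Lemma wild_single g : g < m -> used g = 0 ->
  (forall u, u \in bits 7 -> ~~ formed n R T cls par g g u) ->
  ~ gate_tame n (F g) [:: gclass g 0; gclass g 1; gclass g 2].
Proof.
move=> hg ug hf.
have sub : {subset [:: gclass g 0; gclass g 1; gclass g 2] <= [seq cls (uu g g k) | k <- iota 0 6]}.
  by move=> c hc; apply/mapP; move: hc; rewrite !inE => /or3P[] /eqP ->; [exists 0|exists 1|exists 2].
case=> [/(gate_sum_sub sub) h|[a /(gate_forced_sub sub) h]].
  have [|u hu fu] := @sum_formed n R T cls par g g wf.
    case: h => ls [c [h1 h2]]; exists ls, c; split=> // v hv.
    by rewrite eqxx addbF h2.
  by have := hf u hu; rewrite fu.
have [||||t ht ct] := @forced_cand n R T cls par used g g a a wf => //.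
- by rewrite !eqxx.
- case: h => P [Q [c [h1 h2 h3 h4 h5]]]; exists P, Q, c; split=> // v hv.
  by rewrite andbb; apply: h5.
- by have := stable0 hg hg ht; rewrite ct.
Qed.

Lemma gate_classes_uniq g : g < m -> used g = 0 ->
  (forall u, u \in bits 7 -> ~~ formed n R T cls par g g u) ->
  uniq [:: n; gclass g 0; gclass g 1; gclass g 2].
Proof.
move=> hg ug hf; apply: (@wild_gate_uniq n (F g) (gtable g)) (wild_single hg ug hf) => v hv.
exact: class_val_table.
Qed.

Lemma gclass_le g k : g < m -> k < 3 -> gclass g k <= n.
Proof. by move=> hg hk; case: wf => w1 *; apply: w1; apply: R_le. Qed.

Lemma gclass_root g k : g < m -> k < 3 -> cls (gclass g k) = gclass g k.
Proof. by move=> hg hk; case: wf => _ w2 *; apply: w2; apply: R_le. Qed.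

Lemma wild_pair g h P Q : h < g -> g < m -> used g = 0 -> used h = 0 ->
  (forall u, u \in bits 7 -> ~~ formed n R T cls par g g u) ->
  (forall u, u \in bits 7 -> ~~ formed n R T cls par h h u) ->
  (forall u, u \in bits 7 -> ~~ formed n R T cls par g h u) ->
  P != Q -> P \in [seq gclass g k | k <- iota 0 3] -> Q \in [seq gclass g k | k <- iota 0 3] ->
  P \in [seq gclass h k | k <- iota 0 3] -> Q \in [seq gclass h k | k <- iota 0 3] -> False.
Proof.
move=> hhg hg ug uh fg fh fgh hPQ Pg Qg Ph Qh.
have hh : h < m by lia.
have ngh : g != h by lia.
have E : [:: gclass g 0; gclass g 1; gclass g 2] ++ [:: gclass h 0; gclass h 1; gclass h 2]
       = [seq cls (uu g h k) | k <- iota 0 6] by [].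
(* Three distinct classes below [n] exist, so the guard that admits pairs of gates is satisfied. *)
have n1 : 1 < n.
  have := gate_classes_uniq hg ug fg; rewrite /= !inE !negb_or.
  have := gclass_le hg (isT : 0 < 3); have := gclass_le hg (isT : 1 < 3); have := gclass_le hg (isT : 2 < 3).
  lia.
apply: (@wild_gates_share n (F g) (F h) (gtable g) (gtable h) (gclass g) (gclass h) P Q) => //.
- by move=> v _; apply: class_val_table.
- by move=> v _; apply: class_val_table.
- exact: wild_single.
- exact: wild_single.
- rewrite E => hs; have [|u hu fu] := @sum_formed n R T cls par g h wf.
    by rewrite ngh.
  by have := fgh u hu; rewrite fu.
- move=> a b; rewrite E => hs.
  have guard : (g == h) && (a == b) || (g != h) && (1 < n) by rewrite ngh n1 orbT.
  have [t ht ct] := @forced_cand n R T cls par used g h a b wf guard ug uh hs.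
  by have := stable0 hg hh ht; rewrite ct.
Qed.

Variable s : state.
Hypothesis lin : lin_inv L n m R T cls par used Y0 m s.

Let wild g := (used g == 0) && (sa s Dn g == 0).

Lemma wild_formed g h u : g < m -> wild g -> h <= g -> used h = 0 -> u \in bits 7 ->
  ~~ formed n R T cls par g h u.
Proof. by move=> hg /andP[/eqP ug /eqP dg] hh uh hu; case: lin => _ _ _ cp; apply: cp. Qed.

Lemma count_wild :
  6 * \sum_(g < m) wild g + nroots n cls <= nroots n cls * nroots n cls.
Proof.
pose A := [set g : 'I_m | wild g].
pose RR := [set i : 'I_n.+1 | (i < n) && (cls i == i)].
pose cl (g : 'I_m) (k : 'I_3) : 'I_n.+1 := inord (gclass g k).
have clE (g : 'I_m) (k : 'I_3) : cl g k = gclass g k :> nat by rewrite inordK // ltnS gclass_le.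
have cA : \sum_(g < m) wild g = #|A|.
  by rewrite -sum1_card [RHS]big_mkcond; apply: eq_bigr => g _; rewrite inE; case: (wild g).
have cR : nroots n cls = #|RR|.
  rewrite -sum1_card big_mkcond /= big_ord_recr /= inE /= ltnn /= addn0.
  by apply: eq_bigr => i _; rewrite inE /= ltn_ord /=; case: (_ == _).
have wu (g : 'I_m) : g \in A -> uniq [:: n; gclass g 0; gclass g 1; gclass g 2].
  rewrite inE => wg; have /andP[/eqP ug _] := wg.
  by apply: gate_classes_uniq => // u hu; apply: wild_formed.
have inj (g : 'I_m) : g \in A -> forall i j : 'I_3, gclass g i = gclass g j -> i = j.
  move=> /wu; rewrite /= !inE !negb_or => /and4P[_ /andP[n1 n2] n3 _] i j e; apply: val_inj.
  move: e; case: i => -[|[|[|i]]] hi; case: j => -[|[|[|j]]] hj //= e; exfalso.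
  - by rewrite e eqxx in n1.
  - by rewrite e eqxx in n2.
  - by rewrite e eqxx in n1.
  - by rewrite e eqxx in n3.
  - by rewrite e eqxx in n2.
  - by rewrite e eqxx in n3.
rewrite cA cR; apply: (@linear_triples _ _ A RR cl).
- move=> g k hg; rewrite inE clE gclass_root // eqxx andbT.
  have := gclass_le (ltn_ord g) (ltn_ord k); rewrite leq_eqVlt => /orP[/eqP e|] //.
  move: (wu g hg); rewrite cons_uniq => /andP[/negP hn _]; case: hn; rewrite -e.
  by case: k {e} => -[|[|[|k]]] hk //; rewrite !inE eqxx ?orbT.
- by move=> g hg i j /(congr1 (@nat_of_ord _)); rewrite !clE; apply: inj.
- move=> g h i j i' j' hg hh hij /(congr1 (@nat_of_ord _)) e1 /(congr1 (@nat_of_ord _)) e2.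
  rewrite !clE in e1 e2.
  have memc (g0 : 'I_m) (i0 : 'I_3) : gclass g0 i0 \in [seq gclass g0 k | k <- iota 0 3].
    by apply: map_f; rewrite mem_iota leq0n add0n ltn_ord.
  have nPQ : gclass g i != gclass g j by apply: contra_neq hij; apply: inj.
  have wg : wild g by rewrite inE in hg.
  have wh : wild h by rewrite inE in hh.
  have [/eqP ug _] := andP wg; have [/eqP uh _] := andP wh.
  have fg u : u \in bits 7 -> ~~ formed n R T cls par g g u by apply: wild_formed.
  have fh u : u \in bits 7 -> ~~ formed n R T cls par h h u by apply: wild_formed.
  apply: val_inj; case: (ltngtP g h) => // hgh; exfalso.
    apply: (@wild_pair h g (gclass g i) (gclass g j)) => //; try exact: memc.
    + by move=> u hu; apply: wild_formed => //; apply: ltnW.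
    + by rewrite e1; apply: memc.
    + by rewrite e2; apply: memc.
  apply: (@wild_pair g h (gclass g i) (gclass g j)) => //; try exact: memc.
  + by move=> u hu; apply: wild_formed => //; apply: ltnW.
  + by rewrite e1; apply: memc.
  + by rewrite e2; apply: memc.
Qed.

(** Here [u], [d], [w] count used, linear and wild gates, and [r] classes. Adding up gives
    [n * n + 7 * r <= n + r * r], which contradicts [r <= n] unless [r = 0]. Then [n <= 1], and the
    sharper budget leaves at most [n] gates. *)
Lemma final_count u d w r : u + 2 * r <= 2 * n -> (n <= 1 -> u + r <= n) -> d <= r ->
  6 * w + r <= r * r -> r <= n -> m <= u + d + w -> n * n + 11 * n <= 6 * m -> 0 < m -> False.
Proof.
move=> h1 h2 h3 h4 h5 h6 h7 h8.
have h9 : n * n + 7 * r <= n + r * r by lia.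
case: (posnP r) => [r0|rpos].
  subst r; case: (leqP n 1) => n1; last by nia.
  have := h2 n1; move: h9 h7; case: (n) n1 => [|[|]] //; lia.
nia.
Qed.

Lemma no_assignment x : n * n + 11 * n <= 6 * m -> 0 < m -> x n = false ->
  exists2 g, g < m & gate_val R T g x != odd (sa s Ys g).
Proof.
move=> hm m0 xn.
have [lc _ gd _] := lin.
have [_ _ snd cnt cnt1] := inv0.
have [_ [C1 _ _] [rw _] _ hY] := lc.
case: (boolP [exists g : 'I_m, gate_val R T g x != odd (sa s Ys g)]) => [/existsP[g hg]|].
  by exists g.
rewrite negb_exists => /forallP all_eq; exfalso.
have rx : respects n cls par x.
  apply: snd => // g hg ug; have := all_eq (Ordinal hg); rewrite negbK => /eqP ->.
  by rewrite /= hY.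
case: (gd x xn rx) => [[g hg]|[_ le]].
  by have := all_eq (Ordinal hg); rewrite negbK => ->.
have nh : nhas n s <= nroots n cls.
  apply: leq_sum => i _; case: (posnP (sa s Has i)) => // hi.
  by have [e _ _ _] := rw.2 i (ltn_ord i) hi; rewrite -C1 e eqxx.
apply: (@final_count (nused m used) (nused m (sa s Dn)) (\sum_(g < m) wild g) (nroots n cls)) => //.
- exact: leq_trans nh.
- exact: count_wild.
- exact: nroots_le.
- rewrite /nused -!big_split /= -[X in X <= _]card_ord -sum1_card; apply: leq_sum => g _.
  by rewrite /wild; case: (used g); case: (sa s Dn g).
Qed.

End Conclusion.

(** * Input and output *)

Definition gate_data := (seq nat * seq nat)%type.
Definition no_gate : gate_data := ([::], [::]).
Definition data_code (d : gate_data) := size d.1 :: d.1 ++ d.2.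

Definition data_wf n (d : gate_data) :=
  [/\ size d.1 <= 3, all (leq^~ n) d.1, size d.2 = 2 ^ size d.1 & all (leq^~ 1) d.2].

Section Reading.

Variables (L n m : nat) (ds : seq gate_data).
Hypothesis ds_wf : forall d, d \in ds -> data_wf n d.
Hypothesis ds_size : size ds = m.
Hypothesis nL : n <= L.
Hypothesis mL : m <= L.
Hypothesis L1 : 0 < L.

Lemma read_var_ok s k rs rest : sx s vR = size rs -> sx s vN = n ->
  si s = drop k rs ++ rest -> all (leq^~ n) rs ->
  let s' := sem L (read_var k) s in
  [/\ si s' = drop k.+1 rs ++ rest,
      forall i, sa s' Rd i = if i == 4 * sx s vG + k then nth n rs k else sa s Rd i
    & forall a, arr_id a != arr_id Rd -> sa s' a = sa s a].
Proof.
move=> hr hn hs hle; rewrite /read_var 2!sem_seqs_cons sem_seqs_nil.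
have E : truth s (ltE (EN k) (EX vR)) = (k < size rs) by rewrite truth_lt /= hr.
rewrite [sem L (When (ltE _ _) _) s]sem_when -/(truth _ _) E.
case: (ltnP k (size rs)) => hk.
  set s1 := sem L (Seq _ _) s.
  have F : truth s1 (notE (ltE (EN k) (EX vR))) = false.
    by rewrite truth_not truth_lt -[ev s1 (EX 9)]/(sx s1 9) -[ev s1 (EN k)]/k /s1 keeps_varP // hr hk.
  rewrite sem_when -/(truth _ _) F /s1 /=.
  have hs1 : si s = nth n rs k :: (drop k.+1 rs ++ rest) by rewrite hs (drop_nth n hk).
  rewrite hs1 ev_rd_at /= !updE /=; split=> //.
    move=> i; rewrite updE; case: eqP => // _; apply/minn_idPl; apply: leq_trans nL.
    by apply: (allP hle); apply: mem_nth.
  by move=> a /negPf ->.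
rewrite sem_when -/(truth _ _) truth_not E ltnNge hk /= ev_rd_at; split.
- by rewrite hs !drop_oversize //; lia.
- by move=> i; rewrite updE hn (minn_idPl nL) nth_default.
- by move=> a /negPf ->.
Qed.

Lemma bits_needed_lt i r : i < 8 -> r <= 3 -> (bits_needed i < r + 1) = (i < 2 ^ r).
Proof. by case: r => [|[|[|[|]]]] //; case: i => [|[|[|[|[|[|[|[|]]]]]]]]. Qed.

(** Bits that a short table lacks are not written; their cells must still be 0 to agree with the
    default of [nth]. *)
Lemma read_bit_ok s i r tb rest : sx s vR = r -> r <= 3 -> i < 8 -> size tb = 2 ^ r ->
  si s = drop i tb ++ rest -> all (leq^~ 1) tb -> sa s Tb (8 * sx s vG + i) = 0 ->
  let s' := sem L (read_bit i) s in
  [/\ si s' = drop i.+1 tb ++ rest,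
      forall x, sa s' Tb x = if x == 8 * sx s vG + i then nth 0 tb i else sa s Tb x
    & forall a, arr_id a != arr_id Tb -> sa s' a = sa s a].
Proof.
move=> hr hr3 hi ht hs hle h0; rewrite /read_bit sem_when -/(truth _ _) truth_lt /= hr bits_needed_lt //.
rewrite -ht; case: ltnP => hk.
  have hs1 : si s = nth 0 tb i :: (drop i.+1 tb ++ rest) by rewrite hs (drop_nth 0 hk).
  rewrite hs1 ev_tb_at /= !updE /=; split=> //.
    move=> x; rewrite updE; case: eqP => // _; apply/minn_idPl; apply: leq_trans L1.
    by apply: (allP hle); apply: mem_nth.
  by move=> a /negPf ->.
split=> //; first by rewrite hs !drop_oversize //; lia.
by move=> x; case: eqP => // ->; rewrite h0 nth_default.
Qed.

Lemma read_vars_ok s rs rest k len : sx s vR = size rs -> sx s vN = n ->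
  si s = drop k rs ++ rest -> all (leq^~ n) rs ->
  let s' := sem L (seqs [seq read_var k | k <- iota k len]) s in
  [/\ si s' = drop (k + len) rs ++ rest,
      forall j, j < len -> sa s' Rd (4 * sx s vG + (k + j)) = nth n rs (k + j),
      forall i, (i < 4 * sx s vG + k) || (4 * sx s vG + k + len <= i) -> sa s' Rd i = sa s Rd i
    & forall a, arr_id a != arr_id Rd -> sa s' a = sa s a].
Proof.
elim: len k s => [|len IH] k s hr hn hs hle; first by split=> //; rewrite addn0.
rewrite [map _ _]/= sem_seqs_cons.
have [s1 s2 s3] := read_var_ok hr hn hs hle.
have hr1 : sx (sem L (read_var k) s) vR = size rs by rewrite keeps_varP.
have hn1 : sx (sem L (read_var k) s) vN = n by rewrite keeps_varP.
have hg1 : sx (sem L (read_var k) s) vG = sx s vG by rewrite keeps_varP.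
have [q1 q2 q3 q4] := IH k.+1 _ hr1 hn1 s1 hle.
rewrite hg1 in q2 q3; split.
- by rewrite q1 addSnnS.
- case=> [|j] hj; last by rewrite -addSnnS q2.
  by rewrite q3 ?s2 addn0 ?eqxx //; lia.
- move=> i hi; rewrite q3 ?s2; last by lia.
  by case: eqP => // e; lia.
- by move=> a ha; rewrite q4 // s3.
Qed.

Lemma read_bits_ok s r tb rest k len : sx s vR = r -> r <= 3 -> k + len = 8 -> size tb = 2 ^ r ->
  si s = drop k tb ++ rest -> all (leq^~ 1) tb ->
  (forall i, k <= i -> i < 8 -> sa s Tb (8 * sx s vG + i) = 0) ->
  let s' := sem L (seqs [seq read_bit i | i <- iota k len]) s in
  [/\ si s' = rest,
      forall x, sa s' Tb x = if 8 * sx s vG + k <= x < 8 * sx s vG + 8 then nth 0 tb (x - 8 * sx s vG)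
                             else sa s Tb x
    & forall a, arr_id a != arr_id Tb -> sa s' a = sa s a].
Proof.
move=> hr hr3; elim: len k s hr => [|len IH] k s hr hk ht hs hle h0.
  split=> //.
    have h8 : 2 ^ r <= 8 by rewrite (leq_exp2l r 3).
    by rewrite [sem _ _ _]/= hs drop_oversize // ht; lia.
  by move=> x; rewrite (_ : (_ && _) = false) //; lia.
rewrite [map _ _]/= sem_seqs_cons.
have k8 : k < 8 by lia.
have [s1 s2 s3] := read_bit_ok hr hr3 k8 ht hs hle (h0 k (leqnn k) k8).
have hr1 : sx (sem L (read_bit k) s) vR = r by rewrite keeps_varP.
have hg1 : sx (sem L (read_bit k) s) vG = sx s vG by rewrite keeps_varP.
have h1 i : k.+1 <= i -> i < 8 -> sa (sem L (read_bit k) s) Tb (8 * sx (sem L (read_bit k) s) vG + i) = 0.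
  by move=> hi1 hi2; rewrite hg1 s2 eqn_add2l (_ : (i == k) = false) ?h0 //; lia.
have hk1 : k.+1 + len = 8 by lia.
have [q1 q2 q3] := IH k.+1 _ hr1 hk1 ht s1 hle h1.
split=> //; last by move=> a ha; rewrite q3 // s3.
move=> x; rewrite q2 hg1 s2; case: eqP => [->|ne].
  have -> : (8 * sx s vG + k.+1 <= 8 * sx s vG + k < 8 * sx s vG + 8) = false by lia.
  have -> : (8 * sx s vG + k <= 8 * sx s vG + k < 8 * sx s vG + 8) = true by lia.
  by rewrite addKn.
by congr (if _ then _ else _); lia.
Qed.

Definition read_inv j s :=
  [/\ sx s vN = n /\ sx s vM = m, bounded L s, si s = flatten (map data_code (drop j ds)),
      forall g k, g < j -> k < 3 -> sa s Rd (4 * g + k) = nth n (nth no_gate ds g).1 k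
    & forall x, sa s Tb x = if x < 8 * j then nth 0 (nth no_gate ds (x %/ 8)).2 (x %% 8) else 0].

Lemma read_gate_ok j s : j < m -> read_inv j s -> sx s vG = j -> read_inv j.+1 (sem L read_gate s).
Proof.
move=> hj [[hN hM] hb hi hR hT] hG.
have hjd : j < size ds by rewrite ds_size.
set d := nth no_gate ds j.
have {}hi : si s = data_code d ++ flatten (map data_code (drop j.+1 ds)).
  by rewrite hi (drop_nth no_gate hjd).
have [d1 d2 d3 d4] := ds_wf (mem_nth no_gate hjd : d \in ds).
rewrite /read_gate 3!sem_seqs_cons sem_seqs_nil.
set s1 := sem L (Inp vR) s.
have i1 : si s1 = drop 0 d.1 ++ (d.2 ++ flatten (map data_code (drop j.+1 ds))).
  by rewrite /s1 /= hi drop0 /= -catA.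
have r1 : sx s1 vR = size d.1 by rewrite /s1 /= updE hi.
have [p1 p2 p3 p4] := @read_vars_ok s1 d.1 _ 0 3 r1 hN i1 d2.
have sG : sx s1 vG = j by [].
rewrite sG in p2 p3.
set s2 := sem L (seqs [seq read_var k | k <- iota 0 3]) s1 in p1 p2 p3 p4 *.
have G2 : sx s2 vG = j by rewrite keeps_varP.
have r2 : sx s2 vR = size d.1 by rewrite keeps_varP.
have i2 : si s2 = drop 0 d.2 ++ flatten (map data_code (drop j.+1 ds)).
  by rewrite p1 drop_oversize // drop0.
have T2 : sa s2 Tb = sa s Tb by rewrite p4.
have z2 i : 0 <= i -> i < 8 -> sa s2 Tb (8 * sx s2 vG + i) = 0.
  by move=> _ hi8; rewrite T2 G2 hT (_ : (_ < _) = false) //; lia.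
have [q1 q2 q3] := @read_bits_ok s2 (size d.1) d.2 _ 0 8 r2 d1 (erefl _) d3 i2 d4 z2.
have b2 : bounded L (sem L (seqs [seq read_bit i | i <- iota 0 8]) s2).
  by do 3!apply: bounded_sem.
have v3 k : k < 2 -> sx (sem L (seqs [seq read_bit i | i <- iota 0 8]) s2) k = sx s k.
  by case: k => [|[|]] // _; rewrite !keeps_varP.
have R3 : sa (sem L (seqs [seq read_bit i | i <- iota 0 8]) s2) Rd = sa s2 Rd by rewrite q3.
rewrite G2 in q2.
move: (sem L _ s2) q1 q2 q3 b2 v3 R3 => s3 q1 q2 q3 b2 v3 R3.
split=> //.
- by rewrite !v3.
- move=> g k; rewrite ltnS leq_eqVlt => /orP[/eqP ->|hg] hk.
    by have := p2 k hk; rewrite !add0n R3.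
  have lt : (4 * g + k < 4 * j + 0) || (4 * j + 0 + 3 <= 4 * g + k) by lia.
  by rewrite R3 p3 // -[sa s1 Rd]/(sa s Rd) hR.
- move=> x; rewrite q2 T2 addn0; case: (boolP (8 * j <= x < 8 * j + 8)) => hx.
    have -> : x < 8 * j.+1 by lia.
    have [-> ->] : x %/ 8 = j /\ x %% 8 = x - 8 * j by lia.
    by [].
  rewrite hT (_ : (x < 8 * j.+1) = (x < 8 * j)) //; lia.
Qed.

Lemma read_stage_ok s : sx s vN = n -> sx s vM = m -> bounded L s ->
  si s = flatten (map data_code ds) -> (forall x, sa s Tb x = 0) ->
  read_inv m (sem L read_stage s).
Proof.
move=> h1 h2 h3 h4 h5; apply: sem_for_ind.
    by rewrite /= h2; apply/minn_idPl.
  by split=> //; rewrite ?drop0.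
move=> j s' hj [[q1 q1'] q2 q3 q4 q5]; apply: read_gate_ok => //.
by split=> //; apply: bounded_setx => //; lia.
Qed.

End Reading.

Lemma print_stage_ok L m s : m <= L -> sx s vM = m -> bounded L s ->
  so (sem L print_stage s) = so s ++ [seq sa s Ys g | g <- iota 0 m].
Proof.
move=> mL hM hb.
pose P j s' := sa s' Ys = sa s Ys /\ so s' = so s ++ [seq sa s Ys g | g <- iota 0 j].
suff : P m (sem L print_stage s) by case.
apply: sem_for_ind.
    by rewrite /= hM; apply/minn_idPl.
  by split; rewrite ?cats0.
move=> j s' hj [e1 e2]; split=> //.
by rewrite -[j.+1]addn1 iotaD map_cat catA -e2 /= updE /= e1 -cats1.
Qed.

Lemma init_stage_ok L n s : sx s vN = n -> bounded L s -> n < L ->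
  forall i, i <= n -> sa (sem L init_stage s) Cls i = i.
Proof.
move=> hN hb hL.
pose P j s' := forall i, i < j -> sa s' Cls i = i.
suff H : P n.+1 (sem L init_stage s) by move=> i hi; apply: H.
apply: sem_for_ind => //; first by rewrite /= hN addn1; apply/minn_idPl.
move=> j s' hj h i hi /=; rewrite !updE /=; case: eqP => [->|ne]; first by apply/minn_idPl; lia.
by apply: h; lia.
Qed.

Lemma keeps_arr_merge a : all (fun b => arr_id a != arr_id b) [:: Cls; Par; Used; Ys] ->
  keeps_arr a merge_stage.
Proof.
move=> /and5P[h1 h2 h3 h4 _].
change (keeps_arr a (seqs [seq try_merge t | t <- choices])).
rewrite keeps_arr_seqs all_map; apply/allP => -[[[[b c] p] q] d] _ /=.
by rewrite h1 h2 h3 h4.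
Qed.

Lemma keeps_out_avoid : keeps_out (seqs [:: read_stage; init_stage; merge_stage; linear_stage]).
Proof.
change ([&& keeps_out read_stage, true, keeps_out (seqs [seq try_merge t | t <- choices]),
  keeps_out (seqs [seq try_form u | u <- bits 7]) & true]).
rewrite !keeps_out_seqs !all_map andbT; apply/and4P; split=> //.
Qed.

Lemma avoid_ok L n m ds s : (forall d, d \in ds -> data_wf n d) -> size ds = m ->
  n < L -> n * n <= L -> m <= L -> n * n + 11 * n <= 6 * m -> 0 < m ->
  sx s vN = n -> sx s vM = m -> bounded L s -> so s = [::] ->
  si s = flatten (map data_code ds) -> (forall a i, sa s a i = 0) ->
  let s' := sem L avoid s in
  exists Y : nat -> bool, so s' = [seq nat_of_bool (Y g) | g <- iota 0 m] /\
    forall x : nat -> bool, x n = false ->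
      exists2 g, g < m & let d := nth no_gate ds g in
        Y g != (0 < nth 0 d.2 (nat_of_bits [seq x (nth n d.1 k) | k <- iota 0 3])).
Proof.
move=> hds hsz nL nnL mL hm m0 hN hM hb ho hi ha.
have L1 : 0 < L by lia.
rewrite /avoid 5!sem_seqs_cons sem_seqs_nil.
have := read_stage_ok hds hsz (ltnW nL) mL L1 hN hM hb hi (ha Tb).
set s1 := sem L read_stage s => -[[N1 M1] b1 _ R1 T1].
have a1 a : arr_id a != arr_id Rd -> arr_id a != arr_id Tb -> forall i, sa s1 a i = 0.
  by move=> e1 e2 i; rewrite /s1 keeps_arrP ?ha //= e1 e2.
set s2 := sem L init_stage s1.
have C2 := init_stage_ok N1 b1 nL; rewrite -/s2 in C2.
have R_le g k : g < m -> k < 3 -> sa s2 Rd (4 * g + k) <= n.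
  move=> hg hk; rewrite /s2 keeps_arrP // R1 //.
  have hgd : g < size ds by rewrite hsz.
  have [_ h2 _ _] := hds _ (mem_nth no_gate hgd).
  case: (ltnP k (size (nth no_gate ds g).1)) => h; last by rewrite nth_default.
  by apply: (allP h2); apply: mem_nth.
have T2 x : sa s2 Tb x = if x < 8 * m then nth 0 (nth no_gate ds (x %/ 8)).2 (x %% 8) else 0.
  by rewrite /s2 keeps_arrP // T1.
have T_le x : sa s2 Tb x <= 1.
  rewrite T2; case: ifP => // hx.
  have hgd : x %/ 8 < size ds by rewrite hsz; lia.
  have [_ _ _ h4] := hds _ (mem_nth no_gate hgd).
  case: (ltnP (x %% 8) (size (nth no_gate ds (x %/ 8)).2)) => h; last by rewrite nth_default.
  by apply: (allP h4); apply: mem_nth.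
have c2 : ctx L n m (sa s2 Rd) (sa s2 Tb) s2.
  by split=> //; [rewrite keeps_varP|rewrite keeps_varP|apply: bounded_sem].
have z2 a : arr_id a != arr_id Rd -> arr_id a != arr_id Tb -> arr_id a != arr_id Cls -> forall i, sa s2 a i = 0.
  by move=> e1 e2 e3 i; rewrite /s2 keeps_arrP ?a1.
have inv2 : inv_merge_st n m (sa s2 Rd) (sa s2 Tb) s2.
  have nu : nused m (sa s2 Used) = 0 by apply: big1 => g _; rewrite z2.
  have nr := nroots_le n (sa s2 Cls).
  split.
  - split=> [i hi'|i hi'|i hi'||i]; rewrite ?C2 ?z2 //.
  - by move=> g; rewrite z2.
  - by move=> x xn _ i hi'; rewrite C2 // z2 // addbF.
  - by rewrite nu; lia.
  - by rewrite nu; lia.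
have [c3 inv3 st3] := merge_stage_ok R_le nL mL c2 inv2.
set s3 := sem L merge_stage s2 in c3 inv3 st3 *.
have z3 a : all (fun b => arr_id a != arr_id b) [:: Cls; Par; Used; Ys; Rd; Tb] -> forall i, sa s3 a i = 0.
  move=> hall i; rewrite /s3 keeps_arrP; last first.
    by apply: keeps_arr_merge; move: hall => /= /and5P[-> -> -> -> _].
  by move: hall => /= /and5P[e1 e2 e3 e4 /andP[e5 /andP[e6 _]]]; rewrite z2.
have l3 : lin_inv L n m (sa s2 Rd) (sa s2 Tb) (sa s3 Cls) (sa s3 Par) (sa s3 Used) (sa s3 Ys) 0 s3.
  split=> //; last by move=> x xn rx; right; split=> [i hi'|]; rewrite ?z3 // /nused big1 // => g _; rewrite z3.
    split=> //; last by case: inv3.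
    split; last by move=> i; rewrite z3.
    by split=> [i|i hi']; rewrite z3.
  by move=> g' _; rewrite z3.
have l4 := linear_stage_ok R_le T_le nL nnL mL inv3 l3.
have N4 := no_assignment R_le inv3 st3 l4.
have o4 : so (sem L linear_stage s3) = [::].
  have := @keeps_outP L _ s keeps_out_avoid.
  by rewrite 4!sem_seqs_cons sem_seqs_nil -/s1 -/s2 -/s3 ho.
have [[c4 _ _ Yb _] _ _ _] := l4.
have [_ M4 _ _ b4] := c4.
move: (sem L linear_stage s3) N4 o4 Yb M4 b4 => s4 N4 o4 Yb M4 b4.
exists (fun g => odd (sa s4 Ys g)); split.
  rewrite (print_stage_ok mL M4 b4) o4; apply: eq_map => g.
  by have := Yb g; case: (sa s4 Ys g) => [|[|]].
move=> x xn; have [g hg hne] := N4 x hm m0 xn; exists g => //; rewrite eq_sym.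
move: hne; rewrite /gate_val /tbval T2.
have -> : [seq x (sa s2 Rd (4 * g + k)) | k <- iota 0 3] = [seq x (nth n (nth no_gate ds g).1 k) | k <- iota 0 3].
  by apply/eq_in_map => k; rewrite mem_iota => /andP[_ hk]; rewrite /s2 keeps_arrP // R1.
set idx := nat_of_bits _.
have hidx : idx < 8 by rewrite /idx /=; do 3!case: (x _).
have -> : 8 * g + idx < 8 * m by lia.
by have [-> ->] : (8 * g + idx) %/ 8 = g /\ (8 * g + idx) %% 8 = idx by lia.
Qed.

(** * The machine *)

Definition double_code k : program := nseq k (Plus rL rL rL).

(* Reads [n] and [m], and sets the cut-off to [64 (n + m + 1)]. *)
Definition setup : program :=
  [:: Read (rV vN), Read (rV vM), Plus rL (rV vN) (rV vM), Const (rT 0) 1, Plus rL rL (rT 0)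
   & double_code 6].

Lemma double_code_ok k r : let r' := exec_regs r (double_code k) in
  [/\ r' rL = 2 ^ k * r rL, forall j, j != rL -> r' j = r j
    & cost_regs r (double_code k) <= k * (2 * (2 ^ k * r rL) + 2)].
Proof.
elim: k r => [|k IH] r; first by rewrite /= mul1n.
rewrite /double_code -[nseq _ _]/(Plus rL rL rL :: double_code k) exec_regs_cons cost_regs_cons.
have [h1 h2 h3] := IH (exec_reg r (Plus rL rL rL)).
have e : exec_reg r (Plus rL rL rL) rL = 2 * r rL by rewrite /exec_reg /= updE eqxx; lia.
rewrite e in h1 h3; split.
- by rewrite h1 expnS; lia.
- by move=> j hj; rewrite h2 // /exec_reg /= updE (negPf hj).
- have -> : cost_reg r (Plus rL rL rL) = bitlen (r rL) + bitlen (r rL) by [].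
  have := bitlen_le (r rL); move: h3; rewrite expnS [2 ^ k * _]mulnCA -mulnA.
  have : r rL <= 2 ^ k * r rL by rewrite leq_pmull // expn_gt0.
  move: (2 ^ k * r rL) (bitlen _) (cost_regs _ _) => u b c h0 h3 h4; lia.
Qed.

Definition start n m rest :=
  State (fun k => if k == vN then n else if k == vM then m else 0) (fun _ _ => 0) rest [::].

Lemma setup_ok q n m rest : let L := 64 * (n + m + 1) in
  exists r, [/\ reach (setup ++ q) (init [:: n, m & rest]) (100 * L.+1)
                  (Config (size setup) r rest [::]),
                agree r (start n m rest) & r rL = L].
Proof.
move=> L; set p := setup ++ q.
pose r2 := upd (upd (fun=> 0) (rV vN) n) (rV vM) m.
pose q1 := [:: Plus rL (rV vN) (rV vM); Const (rT 0) 1; Plus rL rL (rT 0)].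
have R1 : reach p (init [:: n, m & rest]) (n + m + 2) (Config 2 r2 rest [::]).
  apply: (@reach_trans _ _ n.+1 (Config 1 (upd (fun=> 0) (rV vN) n) (m :: rest) [::]) m.+1); last by lia.
    have := @reach_step p (init [:: n, m & rest]) (Read (rV vN)) n.+1 (erefl _).
    by apply; apply: bitlen_le.
  have := @reach_step p (Config 1 (upd (fun=> 0) (rV vN) n) (m :: rest) [::]) (Read (rV vM)) m.+1 (erefl _).
  by apply; apply: bitlen_le.
pose r3 := exec_regs r2 q1.
have v0 : r2 (rV vN) = n by rewrite /r2 !updE !loc_eq.
have v1 : r2 (rV vM) = m by rewrite /r2 !updE !loc_eq.
have r3E j : r3 j = if j == rL then n + m + 1 else if j == rT 0 then 1 else r2 j.
  rewrite /r3 /q1 !exec_regE /exec_reg /= !updE !loc_eq //= v0 v1.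
  by case: (j == rL).
have [d1 d2 d3] := double_code_ok 6 r3.
have e3 : r3 rL = n + m + 1 by rewrite r3E eqxx.
rewrite e3 in d1 d3.
exists (exec_regs r3 (double_code 6)); split.
- apply: (reach_trans R1 (N2 := 90 * L.+1)); last by rewrite /L; lia.
  rewrite -exec_regs_cat (_ : size setup = 2 + size (q1 ++ double_code 6)) //.
  apply: reach_plain => //.
    move=> i hi.
    have : code_at p 0 ([:: Read (rV vN); Read (rV vM)] ++ (q1 ++ double_code 6)).
      move=> k hk; rewrite add0n /p -[setup]/([:: Read (rV vN); Read (rV vM)] ++ (q1 ++ double_code 6)).
      by rewrite onth_cat hk.
    by case/code_at_cat => _ /(_ i hi).
  rewrite cost_regs_cat.
  have : cost_regs r2 q1 <= 5 * L.+1.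
    rewrite /q1 !cost_regE /cost_reg /exec_reg /= !updE !loc_eq //= v0 v1.
    by bitlens; rewrite /L; lia.
  by move: d3; rewrite -/r3 /L (_ : 2 ^ 6 = 64) //; move: (cost_regs _ _) (cost_regs _ _) => c1 c2; lia.
- split=> [k|a i].
    rewrite d2; last by rewrite loc_eq.
    by rewrite r3E !loc_eq //= /r2 !updE !loc_eq //=; case: k => [|[|k]].
  have ne k' i' : k' < 5 -> (rA a i == loc k' i') = false.
    move=> hk; have ha := arr_id_lt a; apply/negbTE/eqP.
    by rewrite /rA /loc; lia.
  by rewrite d2 ?ne // r3E !ne // /r2 !updE !ne.
- by rewrite d1 /L.
Qed.

Definition machine (c : cmd) : program := setup ++ compile 0 (size setup) c.

Lemma machine_ok c n m rest :
  let L := 64 * (n + m + 1) in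
  all (leq^~ L) rest ->
  exists2 t, t <= 100 * L.+1 + cost_cmd L c &
    outputs_in_time (machine c) [:: n, m & rest] (so (sem L c (start n m rest))) t.
Proof.
move=> L hrest.
have [r [R1 ha hL]] := setup_ok (compile 0 (size setup) c) n m rest.
have hc : code_at (machine c) (size setup) (compile 0 (size setup) c).
  by move=> i hi; rewrite /machine onth_cat ltnNge leq_addr addKn.
have hb : bounded L (start n m rest).
  by split=> //= k; case: eqP => _; [rewrite /L; lia|case: eqP => _; rewrite /L; lia].
have [r' [R2 ha' _]] := compile_ok hc ha hb hL.
have [t ht H] := reach_trans R1 R2 (leqnn _).
exists t => //.
exists (Config (size setup + size (compile 0 (size setup) c)) r' (si (sem L c (start n m rest)))
  (so (sem L c (start n m rest)))) => //.
rewrite -[t]addn0; apply: H; apply: run_halt.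
by rewrite /machine size_cat.
Qed.

(** * Circuits as input, and the theorem *)

Definition circuit_data k n m (C : circuit k n m) : seq gate_data :=
  [seq (map \val (reads g), encode_bits (table g)) | g <- C].

Lemma encode_circuitE k n m (C : circuit k n m) :
  encode_circuit C = [:: n, m & flatten (map data_code (circuit_data C))].
Proof.
rewrite /encode_circuit /circuit_data -map_comp; congr [:: _, _ & flatten _].
by apply: eq_map => g; rewrite /= /data_code /encode_gate size_map.
Qed.

Lemma circuit_data_wf n m (C : circuit 3 n m) d : d \in circuit_data C -> data_wf n d.
Proof.
rewrite /circuit_data; elim: (tval C) => //= g l IH; rewrite inE => /orP[/eqP ->|/IH //] {IH}.
case: g => rs tb uq sz st; split; rewrite /= ?size_map //.
  by apply/allP => _ /mapP[i _ ->]; apply: ltnW.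
by apply/allP => _ /mapP[b _ ->]; case: b.
Qed.

(** Padding inputs lie past the end of [x], so they read [false]; being high-order bits, they do not
    change the index into the table. *)
Lemma eval_gate_data n (g : gate 3 n) (x : n.-tuple bool) :
  eval_gate g x = (0 < nth 0 (encode_bits (table g))
    (nat_of_bits [seq nth false x (nth n (map \val (reads g)) k) | k <- iota 0 3])).
Proof.
have xn : nth false x n = false by rewrite nth_default // size_tuple.
have E (t : seq bool) i : (0 < nth 0 (encode_bits t) i) = nth false t i.
  case: (ltnP i (size t)) => hi; last by rewrite !nth_default ?size_map.
  by rewrite (nth_map false) //; case: (nth _ _ _).
rewrite /eval_gate; case: g => rs tb uq sz st /=; rewrite E; congr (nth _ _ _).
case: rs sz {uq st} => [|a [|b [|c [|]]]] //= _; rewrite ?xn //= !(tnth_nth false) //.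
Qed.

Lemma size_le_input_size s : size s <= input_size s.
Proof. by elim: s => //= a s IH; rewrite /input_size /= -add1n leq_add. Qed.

(** The number [n] is charged only by its bit length, so the input size is compared with [n] through
    [n <= m], which the density provides. *)
Lemma m_le_input_size k n m (C : circuit k n m) : m <= input_size (encode_circuit C).
Proof.
apply: leq_trans (size_le_input_size _); rewrite /encode_circuit /=.
apply: leq_trans (leqW (leqnSn _)); rewrite size_flatten /shape -map_comp.
rewrite -{1}(size_tuple C); elim: (tval C) => //= g l IH; lia.
Qed.

Lemma circuit_input_le n m (C : circuit 3 n m) L : n < L -> 3 <= L ->
  all (leq^~ L) (flatten (map data_code (circuit_data C))).
Proof.
move=> nL L3; apply/allP => v /flattenP[l /mapP[d hd ->]].
have [h1 h2 h3 h4] := circuit_data_wf hd.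
rewrite inE mem_cat => /or3P[/eqP ->|/(allP h2)|/(allP h4)]; lia.
Qed.

(** Denominators are cleared by a factor 6. *)
Lemma density_nat n m : (1 / 3%:R * 'C(n, 2)%:R + 2%:R * n%:R <= m%:R :> rat)%R ->
  n * n + 11 * n <= 6 * m.
Proof.
move=> h.
have {h} : (('C(n, 2) + 6 * n)%N%:R <= (3 * m)%N%:R :> rat)%R.
  by rewrite GRing.natrD !GRing.natrM; lra.
rewrite Num.Theory.ler_nat => h.
have : 'C(n, 2) * 2 = n * n.-1 by rewrite -[2]/(2`!) bin_ffact ffactnS ffactn1.
by case: (n) h => [|k] /=; nia.
Qed.

(** [0 < m] only excludes [n = m = 0], where the density holds but the range is everything; for
    [n > 0] the density implies it. *)
Theorem theoremA1 :
  exists (p : program) (c d : nat),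
  forall (n m : nat) (C : circuit 3 n m),
    0 < m ->
    (1 / 3%:R * 'C(n, 2)%:R + 2%:R * n%:R <= m%:R :> rat)%R ->
    exists (y : m.-tuple bool) (t : nat),
      [/\ outputs_in_time p (encode_circuit C) (encode_bits y) t,
          t <= c * input_size (encode_circuit C) ^ d + c
        & y \notin codom (eval C)].
Proof.
have [c [d hcd]] := poly_bounded_cost avoid.
(* [c] and [d] bound the compiled program, 100 the setup; the exponent [d.+1] is positive, so it
   also covers the linear cost of the setup. *)
exists (machine avoid), ((c + 100) * 193 ^ d.+1), d.+1 => n m C m0 /density_nat hm.
pose L := 64 * (n + m + 1); set S := input_size _.
have nm : n <= m by nia.
have nL : n < L by rewrite /L; lia.
have hin : all (leq^~ L) (flatten (map data_code (circuit_data C))) by apply: circuit_input_le; rewrite /L; lia.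
have [t ht ho] := machine_ok avoid hin.
have dsz : size (circuit_data C) = m by rewrite size_map size_tuple.
have hb : bounded L (start n m (flatten (map data_code (circuit_data C)))).
  by split=> //= k; case: eqP => _; [rewrite /L; lia|case: eqP => _; rewrite /L; lia].
(* Row offsets grow up to [n * n]; the density bounds this by [6 * m], so a cut-off linear in [m]
   suffices. *)
have nnL : n * n <= L by rewrite /L; lia.
have mL : m <= L by rewrite /L; lia.
have [Y [hY hno]] := avoid_ok (s := start n m _) (@circuit_data_wf n m C) dsz nL nnL mL hm m0 (erefl n) (erefl m) hb
  (erefl _) (erefl _) (fun _ _ => erefl _).
exists [tuple Y g | g < m], t; split.
- rewrite encode_circuitE; move: ho; rewrite -/L hY.
  congr (outputs_in_time _ _ _ _); by rewrite /encode_bits /= -map_comp -val_enum_ord -map_comp.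
- apply: leq_trans ht _; apply: leq_trans (leq_addr _ _).
  (* From [n <= m] and [0 < m], [L.+1 <= 128 * m + 65 <= 193 * m]. *)
  have hL : L.+1 <= 193 * S.
    have := m_le_input_size C; rewrite -/S /L; lia.
  have L0 : 0 < L.+1 ^ d by rewrite expn_gt0.
  rewrite -mulnA -expnMn mulnDl addnC; apply: leq_add.
    apply: leq_trans (hcd L) _; rewrite leq_mul2l; apply/orP; right.
    by apply: (@leq_trans (L.+1 ^ d.+1)); rewrite ?leq_exp2r // leq_pexp2l.
  rewrite leq_mul2l /=; apply: leq_trans hL _; rewrite -{1}[_ * S]expn1.
  by rewrite leq_pexp2l //; lia.
- apply/negP => /codomP[x hx].
  have xn : nth false x n = false by rewrite nth_default // size_tuple.
  have [g hg /eqP] := hno (fun i => nth false x i) xn; apply.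
  have hgC : g < size C by rewrite size_tuple.
  rewrite /circuit_data (nth_map (tnth C (Ordinal hg))) //= -eval_gate_data.
  have := congr1 (fun y => tnth y (Ordinal hg)) hx; rewrite !tnth_mktuple /= => ->.
  by congr (eval_gate _ x); apply: tnth_nth.
Qed.
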